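(* The \textsc{Subset Directed Feedback Vertex Set} problem can be solved in time $O^{*}(2^{O(k^3)})$, where $k$ is the parameter (the allowed size of the solution) and $O^{*}(\cdot)$ hides factors polynomial in the input size.
   Context: \textsc{Subset Directed Feedback Vertex Set}: the input is a directed graph $G$, a set $S\subseteq V(G)$ and a positive integer $k$; the question is whether there exists a set $T\subseteq V(G)$ with $|T|\le k$ such that $G\setminus T$ contains no closed walk passing through a vertex of $S$. (Equivalently, no cycle of $G\setminus T$ contains a vertex of $S$.) *)

(* Defs.v *)
From mathcomp Require Import all_boot.

Set Implicit Arguments.
Unset Strict Implicit.
Unset Printing Implicit Defensive.

(** Digraphs are relations on a finite type; loops are allowed. *)

Definition delete_vertices (V : finType) (e : rel V) (T : {set V}) : rel V :=
  [rel x y | [&& x \notin T, y \notin T & e x y]].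

(* [cycle e (x :: p)] asks for all arcs of the sequence [x :: p] and for the
   arc from its last vertex back to [x]; vertices may repeat, so this is a
   closed walk with at least one arc (the empty sequence meets no vertex). *)
Definition has_closed_walk_through (V : finType) (e : rel V) (S : {set V}) :
    Prop :=
  exists2 p : seq V, cycle e p & exists2 x : V, x \in S & x \in p.

Definition subset_dfvs (V : finType) (e : rel V) (S : {set V}) (k : nat) :
    Prop :=
  exists T : {set V},
    #|T| <= k /\ ~ has_closed_walk_through (delete_vertices e T) S.

(** A unit-cost random access machine: registers with direct addressing, and a
    memory accessed through addresses held in registers. All cells hold natural
    numbers. Every value present after [t] steps has at most [t] more bits
    than the input and program constants, because multiplication is not an
    instruction; hence unit-cost time is polynomially related to Turing machine
    time. *)

Inductive instr : Type :=
  | IConst (d c : nat)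
  | IAdd (d a b : nat)
  | ISub (d a b : nat)
  | IRead (d a : nat)
  | IWrite (a s : nat)
  | IJz (a l : nat).

Definition program := seq instr.

Record config : Type := Config {
  pc : nat;
  reg : nat -> nat;
  mem : nat -> nat
}.

Definition update (f : nat -> nat) (i v : nat) : nat -> nat :=
  fun j => if j == i then v else f j.

Definition exec_instr (i : instr) (s : config) : config :=
  let: Config p r m := s in
  match i with
  | IConst d c => Config p.+1 (update r d c) m
  | IAdd d a b => Config p.+1 (update r d (r a + r b)) m
  | ISub d a b => Config p.+1 (update r d (r a - r b)) m
  | IRead d a => Config p.+1 (update r d (m (r a))) m
  | IWrite a b => Config p.+1 r (update m (r a) (r b))
  | IJz a l => Config (if r a == 0 then l else p.+1) r m
  end.

(* [run P t s] is [Some s'] if [P], started in [s], halts in [s'] after at most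
   [t] instructions, and [None] otherwise; halting means that the program
   counter has left the program. *)
Fixpoint run (P : program) (t : nat) (s : config) : option config :=
  match onth P (pc s) with
  | None => Some s
  | Some i => if t is t'.+1 then run P t' (exec_instr i s) else None
  end.

Definition initial_config (input : seq nat) : config :=
  Config 0 (fun=> 0) (nth 0 input).

(* The answer is yes iff register 0 is nonzero on halting. *)
Definition decides_within (P : program) (input : seq nat) (answer : Prop)
    (t : nat) : Prop :=
  exists2 s : config, run P t (initial_config input) = Some s &
    (reg s 0 != 0 <-> answer).

(** The input: the number of vertices, the parameter, the adjacency matrix row
    by row, and the characteristic vector of [S]. *)

Definition encode (V : finType) (e : rel V) (S : {set V}) (k : nat) : seq nat :=
  #|V| :: k ::
    [seq nat_of_bool (e x y) | x <- enum V, y <- enum V] ++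
    [seq nat_of_bool (x \in S) | x <- enum V].

(* Total length of the binary representations; [0] and [1] have length 1. *)
Definition bit_size (input : seq nat) : nat :=
  \sum_(w <- input) (trunc_log 2 w).+1.

Definition bigO (f g : nat -> nat) : Prop :=
  exists c n0 : nat, forall n, n0 <= n -> f n <= c * g n.

Definition polynomially_bounded (g : nat -> nat) : Prop :=
  exists d : nat, bigO g (fun n => n ^ d).

(* Main.v *)
(** Iterative compression reduces the problem to finding a small solution [T]
    in a graph for which a solution [W], one vertex too large, is known. After
    splitting vertices into unit-capacity arcs, [T] becomes a set of arcs, and
    one separates [W] class by class: guess a class [L] of vertices of [W] that
    are strongly connected after the deletion of [T] and from which no other
    vertex of [W] is reachable, and cut a set [X] containing [L] off from the
    rest of [W] and from every node of [S] that still reaches [W]. Take the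
    furthest minimum cut for this. Either one of its arcs can be guessed to lie
    in [T], or the head of one of them is reachable from [X] in the presence of
    [T] and joins [X], so that the minimum cut grows, or [T] can be pushed onto
    the whole cut. If the minimum cut exceeds the remaining budget, then one of
    the first [budget + 1] sinks hit by a maximum flow, an [S]-node, is
    reachable from [X] under [T] and has to be cut off from [W]; this second
    kind of separation proceeds in the same way and ends with a deletion. This
    makes [O(k^2)] steps, each guided by [O(k)] guessed bits, so that trying all
    [2^O(k^3)] bit strings and testing every candidate suffices.

    The procedure is written in a language of bounded loops over square arrays,
    whose running time can be read off the syntax, and compiled to the machine. *)

Require Import Defs.
From mathcomp Require Import all_boot.
From mathcomp Require Import zify.
From Stdlib Require Import FunctionalExtensionality.

Set Implicit Arguments.
Unset Strict Implicit.
Unset Printing Implicit Defensive.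

(** * Structured machine code *)

(** Every candidate is tested, so the burden is completeness: some bit string must lead a trial to a
    solution. The solution [T] is never computed; [invariant] carries it existentially, and a push
    replaces it by another one, no larger. The obstacle is the length of a run. With [H = k + 2] the
    potential is [H * (3 * ka + #|W|) + (H - l)], where [l] bounds the current minimum cut from
    below: a joining node raises [l], a finished class lowers [#|W|], a deletion releases [3 * H].
    While an [S]-node is being cut off from [W], one [H] of these repays an overdraft made on entry,
    one restarts [l], and one is kept for restarting [l] on the way back. As [#|W| <= k + 1]
    initially, there are at most [(k + 2) * (4 * k + 2) + 1] steps, fewer than the square of
    [4 * k + 8]; a step reads [4 * k + 8] bits, whence the cube in the exponent. So few bits suffice
    for a choice among many nodes because a bit is addressed by the rank of a node within a
    candidate set of at most [k + 1] elements. The parameter is truncated to the number of vertices,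
    so that arrays of polynomial size can hold the guess. *)

Inductive scode :=
  | SI of instr
  | SSeq of scode & scode
  | SLoop of nat & scode.

Fixpoint slen s :=
  match s with
  | SI _ => 1
  | SSeq x y => slen x + slen y
  | SLoop _ x => (slen x).+3
  end.

(* Registers 1 and 2 are assumed to hold the constants 1 and 0. *)
Fixpoint scomp b s : program :=
  match s with
  | SI i => [:: i]
  | SSeq x y => scomp b x ++ scomp (b + slen x) y
  | SLoop c x =>
      IJz c (b + (slen x).+3) :: scomp b.+1 x ++ [:: ISub c c 1; IJz 2 b]
  end.

Lemma size_scomp b s : size (scomp b s) = slen s.
Proof.
elim: s b => [i|x IHx y IHy|c x IHx] b //=; rewrite size_cat ?IHx ?IHy //=.
by rewrite !addnS addn0.
Qed.

Notation regs := (nat -> nat).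
Notation memo := (nat -> nat).

Definition placed (P : program) b s :=
  exists p1 p2, P = p1 ++ scomp b s ++ p2 /\ size p1 = b.

(** Quantifying over the leftover fuel [f] makes the step counts of consecutive pieces add up;
    quantifying over the placement accommodates absolute jump targets. *)
Definition ok s (r : regs) (m : memo) t (r' : regs) (m' : memo) :=
  forall P b, placed P b s ->
  forall f, run P (t + f) (Config b r m) = run P f (Config (b + slen s) r' m').

Lemma onth_cat_size (T : Type) (p1 p2 : seq T) x : onth (p1 ++ x :: p2) (size p1) = Some x.
Proof. by elim: p1. Qed.

Lemma run_step P f b r m i : onth P b = Some i ->
  run P f.+1 (Config b r m) = run P f (exec_instr i (Config b r m)).
Proof. by move=> /= ->. Qed.

Definition jump i := if i is IJz _ _ then true else false.

Lemma ok_instr i r m : ~~ jump i ->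
  let: Config _ r' m' := exec_instr i (Config 0 r m) in ok (SI i) r m 1 r' m'.
Proof.
case: i => //= *; move=> P b [p1 [p2 [-> <-]]] f; rewrite add1n;
  by rewrite (run_step _ _ _ (onth_cat_size _ _ _)) /= addn1.
Qed.

Lemma ok_seq x y r m t r1 m1 t' r2 m2 :
  ok x r m t r1 m1 -> ok y r1 m1 t' r2 m2 -> ok (SSeq x y) r m (t + t') r2 m2.
Proof.
move=> hx hy P b [p1 [p2 [eP sb]]] f; rewrite -addnA hx; last first.
  by exists p1, (scomp (b + slen x) y ++ p2); rewrite eP /= -catA.
rewrite hy ?addnA //.
exists (p1 ++ scomp b x), p2; split; first by rewrite eP /= -!catA.
by rewrite size_cat size_scomp sb.
Qed.

Lemma ok_loop0 c x r m : r c = 0 -> ok (SLoop c x) r m 1 r m.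
Proof.
move=> rc P b [p1 [p2 [-> <-]]] f; rewrite add1n.
by rewrite (run_step _ _ _ (onth_cat_size _ _ _)) /= rc.
Qed.

Lemma ok_loopS c x r m t r1 m1 t' r2 m2 :
  r c != 0 -> ok x r m t r1 m1 -> r1 1 = 1 -> r1 2 = 0 -> c != 2 ->
  ok (SLoop c x) (update r1 c (r1 c - 1)) m1 t' r2 m2 ->
  ok (SLoop c x) r m (t + t' + 3) r2 m2.
Proof.
move=> rc hx h1 h2 c2 hl P b hP f.
have [p1 [p2 [eP sb]]] := hP.
have eP0 : P = p1 ++ IJz c (b + (slen x).+3) ::
    (scomp b.+1 x ++ [:: ISub c c 1, IJz 2 b & p2]).
  by rewrite eP /= -catA.
have o0 : onth P b = Some (IJz c (b + (slen x).+3)).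
  by rewrite eP0 -sb onth_cat_size.
have -> : t + t' + 3 + f = (t + (t' + f).+2).+1 by lia.
rewrite (run_step _ _ _ o0) /= (negbTE rc) hx; last first.
  exists (rcons p1 (IJz c (b + (slen x).+3))), [:: ISub c c 1, IJz 2 b & p2].
  by rewrite size_rcons sb eP0 -cats1 -catA.
have o1 : onth P (b.+1 + slen x) = Some (ISub c c 1).
  have -> : P = (p1 ++ IJz c (b + (slen x).+3) :: scomp b.+1 x) ++
     ISub c c 1 :: [:: IJz 2 b & p2] by rewrite eP0 /= -!catA.
  have -> : b.+1 + slen x = size (p1 ++ IJz c (b + (slen x).+3) :: scomp b.+1 x).
    by rewrite size_cat /= size_scomp sb addSn addnS.
  exact: onth_cat_size.
have o2 : onth P (b.+1 + slen x).+1 = Some (IJz 2 b).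
  have -> : P = (p1 ++ IJz c (b + (slen x).+3) :: scomp b.+1 x ++ [:: ISub c c 1]) ++
     IJz 2 b :: p2 by rewrite eP0 /= -!catA /= -!catA.
  have -> : (b.+1 + slen x).+1 =
     size (p1 ++ IJz c (b + (slen x).+3) :: scomp b.+1 x ++ [:: ISub c c 1]).
    by rewrite !size_cat /= size_cat size_scomp sb /=; lia.
  exact: onth_cat_size.
rewrite (run_step _ _ _ o1) [exec_instr _ _]/= (run_step _ _ _ o2) [exec_instr _ _]/= h1.
have -> : update r1 c (r1 c - 1) 2 = 0 by rewrite /update eq_sym (negbTE c2).
by rewrite eqxx hl.
Qed.

(** * Weakest preconditions with a time bound *)

Definition wp s B (Q : regs -> memo -> Prop) (r : regs) (m : memo) :=
  exists t r' m', [/\ ok s r m t r' m', t <= B & Q r' m'].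

Lemma wp_weaken s B B' (Q Q' : regs -> memo -> Prop) r m :
  wp s B Q r m -> B <= B' -> (forall r' m', Q r' m' -> Q' r' m') ->
  wp s B' Q' r m.
Proof.
move=> [t [r' [m' [h1 h2 h3]]]] hB hQ; exists t, r', m'; split=> //.
- exact: leq_trans hB.
- exact: hQ.
Qed.

Lemma wp_seq x y B1 B2 Q r m :
  wp x B1 (wp y B2 Q) r m -> wp (SSeq x y) (B1 + B2) Q r m.
Proof.
move=> [t [r1 [m1 [h1 h2 [t' [r2 [m2 [h3 h4 h5]]]]]]]].
by exists (t + t'), r2, m2; split; [apply: ok_seq h1 h3 | apply: leq_add | ].
Qed.

Lemma wp_const d c (Q : regs -> memo -> Prop) r m : Q (update r d c) m -> wp (SI (IConst d c)) 1 Q r m.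
Proof. by move=> h; do 3!eexists; split; [apply: (ok_instr (i := IConst d c)) | | exact: h]. Qed.
Lemma wp_add d a b (Q : regs -> memo -> Prop) r m : Q (update r d (r a + r b)) m -> wp (SI (IAdd d a b)) 1 Q r m.
Proof. by move=> h; do 3!eexists; split; [apply: (ok_instr (i := IAdd d a b)) | | exact: h]. Qed.
Lemma wp_sub d a b (Q : regs -> memo -> Prop) r m : Q (update r d (r a - r b)) m -> wp (SI (ISub d a b)) 1 Q r m.
Proof. by move=> h; do 3!eexists; split; [apply: (ok_instr (i := ISub d a b)) | | exact: h]. Qed.
Lemma wp_read d a (Q : regs -> memo -> Prop) r m : Q (update r d (m (r a))) m -> wp (SI (IRead d a)) 1 Q r m.
Proof. by move=> h; do 3!eexists; split; [apply: (ok_instr (i := IRead d a)) | | exact: h]. Qed.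
Lemma wp_write a b (Q : regs -> memo -> Prop) r m : Q r (update m (r a) (r b)) -> wp (SI (IWrite a b)) 1 Q r m.
Proof. by move=> h; do 3!eexists; split; [apply: (ok_instr (i := IWrite a b)) | | exact: h]. Qed.

(** Besides the body, a round costs the test, the decrement and the jump back; the final 1 is the
    test that exits. The body must restore the counter, and the next instance of the invariant is
    demanded after the decrement. *)
Lemma wp_loop c x n B (I : nat -> regs -> memo -> Prop) r m :
  r c = n -> c != 2 -> I 0 r m ->
  (forall i r m, i < n -> r c = n - i -> I i r m ->
     wp x B (fun r' m' => [/\ r' c = r c, r' 1 = 1, r' 2 = 0 &
        I i.+1 (update r' c (r' c - 1)) m']) r m) ->
  wp (SLoop c x) (n * (B + 3) + 1) (fun r' m' => r' c = 0 /\ I n r' m') r m.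
Proof.
move=> rc c2 I0 step.
suff H : forall j i r m, i + j = n -> r c = j -> I i r m ->
    wp (SLoop c x) (j * (B + 3) + 1) (fun r' m' => r' c = 0 /\ I n r' m') r m.
  by apply: (H n 0).
move=> j {r m rc I0}; elim: j => [|j IH] i r m hij rc hI.
  exists 1, r, m; split=> //; first exact: ok_loop0.
  by rewrite addn0 in hij; rewrite -hij.
have lt_i : i < n by lia.
have [|t [r1 [m1 [h1 h2 [e1 e2 e3 hI1]]]]] := step i r m lt_i _ hI; first by lia.
have hrc1 : update r1 c (r1 c - 1) c = j by rewrite /update eqxx e1 rc subn1.
have [|t' [r2 [m2 [h3 h4 h5]]]] := IH i.+1 _ _ _ hrc1 hI1; first by lia.
exists (t + t' + 3), r2, m2; split=> //; last by lia.
by apply: ok_loopS h3 => //; rewrite rc.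
Qed.

(** * A language of bounded loops and its compilation *)

Inductive expr :=
  | EV of nat
  | EC of nat
  | EN
  | EIn of expr
  | ERd of nat & expr & expr
  | EAdd of expr & expr
  | ESub of expr & expr
  | EIf of expr & expr & expr
  | ESum of expr.

Inductive cmd :=
  | CAsg of nat & expr
  | CSeq of cmd & cmd
  | CIf of expr & cmd
  | CFor of cmd
  | CRep of cmd.

Definition store := nat -> nat -> nat -> nat.

Definition upd (st : store) a (f : nat -> nat -> nat) : store :=
  fun b i j => if eqn b a then f i j else st b i j.

Section Semantics.
Variables (N R : nat) (inp : nat -> nat).

(** Reads outside the square give 0, so subscripts computed by a program need no bound of their
    own. *)
Definition rd (st : store) a i j := if (i < N) && (j < N) then st a i j else 0.

Fixpoint eval (st : store) (env : seq nat) e : nat :=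
  match e with
  | EV i => nth 0 env i
  | EC c => c
  | EN => N
  | EIn e => inp (eval st env e)
  | ERd a e1 e2 => rd st a (eval st env e1) (eval st env e2)
  | EAdd e1 e2 => eval st env e1 + eval st env e2
  | ESub e1 e2 => eval st env e1 - eval st env e2
  | EIf e1 e2 e3 =>
      if eval st env e1 != 0 then eval st env e2 else eval st env e3
  | ESum e => \sum_(x < N) eval st (val x :: env) e
  end.

Fixpoint exec c (env : seq nat) (st : store) : store :=
  match c with
  | CAsg a e => upd st a (fun i j => eval st [:: j, i & env] e)
  | CSeq x y => exec y env (exec x env st)
  | CIf e x => if eval st env e != 0 then exec x env st else st
  | CFor x => iteri N (fun i => exec x (i :: env)) st
  | CRep x => iter R (exec x env) st
  end.

End Semantics.

(* Registers: 1 and 2 hold the constants 1 and 0, 3 and 4 the two loop bounds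
   [N] and [R], 5 the first address after the input; registers from 6 on form
   a stack. *)
Definition sbool x := SSeq (SI (ISub x 1 x)) (SI (ISub x 1 x)).
Definition sdbl d := SI (IAdd d d d).
(** The 32 arrays are interleaved: entry [(x, y)] of array [a] lies at [(x * N + y) * 32 + a + OFF].
    Only [x * N] then needs a loop, and the factor 32 is five doublings. *)
Definition saddr a x y d :=
  SSeq (SI (IAdd d y 2)) (SSeq (SI (IAdd d.+1 x 2))
  (SSeq (SLoop d.+1 (SI (IAdd d d 3)))
  (SSeq (sdbl d) (SSeq (sdbl d) (SSeq (sdbl d) (SSeq (sdbl d) (SSeq (sdbl d)
  (SSeq (SI (IConst d.+1 a)) (SSeq (SI (IAdd d d d.+1)) (SI (IAdd d d 5))))))))))).
Definition sfor d x :=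
  SSeq (SI (IConst d 0)) (SSeq (SI (IAdd d.+1 3 2))
    (SLoop d.+1 (SSeq x (SI (IAdd d d 1))))).

(** The value ends up in register [d], and only registers from [d] on are changed. [env] lists the
    registers of the loop variables; an unbound variable falls back on register 2, which holds 0 as
    in [eval]. *)
Fixpoint cexpr e d (env : seq nat) : scode :=
  match e with
  | EV i => SI (IAdd d (nth 2 env i) 2)
  | EC c => SI (IConst d c)
  | EN => SI (IAdd d 3 2)
  (* Cells from [OFF] on belong to the arrays, so such addresses must yield 0 instead of being
     read. *)
  | EIn e => SSeq (cexpr e d env) (SSeq (SI (ISub d.+1 5 d)) (SSeq (sbool d.+1)
      (SSeq (SI (IConst d.+2 0)) (SSeq (SLoop d.+1 (SI (IRead d.+2 d)))
      (SI (IAdd d d.+2 2))))))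
  | ERd a e1 e2 => SSeq (cexpr e1 d env) (SSeq (cexpr e2 d.+1 env)
      (SSeq (SI (ISub d.+2 3 d)) (SSeq (sbool d.+2)
      (SSeq (SI (ISub d.+3 3 d.+1)) (SSeq (sbool d.+3)
      (SSeq (SI (IConst d.+4 0))
      (SSeq (SLoop d.+2 (SLoop d.+3
          (SSeq (saddr a d d.+1 (5 + d)) (SI (IRead d.+4 (5 + d))))))
      (SI (IAdd d d.+4 2)))))))))
  | EAdd e1 e2 => SSeq (cexpr e1 d env) (SSeq (cexpr e2 d.+1 env) (SI (IAdd d d d.+1)))
  | ESub e1 e2 => SSeq (cexpr e1 d env) (SSeq (cexpr e2 d.+1 env) (SI (ISub d d d.+1)))
  | EIf e1 e2 e3 => SSeq (cexpr e1 d.+1 env)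
      (SSeq (SI (ISub d.+2 1 d.+1)) (SSeq (SI (ISub d.+1 1 d.+2))
      (SSeq (SLoop d.+1 (SSeq (cexpr e2 d.+3 env) (SI (IAdd d d.+3 2))))
      (SLoop d.+2 (SSeq (cexpr e3 d.+3 env) (SI (IAdd d d.+3 2)))))))
  | ESum e => SSeq (SI (IConst d 0))
      (sfor d.+1 (SSeq (cexpr e d.+3 (d.+1 :: env)) (SI (IAdd d d d.+3))))
  end.

Fixpoint ccmd c d (env : seq nat) : scode :=
  match c with
  (* The new entries are first collected in array 0, because [e] may read [a]. *)
  | CAsg a e => SSeq
      (sfor d (sfor d.+2 (SSeq (cexpr e (4 + d) [:: d.+2, d & env])
         (SSeq (saddr 0 d d.+2 (5 + d)) (SI (IWrite (5 + d) (4 + d)))))))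
      (sfor d (sfor d.+2 (SSeq (saddr 0 d d.+2 (5 + d)) (SSeq (SI (IRead (4 + d) (5 + d)))
         (SSeq (saddr a d d.+2 (5 + d)) (SI (IWrite (5 + d) (4 + d))))))))
  | CSeq x y => SSeq (ccmd x d env) (ccmd y d env)
  | CIf e x => SSeq (cexpr e d env) (SSeq (sbool d) (SLoop d (ccmd x d.+1 env)))
  | CFor x => sfor d (ccmd x d.+2 (d :: env))
  | CRep x => SSeq (SI (IAdd d 4 2)) (SLoop d (ccmd x d.+1 env))
  end.

Section Cost.
Variables (N R : nat).

Fixpoint ecost e :=
  match e with
  | EV _ | EC _ | EN => 1
  | EIn e => ecost e + 10
  | ERd _ e1 e2 => ecost e1 + ecost e2 + 4 * N + 40
  | EAdd e1 e2 | ESub e1 e2 => ecost e1 + ecost e2 + 1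
  | EIf e1 e2 e3 => ecost e1 + ecost e2 + ecost e3 + 12
  | ESum e => N * (ecost e + 5) + 4
  end.

Fixpoint ccost c :=
  match c with
  | CAsg _ e => N * (N * (ecost e + 4 * N + 20) + 8) + N * (N * (8 * N + 40) + 8) + 6
  | CSeq x y => ccost x + ccost y
  | CIf e x => ecost e + ccost x + 6
  | CFor x => N * (ccost x + 4) + 3
  | CRep x => R * (ccost x + 3) + 2
  end.

End Cost.

(** * Correctness and cost of the compiled code *)

Lemma wp_le s B B' Q r m : wp s B Q r m -> B <= B' -> wp s B' Q r m.
Proof. by move=> h1 h2; apply: (wp_weaken h1 h2). Qed.

Lemma wp_cons s B (Q Q' : regs -> memo -> Prop) r m :
  wp s B Q r m -> (forall r' m', Q r' m' -> Q' r' m') -> wp s B Q' r m.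
Proof. by move=> h1 h2; apply: (wp_weaken h1 _ h2). Qed.

Lemma update_same r d v : update r d v d = v.
Proof. by rewrite /update eqxx. Qed.
Lemma update_other r d v x : x <> d -> update r d v x = r x.
Proof. by move=> /eqP h; rewrite /update (negbTE h). Qed.

Ltac updt := repeat first [rewrite update_same | rewrite update_other; last by lia].

Definition same d (r r' : regs) := forall x, x < d -> r' x = r x.

Lemma same_trans d r1 r2 r3 : same d r1 r2 -> same d r2 r3 -> same d r1 r3.
Proof. by move=> h1 h2 x hx; rewrite h2 ?h1. Qed.
Lemma same_le d d' r r' : d' <= d -> same d r r' -> same d' r r'.
Proof. by move=> hd h x hx; apply: h; apply: leq_trans hd. Qed.
Lemma same_upd d r r' x v : d <= x -> same d r r' -> same d r (update r' x v).
Proof. by move=> hd h y hy; rewrite update_other ?h //; lia. Qed.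

Section Compile.
Variables (N R OFF : nat) (inp : nat -> nat).
Hypothesis inp_out : forall x, OFF <= x -> inp x = 0.

Definition base (r : regs) := [/\ r 1 = 1, r 2 = 0, r 3 = N, r 4 = R & r 5 = OFF].

Lemma base_same d r r' : 6 <= d -> same d r r' -> base r -> base r'.
Proof.
by move=> hd h [h1 h2 h3 h4 h5]; split; rewrite h //; apply: leq_trans hd.
Qed.

Definition addr a i j := (i * N + j) * 32 + a + OFF.

Lemma addr_inj a i j a' i' j' : a < 32 -> a' < 32 -> j < N -> j' < N ->
  addr a i j = addr a' i' j' -> [/\ a = a', i = i' & j = j'].
Proof.
rewrite /addr => ha ha' hj hj' e.
have e1 : (i * N + j) * 32 + a = (i' * N + j') * 32 + a' by lia.
have ea : a = a' by move/(congr1 (modn^~ 32)): e1; rewrite !modnMDl !modn_small.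
have e2 : i * N + j = i' * N + j' by lia.
have ej : j = j' by move/(congr1 (modn^~ N)): e2; rewrite !modnMDl !modn_small.
split=> //; have N0 : 0 < N by apply: leq_ltn_trans hj.
by apply/eqP; rewrite -(eqn_pmul2r N0); apply/eqP; lia.
Qed.

Lemma addr_ge a i j : OFF <= addr a i j. Proof. by rewrite /addr leq_addl. Qed.

Lemma wp_saddr a x y d r m : base r -> 6 <= d -> x < d -> y < d -> r x <= N ->
  wp (saddr a x y d) (4 * N + 12)
    (fun r' m' => [/\ m' = m, same d r r' & r' d = addr a (r x) (r y)]) r m.
Proof.
move=> hb hd hx hy hN; have [b1 b2 b3 b4 b5] := hb.
apply: (@wp_le _ (1 + (1 + ((r x * (1 + 3) + 1) + 8)))); last by lia.
apply/wp_seq/wp_add/wp_seq/wp_add/wp_seq.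
apply: (wp_cons (wp_loop (n := r x) (B := 1)
  (I := fun i r' m' => [/\ m' = m, same d r r' & r' d = i * N + r y]) _ _ _ _)).
- by updt; rewrite b2 addn0.
- by lia.
- split=> //; last by updt; rewrite b2 addn0.
  by repeat (apply: same_upd; first by lia).
- move=> i r1 m1 hi hc [-> hs e]; apply: wp_add; have [c1 c2 c3 c4 c5] := base_same hd hs hb.
  split; updt => //; split=> //; updt.
    by repeat (apply: same_upd; first by lia).
  by rewrite e c3; lia.
move=> r1 m1 [_ [-> hs e]]; have [c1 c2 c3 c4 c5] := base_same hd hs hb.
apply: (@wp_le _ (1+(1+(1+(1+(1+(1+(1+1)))))))) => //.
do 5!(apply/wp_seq/wp_add); apply/wp_seq/wp_const/wp_seq/wp_add/wp_add.
split=> //; first by repeat (apply: same_upd; first by lia).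
by updt; rewrite e c5 /addr; lia.
Qed.

Lemma wp_sbool x r m : r 1 = 1 -> x <> 1 ->
  wp (sbool x) 2 (fun r' m' => [/\ m' = m, same x r r' & r' x = (r x != 0)]) r m.
Proof.
move=> r1 hx; apply: (@wp_le _ (1 + 1)) => //; apply/wp_seq/wp_sub/wp_sub.
split=> //; first by repeat (apply: same_upd; first by lia).
by updt; rewrite r1; case: (r x) => // n; rewrite subSS sub0n.
Qed.

(** The invariant may depend only on registers below [d]: the index, the counter and the scratch
    values of the body live above. *)
Lemma wp_for d x B (J : nat -> regs -> memo -> Prop) r m :
  base r -> 6 <= d ->
  (forall i r r' m, same d r r' -> J i r m -> J i r' m) ->
  J 0 r m ->
  (forall i r m, i < N -> base r -> r d = i -> J i r m ->
     wp x B (fun r' m' => [/\ r' d = r d, r' d.+1 = r d.+1, base r' & J i.+1 r' m']) r m) ->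
  wp (sfor d x) (N * (B + 4) + 3) (fun r' m' => base r' /\ J N r' m') r m.
Proof.
move=> hb hd Jext J0 step; have [b1 b2 b3 b4 b5] := hb.
apply: (@wp_le _ (1 + (1 + (N * ((B + 1) + 3) + 1)))); last by lia.
apply/wp_seq/wp_const/wp_seq/wp_add.
apply: (wp_cons (wp_loop (n := N) (B := B + 1)
  (I := fun i r' m' => [/\ base r', r' d = i & J i r' m']) _ _ _ _)).
- by updt; rewrite b3 b2 addn0.
- by lia.
- split; last 1 first.
  + apply: Jext J0; by repeat (apply: same_upd; first by lia).
  + apply: (base_same hd _ hb); by repeat (apply: same_upd; first by lia).
  + by updt.
- move=> i r1 m1 hi hc [hb1 ed hJ]; apply/wp_seq.
  apply: (wp_cons (step i r1 m1 hi hb1 ed hJ)) => r2 m2 [e1 e2 hb2 hJ2].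
  apply: wp_add; have [c1 c2 c3 c4 c5] := hb2.
  split; updt => //; split; updt.
  + apply: (base_same hd _ hb2); by repeat (apply: same_upd; first by lia).
  + by rewrite e1 ed c1 addn1.
  + apply: Jext hJ2; by repeat (apply: same_upd; first by lia).
by move=> r1 m1 [_ [h1 h2 h3]].
Qed.

(** Array 0 is left out: it is the buffer of assignments and holds no part of the store. *)
Definition rep (st : store) (m : memo) :=
  (forall a i j, 0 < a < 32 -> i < N -> j < N -> m (addr a i j) = st a i j)
  /\ (forall x, x < OFF -> m x = inp x).

Lemma map_same d r r' env : all (gtn d) env -> same d r r' ->
  [seq r' x | x <- env] = [seq r x | x <- env].
Proof. by move=> /allP h hs; apply/eq_in_map => x /h; apply: hs. Qed.

Fixpoint ewf e :=
  match e with
  | EV _ | EC _ | EN => true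
  | EIn e | ESum e => ewf e
  | ERd a e1 e2 => [&& 0 < a < 32, ewf e1 & ewf e2]
  | EAdd e1 e2 | ESub e1 e2 => ewf e1 && ewf e2
  | EIf e1 e2 e3 => [&& ewf e1, ewf e2 & ewf e3]
  end.

Fixpoint cwf c :=
  match c with
  | CAsg a e => (0 < a < 32) && ewf e
  | CSeq x y => cwf x && cwf y
  | CIf e x => ewf e && cwf x
  | CFor x | CRep x => cwf x
  end.

Lemma all_gtn_le d d' env : d <= d' -> all (gtn d) env -> all (gtn d') env.
Proof. by move=> h; apply: sub_all => x /= hx; apply: leq_trans hx h. Qed.

(** Compiled conditionals are loops whose counter is a truth value; one that is entered runs once
    and leaves 0 in the counter, hence [update r' c 0]. *)
Lemma wp_if1 (c : nat) x B (Q : regs -> memo -> Prop) (b : bool) (r : regs) (m : memo) :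
  r c = b :> nat -> c != 2 ->
  (b -> wp x B (fun r' m' => [/\ r' c = r c, r' 1 = 1, r' 2 = 0 &
        Q (update r' c 0) m']) r m) ->
  (~~ b -> Q r m) ->
  wp (SLoop c x) (B + 4) Q r m.
Proof.
case: b => rc c2 ht hf; last first.
  exists 1, r, m; split; [exact: ok_loop0 | by rewrite addnC | exact: hf].
apply: (@wp_le _ (1 * (B + 3) + 1)); last by lia.
apply: (wp_cons (wp_loop (n := 1) (B := B)
  (I := fun i r' m' => if i is 0 then r' = r /\ m' = m else Q r' m') _ _ _ _)) => //.
  move=> [|//] r1 m1 _ _ [-> ->]; apply: (wp_cons (ht isT)) => r2 m2 [e1 e2 e3 hQ].
  by split=> //; rewrite e1 rc.
by move=> r1 m1 [].
Qed.

Lemma wp_cexpr st e d env r m : base r -> 6 <= d -> ewf e -> rep st m ->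
  all (gtn d) env ->
  wp (cexpr e d env) (ecost N e)
    (fun r' m' => [/\ m' = m, same d r r' &
       r' d = eval N inp st [seq r x | x <- env] e]) r m.
Proof.
elim: e d env r => [i|c||e IH|a e1 IH1 e2 IH2|e1 IH1 e2 IH2|e1 IH1 e2 IH2|
   e1 IH1 e2 IH2 e3 IH3|e IH] d env r hb hd hw hr henv /=;
  have [b1 b2 b3 b4 b5] := hb.
- apply: wp_add; split=> //; first exact: same_upd.
  rewrite update_same b2 addn0; case: (ltnP i (size env)) => hi.
    by rewrite (nth_map 2).
  by rewrite !nth_default ?size_map.
- apply: wp_const; split=> //; first exact: same_upd.
  by rewrite update_same.
- apply: wp_add; split=> //; first exact: same_upd.
  by rewrite update_same b3 b2 addn0.
- apply: (@wp_le _ (ecost N e + (1 + (2 + (1 + ((1 + 4) + 1)))))); last by lia.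
  apply/wp_seq/(wp_cons (IH d env r hb hd hw hr henv)) => r1 _ [-> hs1 e1].
  have [c1 c2 c3 c4 c5] := base_same hd hs1 hb.
  apply/wp_seq/wp_sub/wp_seq; apply: (wp_cons (wp_sbool _ _ _)).
    + by updt.
    + by lia.
  move=> r2 _ [-> hs2 e2]; have hs2' := same_le (leqnSn d) hs2.
  apply/wp_seq/wp_const/wp_seq.
  have e2' : r2 d.+1 = (eval N inp st [seq r x | x <- env] e < OFF).
    by rewrite e2; updt; rewrite c5 e1; congr nat_of_bool; lia.
  have ed : r2 d = eval N inp st [seq r x | x <- env] e.
    by rewrite hs2 //; updt.
  have q1 : r2 1 = 1 by rewrite hs2; [updt|lia].
  have q2 : r2 2 = 0 by rewrite hs2; [updt|lia].
  apply: (wp_if1 (b := eval N inp st [seq r x | x <- env] e < OFF)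
    (Q := wp (SI (IAdd d d.+2 2)) 1 _)); first by updt.
  + by lia.
  + move=> hlt; apply: wp_read; split; updt => //.
      apply: wp_add; split=> //; last first.
        by updt; rewrite q2 addn0 ed; case: hr => _ ->.
      repeat (apply: same_upd; first by lia).
      by apply: same_trans hs1 (same_trans _ hs2'); apply: same_upd => //; lia.
  + rewrite -leqNgt => hge; apply: wp_add; split=> //; last first.
      by updt; rewrite q2 inp_out.
    repeat (apply: same_upd; first by lia).
    by apply: same_trans hs1 (same_trans _ hs2'); apply: same_upd => //; lia.
- move: hw => /and3P[ha hw1 hw2].
  apply: (@wp_le _ (ecost N e1 + (ecost N e2 + (1 + (2 + (1 + (2 + (1 +
     ((((4 * N + 12) + 1 + 4) + 4) + 1))))))))); last by lia.
  apply/wp_seq/(wp_cons (IH1 d env r hb hd hw1 hr henv)) => r1 _ [-> hs1 e1'].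
  have hb1 := base_same hd hs1 hb.
  apply/wp_seq/(wp_cons (IH2 d.+1 env r1 hb1 _ hw2 hr (all_gtn_le (leqnSn d) henv))).
    by lia.
  move=> r2 _ [-> hs2 e2'].
  have hb2 : base r2 by apply: base_same hs2 hb1; lia.
  have [c1 c2 c3 c4 c5] := hb2.
  set i := eval _ _ _ _ e1 in e1' *; set j := eval _ _ _ _ e2.
  rewrite (map_same henv hs1) -/j in e2'.
  have e1'' : r2 d = i by rewrite hs2.
  have s2 : same d r r2 by apply: same_trans hs1 (same_le (leqnSn d) hs2).
  apply/wp_seq/wp_sub/wp_seq; apply: (wp_cons (wp_sbool _ _ _)); first by updt.
    by lia.
  move=> r3 _ [-> hs3]; updt; rewrite c3 e1'' => e3.
  have f3 : forall x, x < d.+2 -> r3 x = r2 x by move=> x hx; rewrite hs3; [updt|].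
  apply/wp_seq/wp_sub/wp_seq; apply: (wp_cons (wp_sbool _ _ _)); first by updt; rewrite f3 //; lia.
    by lia.
  move=> r4 _ [-> hs4]; updt; rewrite !f3; [|lia..]; rewrite c3 e2' => e4.
  have e4' : r4 d.+2 = (i < N) by rewrite hs4 //; updt; rewrite e3; congr nat_of_bool; lia.
  have f4 : forall x, x < d.+2 -> r4 x = r2 x.
    by move=> x hx; rewrite hs4; [updt; apply: f3|lia].
  apply/wp_seq/wp_const/wp_seq.
  set r5 := update _ _ _.
  have s5 : same d.+2 r2 r5 by apply: same_upd; [lia|move=> x hx; apply: f4].
  have k2 : r5 d.+2 = (i < N) by rewrite /r5; updt.
  have k3 : r5 d.+3 = (j < N) by rewrite /r5; updt; rewrite e4; congr nat_of_bool; lia.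
  have k4 : r5 d.+4 = 0 by rewrite /r5; updt.
  clearbody r5; clear r4 e4 hs4 e4' f4.
  have hb5 : base r5 by apply: base_same s5 hb2; lia.
  have [g1 g2 g3 g4 g5] := hb5.
  apply: (wp_if1 (b := i < N) (Q := wp (SI (IAdd d d.+4 2)) 1 _) k2); first by lia.
  + move=> hi; apply: (wp_if1 (b := j < N) k3); first by lia.
    * move=> hj; apply: wp_seq.
      apply: (wp_cons (wp_saddr _ _ hb5 _ _ _ _)); [lia|lia|lia| |].
        by rewrite s5 // e1'' ltnW.
      move=> r6 _ [-> s6 e6]; apply: wp_read; updt.
      have [l1 l2 l3 l4 l5] := base_same (leq_trans hd (leq_addl 5 d)) s6 hb5.
      have f5 x : x < d.+4 -> r6 x = r5 x by move=> hx; apply: s6; lia.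
      split; updt => //; first by apply: f5.
      split; updt => //; first by apply: f5.
      apply: wp_add; split=> //; last first.
        updt; rewrite l2 addn0 e6 !s5 // e1'' e2' /rd hi hj /=.
        by case: hr => -> //.
      repeat (apply: same_upd; first by lia).
      move=> x hx; rewrite f5; last by lia.
      by rewrite s5; [apply: s2|lia].
    * move=> hj; split=> //.
      apply: wp_add; split=> //; last first.
        by updt; rewrite g2 k4 /rd (negbTE hj) andbF.
      repeat (apply: same_upd; first by lia).
      by move=> x hx; rewrite s5; [apply: s2|lia].
  + move=> hi; apply: wp_add; split=> //; last first.
      by updt; rewrite g2 k4 /rd (negbTE hi).
    apply: same_upd; first by lia.
    by move=> x hx; rewrite s5; [apply: s2|lia].
- move: hw => /andP[hw1 hw2]; rewrite -addnA.
  apply/wp_seq/(wp_cons (IH1 d env r hb hd hw1 hr henv)) => r1 _ [-> hs1 e1'].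
  have hb1 := base_same hd hs1 hb.
  apply/wp_seq/(wp_cons (IH2 d.+1 env r1 hb1 _ hw2 hr (all_gtn_le (leqnSn d) henv))).
    by lia.
  move=> r2 _ [-> hs2 e2']; apply: wp_add; split=> //.
    by apply: same_upd => //; apply: same_trans hs1 (same_le (leqnSn d) hs2).
  by updt; rewrite e2' hs2 // e1' (map_same henv hs1).
- move: hw => /andP[hw1 hw2]; rewrite -addnA.
  apply/wp_seq/(wp_cons (IH1 d env r hb hd hw1 hr henv)) => r1 _ [-> hs1 e1'].
  have hb1 := base_same hd hs1 hb.
  apply/wp_seq/(wp_cons (IH2 d.+1 env r1 hb1 _ hw2 hr (all_gtn_le (leqnSn d) henv))).
    by lia.
  move=> r2 _ [-> hs2 e2']; apply: wp_sub; split=> //.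
    by apply: same_upd => //; apply: same_trans hs1 (same_le (leqnSn d) hs2).
  by updt; rewrite e2' hs2 // e1' (map_same henv hs1).
- move: hw => /and3P[hw1 hw2 hw3].
  apply: (@wp_le _ (ecost N e1 + (1 + (1 + ((ecost N e2 + 1 + 4) + (ecost N e3 + 1 + 4))))));
    last by lia.
  apply/wp_seq/(wp_cons (IH1 d.+1 env r hb _ hw1 hr (all_gtn_le (leqnSn d) henv))).
    by lia.
  move=> r1 _ [-> hs1 e1']; have hs1' := same_le (leqnSn d) hs1.
  have hb1 := base_same hd hs1' hb; have [c1 c2 c3 c4 c5] := hb1.
  set v := eval _ _ _ _ e1 in e1' *.
  apply/wp_seq/wp_sub/wp_seq/wp_sub; updt; rewrite c1 e1'.
  set r2 := update _ _ _.
  have s2 : same d r1 r2 by repeat (apply: same_upd; first by lia).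
  have hb2 : base r2 by apply: base_same s2 hb1.
  have ed1 : r2 d.+1 = (v != 0) by rewrite /r2; updt; case: (v) => // n; rewrite subSS sub0n.
  have ed2 : r2 d.+2 = (v == 0) by rewrite /r2; updt; case: (v) => // n; rewrite subSS sub0n.
  apply/wp_seq/(wp_if1 (b := v != 0) (Q := wp (SLoop d.+2 _) _ _) ed1).
  + by lia.
  + move=> v0; apply/wp_seq/(wp_cons (IH2 d.+3 env r2 hb2 _ hw2 hr _)); first by lia.
      by apply: all_gtn_le henv; lia.
    move=> r3 _ [-> s3 e3']; have hb3 : base r3 by apply: base_same s3 hb2; lia.
    have [g1 g2 g3 g4 g5] := hb3.
    apply: wp_add; split; updt => //; first by rewrite s3.
    apply: (wp_if1 (b := v == 0)); updt.
    * by rewrite s3 // ed2.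
    * by lia.
    * by rewrite (negbTE v0).
    * move=> _; split=> //; last first.
        by updt; rewrite g2 addn0 v0 e3' (map_same henv s2) (map_same henv hs1').
      repeat (apply: same_upd; first by lia).
      move=> x hx; rewrite s3; last by lia.
      by rewrite s2 // hs1'.
  + rewrite negbK => v0; have hb2' := hb2; have [g1 g2 g3 g4 g5] := hb2.
    apply: (wp_if1 (b := v == 0) ed2).
    * by lia.
    * move=> _; apply/wp_seq/(wp_cons (IH3 d.+3 env r2 hb2 _ hw3 hr _)); first by lia.
        by apply: all_gtn_le henv; lia.
      move=> r3 _ [-> s3 e3']; have hb3 : base r3 by apply: base_same s3 hb2; lia.
      have [k1 k2 k3 k4 k5] := hb3.
      apply: wp_add; split; updt => //; first by rewrite s3.
      split=> //; last first.
        by updt; rewrite k2 addn0 v0 e3' (map_same henv s2) (map_same henv hs1').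
      repeat (apply: same_upd; first by lia).
      move=> x hx; rewrite s3; last by lia.
      by rewrite s2 // hs1'.
    * by rewrite v0.
- apply: (@wp_le _ (1 + (N * ((ecost N e + 1) + 4) + 3))); last by lia.
  apply/wp_seq/wp_const.
  set r0 := update _ _ _.
  have s0 : same d r r0 by apply: same_upd.
  have hb0 := base_same hd s0 hb.
  apply: (wp_cons (wp_for (B := ecost N e + 1) (J := fun i r' m' => [/\ m' = m, same d r r' &
     r' d = \sum_(x < i) eval N inp st (val x :: [seq r x | x <- env]) e]) hb0 _ _ _ _)).
  + by lia.
  + move=> i r1 r2 m1 hs [-> h1 h2]; split=> //.
      by apply: same_trans h1 (same_le (leqnSn d) hs).
    by rewrite -h2 hs.
  + by split=> //; rewrite big_ord0 /r0; updt.
  + move=> i r1 _ hi hb1 ed [-> s1 es].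
    apply/wp_seq/(wp_cons (IH d.+3 (d.+1 :: env) r1 hb1 _ hw hr _)); first by lia.
      by apply/andP; split; [rewrite /=; lia | apply: all_gtn_le henv; lia].
    move=> r2 _ [-> s2 e2]; have hb2 : base r2 by apply: base_same s2 hb1; lia.
    apply: wp_add; split; updt.
    * by rewrite s2.
    * by rewrite s2.
    * by apply: base_same hb2; [exact: hd|apply: same_upd].
    * split=> //; last first.
        by updt; rewrite big_ord_recr /= e2 s2 1?ltnW // es /= ed (map_same henv s1).
      apply: same_upd => //; apply: same_trans s1 _; apply: same_le s2; lia.
  + by move=> r1 m1 [_ [-> h1 h2]].
Qed.

Lemma wp_for2 d x B (J : nat -> nat -> memo -> Prop) r m :
  base r -> 6 <= d -> J 0 0 m -> (forall i m, J i N m -> J i.+1 0 m) ->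
  (forall i j r1 m1, i < N -> j < N -> base r1 -> same d r r1 -> r1 d = i ->
     r1 d.+2 = j -> J i j m1 ->
     wp x B (fun r' m' => same (4 + d) r1 r' /\ J i j.+1 m') r1 m1) ->
  wp (sfor d (sfor d.+2 x)) (N * (N * (B + 4) + 7) + 3)
     (fun r' m' => same d r r' /\ J N 0 m') r m.
Proof.
move=> hb hd J0 JS step.
apply: (@wp_le _ (N * (N * (B + 4) + 3 + 4) + 3)); last by lia.
apply: (wp_cons (wp_for (J := fun i r' m' => same d r r' /\ J i 0 m') hb hd _ _ _)).
- move=> i r1 r2 m1 h [h1 h2]; split=> //; exact: same_trans h1 h.
- by split.
- move=> i r1 m1 hi hb1 e1 [s1 hJ].
  apply: (wp_cons (wp_for (J := fun j r' m' => same d.+2 r1 r' /\ J i j m') hb1 _ _ _ _)).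
  + by lia.
  + by move=> j r2 r3 m2 h [h1 h2]; split=> //; exact: same_trans h1 h.
  + by split.
  + move=> j r2 m2 hj hb2 e2 [s2 hJ2].
    apply: (wp_cons (step i j r2 m2 hi hj hb2 _ _ e2 hJ2)).
    * by apply: same_trans s1 (same_le _ s2); lia.
    * by rewrite s2 //; lia.
    * move=> r3 m3 [s3 hJ3]; split.
      - by rewrite s3.
      - by rewrite s3.
      - by apply: base_same s3 hb2; lia.
      - by split=> //; apply: same_trans s2 (same_le _ s3); lia.
  + move=> r2 m2 [hb2 [s2 hJ2]]; split => //.
    * by rewrite s2.
    * by rewrite s2.
    * split; last exact: JS.
      by apply: same_trans s1 (same_le _ s2); lia.
- by move=> r1 m1 [_ [h1 h2]].
Qed.

Lemma wp_ccmd st c d env r m : base r -> 6 <= d -> cwf c -> rep st m ->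
  all (gtn d) env ->
  wp (ccmd c d env) (ccost N R c)
    (fun r' m' => same d r r' /\ rep (exec N R inp c [seq r x | x <- env] st) m') r m.
Proof.
elim: c d env r m st => [a e|x IHx y IHy|e x IHx|x IHx|x IHx] d env r m st hb hd hw hr henv /=.
- move: hw => /andP[ha hw].
  set F := fun i j => eval N inp st [:: j, i & [seq r x | x <- env]] e.
  apply: (@wp_le _ ((N * (N * ((ecost N e + ((4 * N + 12) + 1)) + 4) + 7) + 3) +
     (N * (N * (((4 * N + 12) + (1 + ((4 * N + 12) + 1))) + 4) + 7) + 3))); last by lia.
  apply: wp_seq.
  (* The first pass writes only to the buffer, which [rep] ignores, so [e] is evaluated in the old
     store throughout. In both passes the invariant speaks of the entries before [(i, j)] in
     row-major order. *)
  apply: (wp_cons (wp_for2 (J := fun i j m' => rep st m' /\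
     forall i' j', i' < N -> j' < N -> (i' < i) || (i' == i) && (j' < j) ->
        m' (addr 0 i' j') = F i' j') hb hd _ _ _)).
  + by split=> // i' j'; rewrite !ltn0 andbF.
  + move=> i m1 [h1 h2]; split=> // i' j' hi' hj' h; apply: h2 => //; lia.
  + move=> i j r1 m1 hi hj hb1 s1 e1 e2 [hr1 hJ].
    apply/wp_seq; apply: (wp_cons (wp_cexpr (st := st) (env := [:: d.+2, d & env]) hb1 _ hw hr1 _)).
    * by lia.
    * by apply/and3P; split; [rewrite /=; lia | rewrite /=; lia | apply: all_gtn_le henv; lia].
    * move=> r2 _ [-> s2 ev]; have hb2 : base r2 by apply: base_same s2 hb1; lia.
      apply/wp_seq; apply: (wp_cons (wp_saddr _ _ hb2 _ _ _ _)); [lia|lia|lia| |].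
        by rewrite s2 ?e1 1?ltnW //; lia.
      move=> r3 _ [-> s3 ea]; apply: wp_write.
      rewrite ea s3 // ev !s2; [|lia|lia].
      rewrite /= e1 e2 (map_same henv s1) -/(F i j).
      split; first by apply: same_trans s2 (same_le _ s3); lia.
      split.
        split=> [a' i' j' ha' hi' hj'|y hy]; rewrite update_other.
        - by case: hr1 => -> //.
        - move=> /addr_inj; case=> //; lia.
        - by case: hr1 => _ ->.
        - by have := addr_ge 0 i j; lia.
      move=> i' j' hi' hj' h.
      case: (eqVneq (i', j') (i, j)) => [[-> ->]|ne]; first by rewrite update_same.
      rewrite update_other; first by apply: hJ => //; move: ne; rewrite xpair_eqE; lia.
      by move=> /addr_inj; case=> // _ ei ej; rewrite ei ej eqxx in ne.
  move=> r1 m1 [s1 [hr1 hF]]; have hb1 := base_same hd s1 hb.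
  have {}hF i j : i < N -> j < N -> m1 (addr 0 i j) = F i j.
    by move=> hi hj; apply: hF => //; rewrite hi.
  apply: (wp_cons (wp_for2 (J := fun i j m' => [/\ forall x, x < OFF -> m' x = inp x,
      forall i j, i < N -> j < N -> m' (addr 0 i j) = F i j &
      forall a' i' j', 0 < a' < 32 -> i' < N -> j' < N -> m' (addr a' i' j') =
        if (a' == a) && ((i' < i) || (i' == i) && (j' < j)) then F i' j' else st a' i' j']) hb1 hd _ _ _)).
  + split=> //; first by case: hr1.
    by move=> a' i' j' h1 h2 h3; rewrite !ltn0 !andbF; case: hr1 => ->.
  + move=> i m2 [h1 h2 h3]; split=> // a' i' j' ha' hi' hj'; rewrite h3 // ltn0 andbF orbF.
    by congr (if _ && _ then _ else _); lia.
  + move=> i j r2 m2 hi hj hb2 s2 e1 e2 [h1 h2 h3].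
    apply/wp_seq; apply: (wp_cons (wp_saddr _ _ hb2 _ _ _ _)); [lia|lia|lia| |].
      by rewrite e1 ltnW.
    move=> r3 _ [-> s3 ea]; have hb3 : base r3 by apply: base_same s3 hb2; lia.
    apply/wp_seq/wp_read; rewrite ea e1 e2 h2 //.
    have s4 : same (4 + d) r2 (update r3 (4 + d) (F i j)).
      by apply: same_upd => //; apply: same_le s3; lia.
    have hb4 : base (update r3 (4 + d) (F i j)) by apply: base_same s4 hb2; lia.
    apply/wp_seq; apply: (wp_cons (wp_saddr _ _ hb4 _ _ _ _)); [lia|lia|lia| |].
      by rewrite s4 ?e1 1?ltnW //; lia.
    move=> r5 _ [-> s5 eb]; apply: wp_write; rewrite eb s5 // update_same !s4; [|lia|lia].
    rewrite e1 e2; split; first by apply: same_trans s4 (same_le _ s5); lia.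
    split.
    * by move=> x hx; rewrite update_other ?h1 //; have := addr_ge a i j; lia.
    * move=> i' j' hi' hj'; rewrite update_other ?h2 //.
      by move=> /addr_inj; case=> //; lia.
    * move=> a' i' j' ha' hi' hj'.
      case: (eqVneq (a', i', j') (a, i, j)) => [[-> -> ->]|ne].
        by rewrite update_same !eqxx /= ltnSn orbT.
      rewrite update_other ?h3 //.
        by congr (if _ then _ else _); move: ne; rewrite !xpair_eqE; lia.
      by move=> /addr_inj; case=> //; [lia|lia|]; move=> ea' ei ej; rewrite ea' ei ej eqxx in ne.
  move=> r2 m2 [s2 [h1 h2 h3]]; split; first exact: same_trans s1 s2.
  split=> // a' i' j' ha' hi' hj'; rewrite h3 // hi' andbT /upd.
  by rewrite -[eqn a' a]/(a' == a).
- move: hw => /andP[hw1 hw2].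
  apply/wp_seq/(wp_cons (IHx d env r m st hb hd hw1 hr henv)) => r1 m1 [s1 hr1].
  have hb1 := base_same hd s1 hb.
  apply: (wp_cons (IHy d env r1 m1 _ hb1 hd hw2 hr1 henv)) => r2 m2 [s2].
  by rewrite (map_same henv s1) => hr2; split=> //; apply: same_trans s1 s2.
- move: hw => /andP[hw1 hw2].
  apply: (@wp_le _ (ecost N e + (2 + (ccost N R x + 4)))); last by lia.
  apply/wp_seq/(wp_cons (wp_cexpr hb hd hw1 hr henv)) => r1 _ [-> s1 e1].
  have hb1 := base_same hd s1 hb; have [c1 _ _ _ _] := hb1.
  apply/wp_seq; apply: (wp_cons (wp_sbool m c1 _)); first by lia.
  move=> r2 _ [-> s2 e2]; have hb2 := base_same hd s2 hb1.
  have s12 := same_trans s1 s2; rewrite e1 in e2.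
  apply: (wp_if1 e2); first by lia.
  + move=> hv; rewrite hv.
    apply: (wp_cons (IHx d.+1 env r2 m st hb2 _ hw2 hr (all_gtn_le (leqnSn d) henv))).
      by lia.
    move=> r3 m3 [s3 hr3]; have s3' := same_le (leqnSn d) s3.
    have [g1 g2 g3 g4 g5] := base_same hd s3' hb2.
    split=> //; first by rewrite s3.
    split; first by apply: same_upd => //; apply: same_trans s12 s3'.
    by rewrite -(map_same henv s12).
  + by move=> hv; rewrite (negbTE hv); split.
- apply: (wp_cons (wp_for (J := fun i r' m' => same d r r' /\
     rep (iteri i (fun i => exec N R inp x (i :: [seq r x | x <- env])) st) m') hb hd _ _ _)).
  + by move=> i r1 r2 m1 h [h1 h2]; split=> //; exact: same_trans h1 h.
  + by split.
  + move=> i r1 m1 hi hb1 e1 [s1 hr1].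
    apply: (wp_cons (IHx d.+2 (d :: env) r1 m1 _ hb1 _ hw hr1 _)).
    * by lia.
    * by apply/andP; split; [rewrite /=; lia | apply: all_gtn_le henv; lia].
    * move=> r2 m2 [s2 hr2]; split; [by rewrite s2 | by rewrite s2 | | ].
        by apply: base_same s2 hb1; lia.
      split; first by apply: same_trans s1 (same_le _ s2); lia.
      by move: hr2; rewrite /= e1 (map_same henv s1).
  + by move=> r1 m1 [_ []].
- have [b1 b2 b3 b4 b5] := hb.
  apply: (@wp_le _ (1 + (R * (ccost N R x + 3) + 1))); last by lia.
  apply/wp_seq/wp_add.
  apply: (wp_cons (wp_loop (n := R) (B := ccost N R x)
   (I := fun i r' m' => same d r r' /\ rep (iter i (exec N R inp x [seq r x | x <- env]) st) m') _ _ _ _)).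
  + by updt; rewrite b4 b2 addn0.
  + by lia.
  + by split=> //; apply: same_upd.
  + move=> i r1 m1 hi hc [s1 hr1]; have hb1 := base_same hd s1 hb.
    apply: (wp_cons (IHx d.+1 env r1 m1 _ hb1 _ hw hr1 (all_gtn_le (leqnSn d) henv))).
      by lia.
    move=> r2 m2 [s2 hr2]; have s2' := same_le (leqnSn d) s2.
    have [g1 g2 g3 g4 g5] := base_same hd s2' hb1.
    split=> //; first by apply: s2.
    split; first by apply: same_upd => //; apply: same_trans s1 s2'.
    by move: hr2; rewrite (map_same henv s1).
  + by move=> r1 m1 [_ []].
Qed.

End Compile.

(** * Polynomial bounds on the cost *)

Lemma poly_mul_le K d K' d' N x y : 0 < N -> x <= K * N ^ d -> y <= K' * N ^ d' ->
  x * y <= (K * K') * N ^ (d + d').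
Proof. by move=> N0 hx hy; rewrite expnD mulnACA; apply: leq_mul. Qed.

Lemma poly_add_le K d K' d' N x y : 0 < N -> x <= K * N ^ d -> y <= K' * N ^ d' ->
  x + y <= (K + K') * N ^ (d + d').
Proof.
move=> N0 hx hy; rewrite mulnDl; apply: leq_add.
  by apply: leq_trans hx _; rewrite leq_mul2l leq_pexp2l ?leq_addr ?orbT.
by apply: leq_trans hy _; rewrite leq_mul2l leq_pexp2l ?leq_addl ?orbT.
Qed.

Definition polyb (f : nat -> nat) := exists K d, forall N, 0 < N -> f N <= K * N ^ d.

Lemma polyb_const c : polyb (fun=> c).
Proof. by exists c, 0 => N _; rewrite muln1. Qed.
Lemma polyb_id : polyb id.
Proof. by exists 1, 1 => N _; rewrite mul1n. Qed.
Lemma polyb_add f g : polyb f -> polyb g -> polyb (fun N => f N + g N).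
Proof.
move=> [K [d h]] [K' [d' h']]; exists (K + K'), (d + d') => N N0.
by apply: poly_add_le => //; [apply: h|apply: h'].
Qed.
Lemma polyb_mul f g : polyb f -> polyb g -> polyb (fun N => f N * g N).
Proof.
move=> [K [d h]] [K' [d' h']]; exists (K * K'), (d + d') => N N0.
by apply: poly_mul_le => //; [apply: h|apply: h'].
Qed.
#[local] Hint Resolve polyb_const polyb_id polyb_add polyb_mul : poly.

Lemma polyb_ecost e : polyb (ecost^~ e).
Proof. by elim: e => /=; auto 20 with poly. Qed.

Fixpoint norep c :=
  match c with
  | CAsg _ _ => true
  | CSeq x y => norep x && norep y
  | CIf _ x | CFor x => norep x
  | CRep _ => false
  end.

(** No repetition is nested in another one, so the exponential count [R] enters the cost
    linearly. *)
Fixpoint onerep c :=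
  match c with
  | CAsg _ _ => true
  | CSeq x y => onerep x && onerep y
  | CIf _ x | CFor x => onerep x
  | CRep x => norep x
  end.

Lemma polyb_norep c : norep c ->
  exists2 f, polyb f & forall N R, ccost N R c <= f N.
Proof.
elim: c => [a e|x IHx y IHy|e x IHx|x IHx|x IHx] //=.
- have := polyb_ecost e => he _; eexists; last by move=> N R; apply: leqnn.
  by auto 20 with poly.
- move=> /andP[/IHx[f pf hf] /IHy[g pg hg]]; exists (fun N => f N + g N); auto with poly.
  by move=> N R; apply: leq_add.
- move=> /IHx[f pf hf]; have he := polyb_ecost e.
  exists (fun N => ecost N e + f N + 6); auto with poly.
  by move=> N R; rewrite leq_add2r leq_add2l.
- move=> /IHx[f pf hf]; exists (fun N => N * (f N + 4) + 3); auto with poly.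
  by move=> N R; rewrite leq_add2r leq_mul2l leq_add2r hf orbT.
Qed.

Lemma polyb_onerep c : onerep c ->
  exists2 f, polyb f & forall N R, 0 < R -> ccost N R c <= R * f N.
Proof.
elim: c => [a e|x IHx y IHy|e x IHx|x IHx|x IHx] //=.
- move=> _; have [f pf hf] := @polyb_norep (CAsg a e) isT.
  exists f => // N R R0; apply: leq_trans (hf N R) _; exact: leq_pmull.
- move=> /andP[/IHx[f pf hf] /IHy[g pg hg]]; exists (fun N => f N + g N); auto with poly.
  by move=> N R R0; rewrite mulnDr; apply: leq_add; [apply: hf|apply: hg].
- move=> /IHx[f pf hf]; have he := polyb_ecost e.
  exists (fun N => ecost N e + f N + 6); auto with poly.
  move=> N R R0; rewrite !mulnDr; have := hf N R R0; have := leq_pmull (ecost N e) R0; lia.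
- move=> /IHx[f pf hf]; exists (fun N => N * (f N + 4) + 3); auto with poly.
  move=> N R R0; rewrite !mulnDr mulnCA.
  have h1 := leq_mul (leqnn N) (hf N R R0).
  have h2 : N * 4 <= R * (N * 4) by apply: leq_pmull.
  lia.
- move=> /polyb_norep[f pf hf]; exists (fun N => f N + 5); auto with poly.
  move=> N R R0; have h := leq_mul (leqnn R) (hf N R); lia.
Qed.

(** * Computing the loop bounds on the machine *)

Definition smul d a b :=
  SSeq (SI (IConst d 0)) (SSeq (SI (IAdd d.+1 a 2)) (SLoop d.+1 (SI (IAdd d d b)))).

Lemma wp_smul d a b (r : regs) m : r 1 = 1 -> r 2 = 0 -> 2 < d -> a < d -> b < d ->
  wp (smul d a b) (4 * r a + 3)
    (fun r' m' => [/\ m' = m, same d r r' & r' d = r a * r b]) r m.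
Proof.
move=> r1 r2 hd ha hb.
apply: (@wp_le _ (1 + (1 + (r a * (1 + 3) + 1)))); last by lia.
apply/wp_seq/wp_const/wp_seq/wp_add.
apply: (wp_cons (wp_loop (n := r a) (B := 1)
  (I := fun i r' m' => [/\ m' = m, same d r r' & r' d = i * r b]) _ _ _ _)).
- by updt; rewrite r2 addn0.
- by lia.
- split=> //; last by updt.
  by repeat (apply: same_upd; first by lia).
- move=> i r' m' hi hc [-> hs e]; apply: wp_add; split; updt => //.
  + by rewrite hs //; lia.
  + by rewrite hs //; lia.
  + split=> //; updt; first by repeat (apply: same_upd; first by lia).
    by rewrite e hs // mulSn addnC.
- by move=> r' m' [_ []].
Qed.

(** Register 6 receives [n] and register 7 the truncated parameter [k - (k - n)]. The bound [N] in
    register 3 is the cube of [4 * n + 8], the bound [R] in register 4 comes from repeated doubling,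
    and register 5 receives the length [n * n + n + 2] of the input. *)
Definition prologue :=
  SSeq (SI (IConst 1 1)) (SSeq (SI (IConst 6 0)) (SSeq (SI (IRead 6 6))
  (SSeq (SI (IRead 7 1)) (SSeq (SI (ISub 8 7 6)) (SSeq (SI (ISub 7 7 8))
  (SSeq (SI (IConst 9 8)) (SSeq (SI (IAdd 8 6 6)) (SSeq (SI (IAdd 8 8 8))
  (SSeq (SI (IAdd 8 8 9)) (SSeq (smul 10 8 8) (SSeq (smul 11 10 8)
  (SSeq (SI (IAdd 3 11 2))
  (SSeq (SI (IAdd 8 7 7)) (SSeq (SI (IAdd 8 8 8)) (SSeq (SI (IAdd 8 8 9))
  (SSeq (smul 10 8 8) (SSeq (smul 11 10 8)
  (SSeq (SI (IConst 4 1)) (SSeq (SLoop 11 (SI (IAdd 4 4 4)))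
  (SSeq (smul 10 6 6) (SSeq (SI (IAdd 5 10 6)) (SSeq (SI (IConst 10 2))
  (SI (IAdd 5 5 10)))))))))))))))))))))))).

(** At the parameter, [side] is the number of bits guessed per step and its square exceeds the
    number of steps; at [n], its cube is the side of the arrays, which thus have room for all
    guessed bits and for the split graph. *)
Definition side n := 4 * n + 8.

Lemma wp_prologue n k m : m 0 = n -> m 1 = k ->
  wp prologue (40 * side n ^ 3)
    (fun r' m' => m' = m /\ base (side n ^ 3) (2 ^ (side (minn k n) ^ 3)) (n * n + n + 2) r')
    (fun=> 0) m.
Proof.
move=> m0 m1; set k' := minn k n; set M := side n; set p := side k'.
have hk : k' <= n by apply: geq_minr.
have hpM : p <= M by rewrite /p /M /side; lia.
have hM : 8 <= M by rewrite /M /side leq_addl.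
have hp : 8 <= p by rewrite /p /side leq_addl.
have h2 : M <= M * M by rewrite leq_pmulr //; lia.
have h3 : M * M <= M * M * M by rewrite leq_pmulr //; lia.
have h4 : p * p <= M * M by apply: leq_mul.
have h5 : p * p * p <= M * M * M by apply: leq_mul.
have hn : n <= M by rewrite /M /side; lia.
have M3 : M ^ 3 = M * M * M by rewrite !expnS expn0 muln1 mulnA.
have p3 : p ^ 3 = p * p * p by rewrite !expnS expn0 muln1 mulnA.
apply: (@wp_le _ (1+(1+(1+(1+(1+(1+(1+(1+(1+(1+((4*M+3)+((4*(M*M)+3)+(1+(1+(1+(1+
  ((4*p+3)+((4*(p*p)+3)+(1+((p*p*p*(1+3)+1)+((4*n+3)+(1+(1+1)))))))))))))))))))))))); last first.
  by rewrite M3; lia.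
apply/wp_seq/wp_const/wp_seq/wp_const/wp_seq/wp_read/wp_seq/wp_read/wp_seq/wp_sub.
apply/wp_seq/wp_sub/wp_seq/wp_const/wp_seq/wp_add/wp_seq/wp_add/wp_seq/wp_add.
rewrite /update /= m0 m1.
have ek : k - (k - n) = k' by rewrite /k' minnE.
set r0 := fun j : nat => _.
have a1 : r0 1 = 1 by [].
have a2 : r0 2 = 0 by [].
have a6 : r0 6 = n by [].
have a7 : r0 7 = k' by rewrite /r0 /= ek.
have a8 : r0 8 = M by rewrite /r0 /= /M /side; lia.
have a9 : r0 9 = 8 by [].
clearbody r0.
apply/wp_seq; apply: (wp_weaken (wp_smul m a1 a2 _ _ _)) => //; first by rewrite a8.
move=> r1 _ [-> s1 e1]; rewrite a8 in e1.
have q1 : r1 1 = 1 by rewrite s1.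
have q2 : r1 2 = 0 by rewrite s1.
apply/wp_seq; apply: (wp_weaken (wp_smul m q1 q2 _ _ _)) => //; first by rewrite e1.
move=> r2 _ [-> s2]; rewrite e1 s1 // a8 => e2.
apply/wp_seq/wp_add; set r3 := update _ _ _.
have b x : 3 < x < 10 -> r3 x = r0 x.
  by move=> hx; rewrite /r3; updt; rewrite s2 ?s1 //; lia.
have b1 : r3 1 = 1 by rewrite /r3; updt; rewrite s2 ?s1.
have b2 : r3 2 = 0 by rewrite /r3; updt; rewrite s2 ?s1.
have b3 : r3 3 = M * M * M by rewrite /r3; updt; rewrite e2 s2 // s1 // a2 addn0.
clearbody r3; clear r1 s1 e1 q1 q2 r2 s2 e2.
apply/wp_seq/wp_add/wp_seq/wp_add/wp_seq/wp_add; set r4 := update _ _ _.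
have c8 : r4 8 = p by rewrite /r4; updt; rewrite !b // a7 a9 /p /side; lia.
have c x : x < 8 -> r4 x = r3 x by move=> hx; rewrite /r4; updt.
clearbody r4.
have q1 : r4 1 = 1 by rewrite c.
have q2 : r4 2 = 0 by rewrite c.
apply/wp_seq; apply: (wp_weaken (wp_smul m q1 q2 _ _ _)) => //; first by rewrite c8.
move=> r5 _ [-> s5 e5]; rewrite c8 in e5.
have q3 : r5 1 = 1 by rewrite s5.
have q4 : r5 2 = 0 by rewrite s5.
apply/wp_seq; apply: (wp_weaken (wp_smul m q3 q4 _ _ _)) => //; first by rewrite e5.
move=> r6 _ [-> s6]; rewrite e5 s5 // c8 => e6.
apply/wp_seq/wp_const; set r7 := update _ _ _.
have d x : x < 8 -> x != 4 -> r7 x = r3 x.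
  by move=> hx h; rewrite /r7; updt; rewrite s6 ?s5 ?c //; lia.
have d4 : r7 4 = 1 by rewrite /r7; updt.
have d11 : r7 11 = p * p * p by rewrite /r7; updt.
clearbody r7; clear r4 c8 c q1 q2 r5 q3 q4 s5 e5 r6 s6 e6.
apply/wp_seq; apply: (wp_cons (wp_loop (n := p * p * p) (B := 1)
  (I := fun i r' m' => [/\ m' = m, forall x, x < 8 -> x != 4 -> r' x = r3 x & r' 4 = 2 ^ i]) _ _ _ _)) => //.
  move=> i r8 _ hi hc [-> h hx]; apply: wp_add; split; [by updt | by updt; rewrite h | by updt; rewrite h | ].
  split=> //; last by updt; rewrite hx addnn -mul2n expnS.
  by move=> x hx1 hx2; updt; apply: h.
move=> r8 _ [_ [-> h hx]].
have q1 : r8 1 = 1 by rewrite h.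
have q2 : r8 2 = 0 by rewrite h.
have q6 : r8 6 = n by rewrite h // b.
apply/wp_seq; apply: (wp_weaken (wp_smul m q1 q2 _ _ _)) => //; first by rewrite q6.
move=> r9 _ [-> s9]; rewrite q6 => e9.
apply: (wp_seq (B1 := 1) (B2 := 1+1)); apply: wp_add.
apply/wp_seq/wp_const/wp_add; split=> //.
split; updt.
- by rewrite s9.
- by rewrite s9.
- by rewrite s9 // h // b3 M3.
- by rewrite s9 // hx p3.
- by rewrite e9 s9 // q6.
Qed.

Lemma run_halt P f s : onth P (pc s) = None -> run P f s = Some s.
Proof. by case: f => [|f] /= ->. Qed.

Lemma ram_implements c out : cwf c -> onerep c -> 0 < out < 32 ->
  exists (P : program) (K d : nat), forall (n k : nat) (rest : seq nat),
  size rest = n * n + n ->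
  exists st0 s,
    run P (2 ^ (side (minn k n) ^ 3) * (K * side n ^ d))
      (initial_config [:: n, k & rest]) = Some s /\
    reg s 0 = exec (side n ^ 3) (2 ^ (side (minn k n) ^ 3))
                (nth 0 [:: n, k & rest]) c [::] st0 out 0 0.
Proof.
move=> wc oc hout; have [f [K [d hf]] hc] := polyb_onerep oc.
pose code := SSeq prologue (SSeq (ccmd c 6 [::])
   (SSeq (cexpr (ERd out (EC 0) (EC 0)) 6 [::]) (SI (IAdd 0 6 2)))).
(* The prologue and the final read cost at most [44 * N + 43], absorbed by 90. The bound [K * N ^ d]
   is raised to [N ^ d * N] with [N = side n ^ 3], which gives the exponent [3 * d + 3]. *)
exists (scomp 0 code), (K + 90), (3 * d + 3) => n k rest sz.
set N := (side n ^ 3)%N; set R := (2 ^ (side (minn k n) ^ 3))%N.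
set input := [:: n, k & rest].
set OFF := n * n + n + 2.
have N0 : 0 < N by rewrite expn_gt0 /side addn_gt0 orbT.
have R0 : 0 < R by rewrite expn_gt0.
have inp_out x : OFF <= x -> nth 0 input x = 0.
  by move=> hx; apply: nth_default; rewrite /= sz; lia.
pose m0 : memo := nth 0 input.
pose st0 : store := fun a i j => m0 (addr N OFF a i j).
have hr0 : rep N OFF (nth 0 input) st0 m0 by split.
have [t [r' [m' [hok ht hq]]]] : wp code (40 * N + (R * f N + ((4 * N + 42) + 1)))
    (fun r' _ => r' 0 = exec N R (nth 0 input) c [::] st0 out 0 0) (fun=> 0) m0.
  apply: (wp_seq (B1 := 40 * N)).
  apply: (wp_cons (wp_prologue (n := n) (k := k) _ _)) => // r1 _ [-> hb1].
  apply: (wp_seq (B1 := R * f N)).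
  apply: (wp_weaken (wp_ccmd inp_out hb1 _ wc hr0 _)) => //; first exact: hc.
  move=> r2 m2 [s2 hr2]; have hb2 := base_same (leqnn 6) s2 hb1.
  apply: wp_seq; apply: (wp_weaken (wp_cexpr (e := ERd out (EC 0) (EC 0)) inp_out hb2 _ _ hr2 _)) => //.
  - by rewrite /= hout.
  - by rewrite /=; lia.
  move=> r3 _ [-> s3 e3]; apply: wp_add; rewrite update_same e3.
  have [_ -> _ _ _] := base_same (leqnn 6) s3 hb2.
  by rewrite addn0 /= /rd N0.
exists st0.
have hbound : t <= R * ((K + 90) * side n ^ (3 * d + 3)).
  apply: leq_trans ht _.
  rewrite expnD expnM -/N; have hfN := hf N N0.
  have hNd : 0 < N ^ d by rewrite expn_gt0 N0.
  have h1 : R * f N <= R * (K * N ^ d * N).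
    by rewrite leq_mul2l; apply/orP; right; apply: leq_trans hfN _; exact: leq_pmulr.
  have h2 : N <= N ^ d * N by exact: leq_pmull.
  have h3 : N ^ d * N <= R * (N ^ d * N) by exact: leq_pmull.
  set X := N ^ d * N in h2 h3 *.
  have -> : R * ((K + 90) * X) = R * (K * N ^ d * N) + 90 * (R * X) by rewrite /X; nia.
  lia.
exists (Config (slen code) r' m'); split=> //.
rewrite -(subnKC hbound) /initial_config hok; last first.
  by exists [::], [::]; rewrite cats0.
by apply: run_halt; rewrite add0n -(size_scomp 0) onth_default.
Qed.

(** * Furthest minimum cuts *)

Section Cuts.
Variable V : finType.
Implicit Types (c : V -> V -> nat) (A X Z W S L P E : {set V}) (T : {set V * V}).

Definition arc c : rel V := fun x y => 0 < c x y.
Definition mask c T : V -> V -> nat := fun x y => if (x, y) \in T then 0 else c x y.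
Definition reach c X := [set y | [exists x in X, connect (arc c) x y]].
Definition delta c A := \sum_(x in A) \sum_(y in ~: A) c x y.
Definition cut c A := [set p | [&& p.1 \in A, p.2 \notin A & arc c p.1 p.2]].
Definition bad c S := exists s y, [/\ s \in S, arc c s y & connect (arc c) y s].
(** Deleting all arcs that leave [W] destroys the same closed walks as deleting the nodes of [W],
    and keeps every deletion a deletion of arcs. *)
Definition outs W : {set V * V} := [set p | p.1 \in W].
Definition closed_in c A := forall x y, x \in A -> arc c x y -> y \in A.

(** An arc has to be present in [e2] only if it lies on some walk from [x] to [z]; this moves walks
    confined to a region from one graph to another. *)
Lemma connect_transfer (e1 e2 : rel V) x z : connect e1 x z ->
  (forall u v, connect e1 x u -> e1 u v -> connect e1 v z -> e2 u v) ->
  connect e2 x z.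
Proof.
move=> /connectP[p hp ->]; elim: p x hp => [|y p IH] x /= hp H; first exact: connect0.
case/andP: hp => xy hp.
apply: connect_trans (connect1 _) (IH y hp _).
  by apply: H; [exact: connect0 | exact: xy | apply/connectP; exists p].
by move=> u v yu; apply: H; apply: connect_trans (connect1 xy) yu.
Qed.

Lemma closed_connect c A x y : closed_in c A -> x \in A ->
  connect (arc c) x y -> y \in A.
Proof.
move=> cA xA /connectP[p hp ->]; elim: p x xA hp => [|z p IH] x xA //= /andP[xz].
by apply: IH; apply: cA xA xz.
Qed.

Lemma reachP c X y : reflect (exists2 x, x \in X & connect (arc c) x y) (y \in reach c X).
Proof. by rewrite inE; apply: (iffP existsP) => [[x /andP[]]|[x h1 h2]]; exists x => //; apply/andP. Qed.

Lemma sub_reach c X : X \subset reach c X.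
Proof. by apply/subsetP => x xX; apply/reachP; exists x. Qed.

Lemma reach_closed c X : closed_in c (reach c X).
Proof.
move=> x y /reachP[z zX zx] xy; apply/reachP; exists z => //.
exact: connect_trans zx (connect1 xy).
Qed.

Lemma reach_min c X A : X \subset A -> closed_in c A -> reach c X \subset A.
Proof.
move=> /subsetP XA cA; apply/subsetP => y /reachP[x /XA xA]; exact: closed_connect.
Qed.

Lemma reach_setU1 c X y : y \in reach c X -> reach c (y |: X) = reach c X.
Proof.
move=> yR; apply/eqP; rewrite eqEsubset; apply/andP; split.
  by apply: reach_min; [rewrite subUset sub1set yR sub_reach | exact: reach_closed].
by apply: reach_min; [apply: subset_trans (sub_reach _ _); exact: subsetUr | exact: reach_closed].
Qed.

Lemma arc_mask c T x y : arc (mask c T) x y = arc c x y && ((x, y) \notin T).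
Proof. by rewrite /arc /mask; case: ifP; rewrite ?andbF ?andbT. Qed.

Lemma connect_mask c T x y : connect (arc (mask c T)) x y -> connect (arc c) x y.
Proof. by apply: connect_sub => u v; rewrite arc_mask => /andP[/connect1]. Qed.

Definition tok c T := forall p, p \in T -> c p.1 p.2 = 1.

Lemma delta_cut c A : delta c A = \sum_(p in cut c A) c p.1 p.2.
Proof.
rewrite /delta pair_big /= [RHS]big_mkcond [LHS]big_mkcond.
apply: eq_bigr => -[x y] _; rewrite !inE /= /arc.
by case: (x \in A); case: (y \in A) => //=; case: (c x y).
Qed.

Lemma delta_cut1 c A : (forall p, p \in cut c A -> c p.1 p.2 = 1) -> delta c A = #|cut c A|.
Proof. by move=> h; rewrite delta_cut -sum1_card; apply: eq_bigr. Qed.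

Lemma delta0_closed c A : delta c A = 0 -> closed_in c A.
Proof.
move=> d0 x y xA xy; apply: contraTT isT => yA.
have : c x y <= delta c A.
  have pc : (x, y) \in cut c A by rewrite inE /= xA yA.
  by rewrite delta_cut (bigD1 (x, y)) //= leq_addr.
by rewrite d0 leqn0 => /eqP h; move: xy; rewrite /arc h.
Qed.

Lemma cut_caps c A k : (forall x y, c x y <= 1 \/ k < c x y) -> delta c A <= k ->
  forall p, p \in cut c A -> c p.1 p.2 = 1.
Proof.
move=> hc hd p pc; have h : c p.1 p.2 <= k.
  by apply: leq_trans hd; rewrite delta_cut (bigD1 p) //= leq_addr.
have h0 : 0 < c p.1 p.2 by move: pc; rewrite inE => /and3P[].
by case: (hc p.1 p.2); lia.
Qed.

Lemma cut_reach_sub c T X : cut c (reach (mask c T) X) \subset T.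
Proof.
apply/subsetP => -[x y]; rewrite inE /= => /and3P[xR yR xy].
apply: contraNT yR => xyT; apply: reach_closed xR _; by rewrite arc_mask xy.
Qed.

Lemma delta_reach c T X : tok c T ->
  delta c (reach (mask c T) X) = #|cut c (reach (mask c T) X)|.
Proof. by move=> hT; apply: delta_cut1 => p /(subsetP (cut_reach_sub c T X)); apply: hT. Qed.

Lemma delta_reach_le c T X : tok c T -> delta c (reach (mask c T) X) <= #|T|.
Proof. by move=> hT; rewrite delta_reach //; apply/subset_leq_card/cut_reach_sub. Qed.

Definition is_far c X Z A :=
  [/\ X \subset A, [disjoint A & Z] &
      forall A', X \subset A' -> [disjoint A' & Z] ->
        delta c A <= delta c A' /\ (delta c A' = delta c A -> A' \subset A)].

(** If no head of a cut arc is reached under [T], no walk from [X] leaves [A]; so [R] lies in [A]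
    and is itself an admissible side. By minimality [cut c A] has at most as many arcs as [cut c R],
    all of which belong to [T], and the exchange does not enlarge [T]. *)
Lemma push_far c X Z A T (R := reach (mask c T) X) :
  is_far c X Z A -> tok c T -> (forall p, p \in cut c A -> c p.1 p.2 = 1) ->
  (exists2 p, p \in cut c A & p \in T \/ p.2 \in R) \/
  [/\ R \subset A, tok c ((T :\: cut c R) :|: cut c A) &
      #|(T :\: cut c R) :|: cut c A| <= #|T| ].
Proof.
move=> [XA AZ hmin] hT cap1.
case: (boolP [exists p in cut c A, (p \in T) || (p.2 \in R)]) => [|hn].
  by case/exists_inP=> p pc /orP h; left; exists p.
right; have RA : R \subset A.
  suff : R \subset R :&: A by rewrite subsetI => /andP[].
  apply: reach_min; first by rewrite subsetI XA sub_reach.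
  move=> x y /setIP[xR xA] xy; have yR := reach_closed xR xy.
  rewrite inE yR /=; apply: contraNT hn => yA; apply/exists_inP; exists (x, y).
    by rewrite inE /= xA yA; move: xy; rewrite arc_mask => /andP[].
  by rewrite yR orbT.
split=> //.
  by move=> p /setUP[/setDP[/hT]|/cap1].
have hRZ : [disjoint R & Z] by apply: disjointWl AZ.
have [hle _] := hmin R (sub_reach _ _) hRZ.
rewrite delta_reach // delta_cut1 // in hle.
apply: leq_trans (_ : #|T :\: cut c R| + #|cut c A| <= _).
  by rewrite -cardsUI leq_addr.
by rewrite -(cardsID (cut c R) T) (setIidPr (cut_reach_sub c T X)) addnC leq_add2r.
Qed.

(** A side of the same value as [A] would be minimum and hence contained in [A], which [y] excludes.
    This strict growth limits how many nodes can join. *)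
Lemma far_lower_bound c X Z A y A' : is_far c X Z A -> y \notin A ->
  y |: X \subset A' -> [disjoint A' & Z] -> delta c A < delta c A'.
Proof.
move=> [XA AZ hmin] yA; rewrite subUset sub1set => /andP[yA' XA'] A'Z.
have [h1 h2] := hmin A' XA' A'Z.
rewrite ltn_neqAle h1 andbT; apply: contraNneq yA => e.
exact: (subsetP (h2 (esym e))).
Qed.

(** * Feasible solutions and their exchange along a cut *)

Definition alive c W := [set s | [exists w in W, connect (arc c) s w]].

Lemma aliveP c W s : reflect (exists2 w, w \in W & connect (arc c) s w) (s \in alive c W).
Proof. by rewrite inE; apply: (iffP existsP) => [[x /andP[]]|[x h1 h2]]; exists x => //; apply/andP. Qed.

Definition hits c S W := ~ bad (mask c (outs W)) S.

(** If [s] could not reach [W], its closed walk would avoid [W] and survive the deletion of [W]. *)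
Lemma hits_alive c S W c1 s y : hits c S W -> (forall u v, arc c1 u v -> arc c u v) ->
  s \in S -> arc c1 s y -> connect (arc c1) y s -> s \in alive c W.
Proof.
move=> hW sub sS sy ys; apply: contraPT hW => dead; apply; exists s, y.
have H u : connect (arc c1) s u -> u \notin W.
  move=> su; apply: contraNN dead => uW; apply/aliveP; exists u => //.
  by apply: connect_sub su => a b /sub/connect1.
split=> //; first by rewrite arc_mask sub // inE H.
apply: connect_transfer ys _ => u v yu uv vs; rewrite arc_mask sub // inE H //=.
exact: connect_trans (connect1 sy) yu.
Qed.

(* What is known about the solution [T] while the vertices of [L], a strongly
   connected class of [W] from which no other vertex of [W] is reachable, are
   being separated from the rest of [W]. *)
Definition feasible c S W L X T :=
  [/\ ~ bad (mask c T) S, L \subset X, L \subset W,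
      [disjoint reach (mask c T) X & W :\: L] &
      forall s, s \in S -> s \in reach (mask c T) X ->
        [disjoint reach (mask c T) [set s] & W]].

Definition xsinks c S W L := (W :\: L) :|: (S :&: alive c W).

Lemma disjointP A (B : {set V}) : reflect (forall x, x \in A -> x \notin B) [disjoint A & B].
Proof.
apply: (iffP idP) => [h x xA|h]; first by rewrite (disjointFr h).
apply/pred0P => x /=; apply/negbTE; rewrite negb_and.
by case: (boolP (x \in A)) => //= /h.
Qed.

Lemma disjoint_absurd A (B : {set V}) x : [disjoint A & B] -> x \in A -> x \in B -> False.
Proof. by move=> /disjointP h /h /negP. Qed.

Section Push.
Variables (c : V -> V -> nat) (T : {set V * V}) (A R : {set V}).
Hypothesis RA : R \subset A.
Let T' := (T :\: cut c R) :|: cut c A.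

Lemma pushed_closed : closed_in (mask c T') A.
Proof.
move=> x y xA; rewrite arc_mask => /andP[xy]; rewrite !inE /= negb_or => /andP[_].
by rewrite xA xy andbT negbK.
Qed.

(** [A] is closed once its cut is deleted, so a walk that ends outside [A] never meets [A]; the arcs
    of [T] that were given up start in [R], inside [A], and do not occur on it. *)
Lemma pushed_transfer x z : connect (arc (mask c T')) x z -> z \notin A ->
  connect (arc (mask c T)) x z.
Proof.
move=> xz zA; apply: connect_transfer xz _ => u v xu uv vz.
have uA : u \notin A.
  apply: contraNN zA => uA; apply: closed_connect vz; first exact: pushed_closed.
  exact: pushed_closed uA uv.
move: uv; rewrite !arc_mask => /andP[-> ]; rewrite !inE /= negb_or => /andP[+ _].
by rewrite (contraNF (subsetP RA u) uA).
Qed.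

Lemma pushed_bad S : bad (mask c T') S -> ~ bad (mask c T) S ->
  exists s y, [/\ s \in S, s \in A, arc (mask c T') s y & connect (arc (mask c T')) y s].
Proof.
move=> [s [y [sS sy ys]]] nb; exists s, y; split=> //; apply: contraPT nb => sA.
apply; exists s, y; split=> //; last exact: pushed_transfer ys sA.
move: sy; rewrite !arc_mask => /andP[-> ]; rewrite !inE /= negb_or => /andP[+ _].
by rewrite (contraNF (subsetP RA s) sA).
Qed.

Lemma pushed_reach X : X \subset A -> reach (mask c T') X \subset A.
Proof. by move=> XA; apply: reach_min => //; exact: pushed_closed. Qed.

End Push.

(** A closed walk created by the exchange goes through an [S]-node of [A]. That node reaches [W] by
    [hits_alive] and is therefore a sink, yet [A] contains no sink. The nonempty cut supplies an arc
    of the new solution. *)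
Lemma push_source c S W L X A T : hits c S W -> feasible c S W L X T ->
  is_far c X (xsinks c S W L) A -> tok c T ->
  (forall p, p \in cut c A -> c p.1 p.2 = 1) -> cut c A != set0 ->
  exists T', [/\ tok c T', #|T'| <= #|T|, feasible c S W L X T' &
    exists2 p, p \in cut c A & p \in T' \/ p.2 \in reach (mask c T') X].
Proof.
move=> hW hF far hT cap1 /set0Pn[p0 p0c].
case: (push_far far hT cap1) => [h|[RA tT' cT']]; first by exists T; split.
set T' := _ :|: _ in tT' cT'; exists T'; split=> //; last first.
  by exists p0 => //; left; rewrite inE p0c orbT.
have [XA AZ _] := far; have [nb LX LW dX dead] := hF.
have R'A : reach (mask c T') X \subset A by apply: pushed_reach.
have noalive s : s \in S -> s \in A -> s \notin alive c W.
  move=> sS sA; apply/negP => al; move/disjointP/(_ s sA): AZ.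
  by rewrite !inE /= sS; move: al; rewrite inE => ->; rewrite orbT.
split=> //.
- move=> /(pushed_bad RA)/(_ nb)[s [y [sS sA sy ys]]].
  move: (noalive s sS sA); rewrite (hits_alive hW _ sS sy ys) //.
  by move=> u v; rewrite arc_mask => /andP[].
- apply: disjointWl R'A _; apply: disjointWr AZ; exact: subsetUl.
- move=> s sS /(subsetP R'A) sA; apply/disjointP => w /reachP[s' /set1P-> sw].
  apply: contraNN (noalive s sS sA) => wW; apply/aliveP; exists w => //.
  exact: connect_mask sw.
Qed.

(** Here [A] avoids [W], so a closed walk created inside [A] would survive the deletion of [W].
    Walks into [W] end outside [A] and were already present under [T] by [pushed_transfer]. *)
Lemma push_dead c S W L X P A T : hits c S W -> feasible c S W L X T ->
  [disjoint reach (mask c T) P & W] ->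
  is_far c P W A -> tok c T ->
  (forall p, p \in cut c A -> c p.1 p.2 = 1) -> cut c A != set0 ->
  exists T', [/\ tok c T', #|T'| <= #|T|, feasible c S W L X T',
    [disjoint reach (mask c T') P & W] &
    exists2 p, p \in cut c A & p \in T' \/ p.2 \in reach (mask c T') P].
Proof.
move=> hW hF dP far hT cap1 /set0Pn[p0 p0c].
case: (push_far far hT cap1) => [h|[RA tT' cT']]; first by exists T; split.
set T' := _ :|: _ in tT' cT'; exists T'; have [PA AW _] := far.
have notA w : w \in W -> w \notin A by rewrite disjoint_sym in AW; move/disjointP: AW; apply.
split=> //; last first.
- by exists p0 => //; left; rewrite inE p0c orbT.
- by apply: disjointWl AW; apply: pushed_reach.
have [nb LX LW dX dead] := hF; split=> //.
- move=> /(pushed_bad RA)/(_ nb)[s [y [sS sA sy ys]]]; apply: hW.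
  have clA : closed_in (mask c T') A by apply: pushed_closed.
  have H u v : u \in A -> arc (mask c T') u v -> arc (mask c (outs W)) u v.
    move=> uA; rewrite !arc_mask => /andP[-> _]; rewrite inE /=.
    by move/disjointP: AW; apply.
  exists s, y; split=> //; first exact: H.
  apply: connect_transfer ys _ => u v yu uv _; apply: H => //.
  by apply: closed_connect yu => //; apply: clA sA sy.
- apply/disjointP => w /reachP[x xX xw]; apply/negP => wWL.
  apply: (disjoint_absurd dX _ wWL); apply/reachP; exists x => //.
  by apply: pushed_transfer xw _ => //; apply: notA; case/setDP: wWL.
- move=> s sS /reachP[x xX xs]; apply/disjointP => w /reachP[s' /set1P-> sw].
  apply/negP => wW; have sA : s \notin A.
    apply: contraNN (notA w wW) => sA.
    by apply: closed_connect sw => //; apply: pushed_closed.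
  have sR : s \in reach (mask c T) X.
    by apply/reachP; exists x => //; apply: pushed_transfer xs _.
  apply: (disjoint_absurd (dead s sS sR) _ wW); apply/reachP; exists s; rewrite ?inE //.
  by apply: pushed_transfer sw _ => //; apply: notA.
Qed.

(** A closed walk through [s] that survives the deletion of [W :\: L] must meet [W], hence [L].
    Since [A] is closed and contains [L], it contains [s], which reaches [W] and is a sink: a
    contradiction. *)
Lemma hits_setD c S W L X A : hits c S W -> L \subset X ->
  is_far c X (xsinks c S W L) A -> cut c A = set0 -> hits c S (W :\: L).
Proof.
move=> hW LX [XA AZ _] cut0 [s [y [sS sy ys]]].
have clA : closed_in c A.
  move=> u v uA uv; apply: contraTT isT => vA; have : (u, v) \in cut c A by rewrite inE /= uA vA.
  by rewrite cut0 inE.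
set c' := mask c (outs (W :\: L)) in sy ys.
case: (boolP [exists w in W, connect (arc c') s w && connect (arc c') w s]) => [|hn].
  case/exists_inP=> w wW /andP[sw ws].
  have sC : exists2 v, arc c' w v & connect (arc c') v s.
    move/connectP: (ws) => [[|v q] /=]; first by move=> _ e; exists y; rewrite -?e.
    by case/andP=> wv hq e; exists v => //; apply/connectP; exists q.
  have wL : w \in L.
    case: sC => v; rewrite arc_mask !inE wW andbT negbK => /andP[_ ->] //.
  have sA : s \in A.
    apply: closed_connect (connect_mask ws) => //.
    by apply: (subsetP XA); apply: (subsetP LX).
  move/disjointP/(_ s sA): AZ; rewrite in_setU in_setI sS /= negb_or => /andP[_ /aliveP[]].
  by exists w => //; apply: connect_mask sw.
apply: hW; exists s, y.
have H u v : connect (arc c') s u -> connect (arc c') u s -> arc c' u v ->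
    arc (mask c (outs W)) u v.
  move=> su us; rewrite !arc_mask => /andP[-> _]; rewrite inE /=.
  by apply: contraNN hn => uW; apply/exists_inP; exists u => //; rewrite su.
split=> //.
  by apply: H => //; apply: connect_trans (connect1 sy) ys.
apply: connect_transfer ys _ => u v yu uv vs; apply: H => //.
  exact: connect_trans (connect1 sy) yu.
exact: connect_trans (connect1 uv) vs.
Qed.

(** Take a vertex of [W] that reaches the fewest vertices of [W] under [T]: all those it reaches
    also reach it back. An [S]-node reached from this class and reaching [W] would close a walk. *)
Lemma last_class c S W T : [disjoint S & W] -> ~ bad (mask c T) S -> W != set0 ->
  exists2 L : {set V}, L != set0 & feasible c S W L L T.
Proof.
move=> SW nb /set0Pn[w1 w1W].
pose f w := #|reach (mask c T) [set w] :&: W|.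
have [w0 w0W hmin] : exists2 w0, w0 \in W & forall w, w \in W -> f w0 <= f w.
  by case: (arg_minnP f w1W) => w0 h1 h2; exists w0.
pose L := reach (mask c T) [set w0] :&: W.
have back w : w \in L -> connect (arc (mask c T)) w w0.
  move=> /setIP[w0w wW].
  have sub : reach (mask c T) [set w] :&: W \subset L.
    apply: setSI; apply: reach_min; first by rewrite sub1set.
    exact: reach_closed.
  have e : reach (mask c T) [set w] :&: W = L.
    by apply/eqP; rewrite eqEcard sub /=; apply: hmin.
  have : w0 \in L by rewrite inE w0W andbT; apply: (subsetP (sub_reach _ _)); rewrite inE.
  by rewrite -e => /setIP[/reachP[w' /set1P->]].
have RL : reach (mask c T) L \subset reach (mask c T) [set w0].
  by apply: reach_min; [exact: subsetIl | exact: reach_closed].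
exists L.
  by apply/set0Pn; exists w0; rewrite inE w0W andbT; apply: (subsetP (sub_reach _ _)); rewrite inE.
split=> //; first exact: subsetIr.
- apply/disjointP => w /(subsetP RL) wR; apply/negP => /setDP[wW].
  by rewrite inE wR wW.
- move=> s sS /(subsetP RL) sR; apply/disjointP => w /reachP[s' /set1P-> sw].
  apply/negP => wW; apply: nb.
  have [w' /set1P-> w0s] := reachP _ _ _ sR.
  have wL : w \in L.
    rewrite inE wW andbT; apply/reachP; exists w0; rewrite ?inE //.
    exact: connect_trans w0s sw.
  (* Since [s] is not in [W], the walk from [s] to [w] has at least one arc, as [bad] requires. *)
  move/connectP: sw => [[|y p] /=].
    by move=> _ e; move/disjointP: SW => /(_ s sS); rewrite -e wW.
  case/andP=> sy hp e; exists s, y; split=> //.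
  apply: connect_trans (connect_trans (back _ wL) w0s).
  by apply/connectP; exists p.
Qed.

(** * Residual capacities *)

Lemma delta_pairs c A : delta c A = \sum_p ((p.1 \in A) && (p.2 \notin A)) * c p.1 p.2.
Proof.
rewrite delta_cut big_mkcond; apply: eq_bigr => -[x y] _; rewrite !inE /= /arc.
by case: (x \in A); case: (y \in A); rewrite ?mul0n ?mul1n //=; case: (c x y).
Qed.

Definition shift (r : V -> V -> nat) p q : V -> V -> nat := fun x y =>
  r x y - ((x, y) == (p, q)) + ((x, y) == (q, p)).

(** Moving a unit across [(p, q)] affects a cut only through the sides of [p] and [q], so along a
    path the changes telescope to the two ends. *)
Lemma delta_shift r p q A : p != q -> 0 < r p q ->
  delta (shift r p q) A + (p \in A) = delta r A + (q \in A).
Proof.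
move=> pq rpq; pose w (x y : V) := (x \in A) && (y \notin A) : nat.
have pick a b : \sum_(x : V * V) w x.1 x.2 * (x == (a, b)) = w a b.
  rewrite (bigD1 (a, b)) //= eqxx muln1 big1 ?addn0 // => x /negbTE ->.
  by rewrite muln0.
suff H : delta (shift r p q) A + w p q = delta r A + w q p.
  move: H; rewrite /w; case: (p \in A); case: (q \in A) => /=; lia.
rewrite !delta_pairs -(pick p q) -(pick q p) -!big_split /=.
apply: eq_bigr => -[x y] _; rewrite -!mulnDr; congr (_ * _); rewrite /shift /=.
case: (eqVneq (x, y) (p, q)) => [[-> ->]|ne] /=; last by rewrite subn0 addn0.
by rewrite xpair_eqE (negbTE pq) /= !addn0 subnK.
Qed.

(** Think of [r] as the residual of a flow of value [a] that ends in [E]. No residual arc leaves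
    [A], so its cut equals [a]; a side of equal value is left by no residual arc either, hence none
    of its nodes reaches [Z]. *)
Lemma is_far_residual c r a E X Z :
  (forall A, X \subset A -> [disjoint A & E] -> delta r A + a = delta c A) ->
  E \subset Z -> (forall x, x \in X -> x \notin alive r Z) ->
  is_far c X Z (~: alive r Z) /\ delta c (~: alive r Z) = a.
Proof.
move=> hr EZ nX; set A := ~: _.
have XA : X \subset A by apply/subsetP => x /nX; rewrite in_setC.
have AZ : [disjoint A & Z].
  apply/disjointP => z; rewrite in_setC; apply: contraNN => zZ; apply/aliveP.
  by exists z.
have clA : closed_in r A.
  move=> x y; rewrite !in_setC => + xy; apply: contraNN => /aliveP[z zZ yz].
  by apply/aliveP; exists z => //; apply: connect_trans (connect1 xy) yz.
have cl0 B : closed_in r B -> delta r B = 0.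
  move=> clB; rewrite delta_cut big1 // => -[x y]; rewrite inE /= => /and3P[xB yB xy].
  by rewrite (clB _ _ xB xy) in yB.
have dA : delta c A = a.
  by rewrite -hr // ?cl0 //; apply: disjointWr AZ.
split=> //; split=> // A' XA' A'Z.
rewrite dA -(hr A') //; last exact: disjointWr A'Z.
split; first exact: leq_addl.
move=> e; have /delta0_closed clA' : delta r A' = 0 by lia.
apply/subsetP => x xA'; rewrite in_setC; apply/aliveP => -[z zZ xz].
by apply: (disjoint_absurd A'Z _ zZ); apply: closed_connect xz.
Qed.

(* Either the set [E] of at most [ka + 1] sinks already cannot be separated
   from [X] by [ka] deletions, or [A] is the largest side of a minimum cut. *)
Definition flow_spec c X Z ka (over : bool) E A :=
  if over then [/\ E \subset Z, #|E| <= ka.+1 &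
     forall A', X \subset A' -> [disjoint A' & E] -> ka < delta c A']
  else is_far c X Z A /\ delta c A <= ka.

(** * The potential that bounds the number of steps *)

Section Steps.
Variables (k : nat) (S : {set V}).
Notation H := k.+2.

(* [mode] tells whether [P] is being cut off from [W], rather than [X] from
   [xsinks]; [l] is a lower bound on the current minimum cut, and [mu] a bound
   on the number of steps still needed. While an alive node of [P] is left, the
   second kind of separation costs at least one unit of the budget [ka], which
   pays for the reset of [l] on entering and on leaving it. *)
Definition invariant (mode : bool) c ka W L X P mu :=
  [/\ forall x y, c x y <= 1 \/ k < c x y, ka <= k, hits c S W,
      [disjoint S & W] & W != set0] /\
  [/\ L = set0 -> X = set0 /\ mode = false & exists T,
  [/\ tok c T, #|T| <= ka, feasible c S W L X T & exists l, [/\ l <= k.+1 &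
      if mode then
        [/\ [disjoint reach (mask c T) P & W],
           forall A, P \subset A -> [disjoint A & W] -> l <= delta c A &
           (exists2 f, f \in P & f \in alive c W) /\
             H * (3 * ka + #|W|) + (H - l) <= mu + H \/
           H * (3 * ka + #|W| + 1) + (H - l) <= mu]
      else
        [/\ forall A, X \subset A -> [disjoint A & xsinks c S W L] -> l <= delta c A &
           (L == set0) + H * (3 * ka + #|W|) + (H - l) <= mu]]]].

(** [H - l] is positive as [l <= k + 1], and the nonempty [W] contributes at least [H], which covers
    the overdraft allowed in the second mode. *)
Lemma invariant_pos mode c ka W L X P : ~ invariant mode c ka W L X P 0.
Proof.
case=> [[_ _ _ _ W0] [_ [T [_ _ _ [l [hl]]]]]]; rewrite -card_gt0 in W0.
have : H <= H * (3 * ka + #|W|) by apply: leq_pmulr; rewrite addn_gt0 W0 orbT.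
case: mode => h -[]; last by lia.
by move=> _ _ [[_]|]; lia.
Qed.

Lemma delta_set0 c : delta c set0 = 0.
Proof. by rewrite /delta big_set0. Qed.

(** The set reached from [X] under [T] has a cut of at most [ka], so it cannot avoid [E]. By
    feasibility the node of [E] that it meets is not in [W :\: L]; it is an [S]-node which [T]
    separates from [W]. *)
Lemma step_over c ka W L X P mu E A :
  invariant false c ka W L X P mu.+1 ->
  flow_spec c X (xsinks c S W L) ka true E A ->
  exists2 f, f \in E & invariant true c ka W L X [set f] mu.
Proof.
move=> [[h1 h2 h3 h4 h5] [hL [T [hT cT hF [l [hl [hlb hmu]]]]]]] [EZ cE hE].
have [nb LX LW dX dead] := hF.
have L0 : L != set0.
  apply/eqP => L0; have [X0 _] := hL L0.
  have := hE set0; rewrite X0 sub0set delta_set0; move/(_ isT).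
  by rewrite ltn0 => /(_ _)/negP; apply => //; apply/disjointP => x; rewrite inE.
have [f fR fE] : exists2 f, f \in reach (mask c T) X & f \in E.
  apply/exists_inP; rewrite -[X in is_true X]negbK; apply/negP => /exists_inPn hn.
  have := hE _ (sub_reach (mask c T) X); rewrite ltnNge => /(_ _)/negP; apply.
    by apply/disjointP.
  exact: leq_trans (delta_reach_le _ hT) cT.
have := subsetP EZ f fE; rewrite in_setU in_setI => /orP[fWL|/andP[fS fal]].
  by case: (disjoint_absurd dX fR fWL).
exists f => //; split=> //; split; first by move=> e; rewrite e eqxx in L0.
exists T; split=> //; exists 0; split=> //; split=> //; first exact: dead.
(* The positive [H - l] pays for this step, and the restart of [l] is charged to the overdraft
   [H]. *)
left; split; first by exists f => //; apply: set11.
by lia.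
Qed.

(** [T] itself separates [P] from [W] at cost at most [ka]. *)
Lemma step_over_dead c ka W L X P mu E A :
  invariant true c ka W L X P mu -> ~ flow_spec c P W ka true E A.
Proof.
move=> [_ [_ [T [hT cT _ [l [_ [dP _ _]]]]]]] [EW _ /(_ _ (sub_reach (mask c T) P))].
rewrite ltnNge => /(_ _)/negP; apply; first exact: disjointWr dP.
exact: leq_trans (delta_reach_le _ hT) cT.
Qed.

Lemma mask_mask1 c T p : p \in T -> mask (mask c [set p]) (T :\ p) = mask c T.
Proof.
move=> pT; do 2!apply: functional_extensionality => ?; rewrite /mask !inE.
by case: eqP => //= ->; rewrite pT.
Qed.

Lemma mask_mask c T T' : mask (mask c T) T' = mask (mask c T') T.
Proof.
by do 2!apply: functional_extensionality => ?; rewrite /mask; case: ifP; case: ifP.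
Qed.

Lemma bad_mask c T : bad (mask c T) S -> bad c S.
Proof.
move=> [s [y [sS sy ys]]]; exists s, y; split=> //; last exact: connect_mask ys.
by move: sy; rewrite arc_mask => /andP[].
Qed.

Lemma feasible_delete c W L X T p : feasible c S W L X T -> p \in T ->
  feasible (mask c [set p]) S W L X (T :\ p).
Proof. by move=> h pT; rewrite /feasible mask_mask1. Qed.

Lemma cap_delete c (p : V * V) : (forall x y, c x y <= 1 \/ k < c x y) ->
  forall x y, mask c [set p] x y <= 1 \/ k < mask c [set p] x y.
Proof. by move=> h x y; rewrite /mask; case: ifP => // _; left. Qed.

Lemma hits_delete c W (p : V * V) : hits c S W -> hits (mask c [set p]) S W.
Proof. by move=> h; rewrite /hits mask_mask => /bad_mask. Qed.

Lemma tok_delete c T p : tok c T -> p \in T -> tok (mask c [set p]) (T :\ p).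
Proof.
move=> hT pT q /setD1P[qp qT]; rewrite /mask inE -surjective_pairing (negbTE qp).
exact: hT.
Qed.

Lemma step_cut mode c ka W L X P mu E A (src := if mode then P else X)
    (snk := if mode then W else xsinks c S W L) :
  invariant mode c ka W L X P mu.+1 -> flow_spec c src snk ka false E A ->
  cut c A != set0 ->
  exists2 p, p \in cut c A &
   (0 < ka /\ invariant mode (mask c [set p]) ka.-1 W L X P mu) \/
   (if mode then invariant mode c ka W L X (p.2 |: P) mu
    else invariant mode c ka W L (p.2 |: X) P mu).
Proof.
rewrite {}/src {}/snk.
move=> [[h1 h2 h3 h4 h5] [hL [T [hT cT hF [l [hl hm]]]]]] [far dA] cA.
have cap1 := cut_caps h1 (leq_trans dA h2).
have W0 : 0 < #|W| by rewrite card_gt0.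
case: mode hL hm far => hL hm far.
- have L0 : L != set0 by apply/eqP => /hL[].
  case: hm => dP hlb hmu.
  have [T' [tT' cT' hF' dP' [p pc pT']]] := push_dead h3 hF dP far hT cap1 cA.
  have {}cT' := leq_trans cT' cT; exists p => //.
  have lA : l <= delta c A by case: far => h6 h7 _; apply: hlb.
  case: pT' => pT'; [left|right].
  + have k0 : 0 < ka by apply: leq_trans cT'; rewrite card_gt0; apply/set0Pn; exists p.
    split=> //; split.
      split=> //; [exact: cap_delete | lia | exact: hits_delete].
    split=> //; exists (T' :\ p); split.
    * exact: tok_delete.
    * by rewrite -ltnS prednK //; move: cT'; rewrite (cardsD1 p T') pT'.
    * exact: feasible_delete.
    * exists 0; split=> //; split=> //; first by rewrite mask_mask1.
      (* Of the three released units, one stays as the reserve of the second alternative; the other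
         two repay the overdraft and restart [l]. *)
      have e1 : 3 * ka + #|W| = 3 * ka.-1 + #|W| + 1 + 2 by lia.
      have e2 := mulnDr H (3 * ka.-1 + #|W| + 1) 2; rewrite -e1 in e2.
      have e3 := mulnDr H (3 * ka + #|W|) 1.
      by right; case: hmu => [[_]|]; lia.
  (* [far_lower_bound] makes [delta c A + 1] the new lower bound; it is at most [k + 1] because
     [delta c A <= ka]. *)
  + split=> //; split=> //; exists T'; split=> //; exists (delta c A).+1; split; first by lia.
    split.
    * by rewrite reach_setU1.
    * move=> B pB BW; apply: far_lower_bound far _ pB BW.
      by move: pc; rewrite inE => /and3P[].
    * case: hmu => [[[f fP fal]] hmu|hmu]; [left|right]; last by lia.
      by split; [exists f => //; rewrite inE fP orbT|lia].
- case: hm => hlb hmu.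
  have [T' [tT' cT' hF' [p pc pT']]] := push_source h3 hF far hT cap1 cA.
  have {}cT' := leq_trans cT' cT; exists p => //.
  have lA : l <= delta c A by case: far => h6 h7 _; apply: hlb.
  case: pT' => pT'; [left|right].
  + have k0 : 0 < ka by apply: leq_trans cT'; rewrite card_gt0; apply/set0Pn; exists p.
    split=> //; split.
      split=> //; [exact: cap_delete | lia | exact: hits_delete].
    split=> //; exists (T' :\ p); split.
    * exact: tok_delete.
    * by rewrite -ltnS prednK //; move: cT'; rewrite (cardsD1 p T') pT'.
    * exact: feasible_delete.
    * exists 0; split=> //; split=> //.
      have e1 : 3 * ka + #|W| = 3 * ka.-1 + #|W| + 3 by lia.
      have e2 := mulnDr H (3 * ka.-1 + #|W|) 3; rewrite -e1 in e2.
      by case: (L == set0) hmu => /= hmu; lia.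
  (* With [L] empty, [X] is empty and [set0] is an admissible side of value 0, which contradicts a
     nonempty minimum cut. *)
  + have L0 : L != set0.
      apply/eqP => /hL[X0 _]; case: far => _ _ /(_ set0).
      rewrite X0 sub0set delta_set0 => /(_ isT) [|+ _].
        by apply/disjointP => x; rewrite inE.
      rewrite leqn0 => /eqP; rewrite delta_cut1 // => /eqP.
      by rewrite cards_eq0 (negbTE cA).
    split=> //; split; first by move=> e; rewrite e eqxx in L0.
    exists T'; split=> //.
      case: hF' => q1 q2 q3 q4 q5; split=> //; try by rewrite reach_setU1.
      by apply: subset_trans q2 _; exact: subsetUr.
    exists (delta c A).+1; split; first by lia.
    split.
    * move=> B pB BW; apply: far_lower_bound far _ pB BW.
      by move: pc; rewrite inE => /and3P[].
    * by rewrite (negbTE L0) in hmu *; lia.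
Qed.

Lemma step_dead_done c ka W L X P mu E A :
  invariant true c ka W L X P mu.+1 -> flow_spec c P W ka false E A ->
  cut c A = set0 -> invariant false c ka W L X set0 mu.
Proof.
move=> [h [hL [T [hT cT hF [l [hl [dP hlb hmu]]]]]]] [[PA AW _] dA] cA.
have L0 : L != set0 by apply/eqP => /hL[].
split=> //; split; first by move=> e; rewrite e eqxx in L0.
exists T; split=> //; exists 0; split=> //; split=> //; rewrite (negbTE L0).
case: hmu => [[[f fP /aliveP[w wW fw]] _]|hmu]; last by lia.
case: (disjoint_absurd AW _ wW); apply: closed_connect fw; last exact: (subsetP PA).
by apply: delta0_closed; rewrite delta_cut cA big_set0.
Qed.

(** Removing a class frees [H] for the restart of [l]. In the initial state [L] is empty and nothing
    is removed, but [l] is 0 already and the extra unit [(L == set0)] pays. *)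
Lemma step_class_done c ka W L X P mu E A :
  invariant false c ka W L X P mu.+1 ->
  flow_spec c X (xsinks c S W L) ka false E A -> cut c A = set0 ->
  hits c S (W :\: L) /\ (W :\: L != set0 ->
  exists2 L' : {set V}, L' \subset W :\: L & invariant false c ka (W :\: L) L' L' P mu).
Proof.
move=> [[h1 h2 h3 h4 h5] [hL [T [hT cT hF [l [hl [hlb hmu]]]]]]] [far dA] cA.
have [nb LX LW dX dead] := hF.
have h3' : hits c S (W :\: L) by apply: hits_setD far _.
split=> // W0.
have h4' : [disjoint S & W :\: L] by apply: disjointWr h4; exact: subsetDl.
have [L' L0 hF'] := last_class h4' nb W0.
exists L'; first by case: hF'.
split=> //; split; first by move=> e; rewrite e eqxx in L0.
exists T; split=> //; exists 0; split=> //; split=> //; rewrite (negbTE L0) add0n subn0.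
case: (eqVneq L set0) hmu => [e|ne] hmu.
  have [X0 _] := hL e; have : l <= 0.
    by rewrite -(delta_set0 c); apply: hlb; [rewrite X0|apply/disjointP=> x; rewrite inE].
  by rewrite e setD0; lia.
have : #|W :\: L| < #|W|.
  apply: proper_card; rewrite properEneq subsetDl andbT; apply: contraNneq ne => e.
  apply/eqP/setP => x; rewrite inE; apply/negP => xL.
  by have := subsetP LW x xL; rewrite -e inE xL.
move=> hlt; have := leq_mul (leqnn H) (_ : 3 * ka + #|W :\: L| + 1 <= 3 * ka + #|W|).
by rewrite mulnDr => /(_ _); lia.
Qed.

End Steps.

End Cuts.

(** * The program *)

(* [aSOL], [aOK]: the current solution, and whether one still exists;
   [aG]: the guessed bits; [aFOUND], [aCAND]: the outcome of the trials;
   [aDEL], [aW], [aL], [aX], [aP], [aMODE]: the state of a trial, as in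
   [invariant]; [aRES]: residual capacities; [aDIST]: one plus the distance
   from the sources [aSRC], or 0; [aCUR], [aPAR]: the arc being augmented;
   [aCNT], [aENDS]: number and end nodes of the augmenting paths; [aBACK]: the
   nodes that reach the sinks [aSNK] in the residual graph; [aROW]: the bits of
   the current step; [aCV]: the tails of the cut arcs; [aCHO], [aSEL]: the set
   chosen from and the choice; [aI]: the vertex being added. *)
Definition aADJ := 1.
Definition aS := 2.
Definition aSOL := 3.
Definition aOK := 4.
Definition aG := 5.
Definition aFOUND := 6.
Definition aCAND := 7.
Definition aDEL := 8.
Definition aW := 9.
Definition aL := 10.
Definition aX := 11.
Definition aP := 12.
Definition aMODE := 13.
Definition aSRC := 14.
Definition aSNK := 15.
Definition aRES := 16.
Definition aDIST := 17.
Definition aCUR := 18.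
Definition aPAR := 19.
Definition aCNT := 20.
Definition aENDS := 21.
Definition aBACK := 22.
Definition aRW := 23.
Definition aROW := 24.
Definition aSEL := 25.
Definition aRS := 26.
Definition aBAD := 27.
Definition aI := 28.
Definition aCV := 29.
Definition aCASE := 30.
Definition aCHO := 31.

(* Inside [CAsg a e] the variables 0 and 1 of [e] are the column and the row of
   the entry being written; each [ESum] and each enclosing [CFor] adds one
   variable. Vectors are stored in column 0 and scalars in entry (0, 0). *)
Definition rd0 a e := ERd a e (EC 0).
Definition sc a := rd0 a (EC 0).
Definition ENot e := ESub (EC 1) e.
Definition EAnd a b := EIf a b (EC 0).
Definition ELt a b := ESub b a.
Definition EEq a b := ENot (EAdd (ESub a b) (ESub b a)).
Definition ECard a := ESum (EIf (rd0 a (EV 0)) (EC 1) (EC 0)).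
(* The least index at which [e] is nonzero, or [N]. *)
Definition EMu e := ESum (ENot (ESum (EIf (ESub (EV 0) (EV 1)) (EC 0) e))).
Definition eN := EIn (EC 0).
(* The parameter truncated to the number of vertices. *)
Definition eK := ESub (EIn (EC 1)) (ESub (EIn (EC 1)) eN).
Definition eM := EAdd (EAdd (EAdd eK eK) (EAdd eK eK)) (EC 8).
Definition eKap := ESub eK (ECard aDEL).

(** In [edge], variable 0 is a node already present and variable 2 the node that it brings in; with
    these roles exchanged the closure runs backwards along the arcs. *)
Definition cclos a edge := CFor (CAsg a
  (EAdd (rd0 a (EV 1)) (ESum (EIf edge (rd0 a (EV 0)) (EC 0))))).

(* Capacity in the split graph: vertex [v < n] becomes an arc of capacity 1
   from node [v] to node [v + n]; every other arc is too expensive to cut. *)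
Definition capE p q :=
  EIf (ELt p eN)
    (EIf (EEq q (EAdd p eN)) (EIf (ESub p (sc aI)) (EC 0) (ENot (rd0 aDEL p))) (EC 0))
    (EIf (ELt q eN) (EIf (ERd aADJ (ESub p eN) q) (EAdd eK (EC 1)) (EC 0)) (EC 0)).

Definition cdist :=
  CSeq (CAsg aDIST (EIf (rd0 aSRC (EV 1)) (EC 1) (EC 0)))
  (CFor (CAsg aDIST (EIf (rd0 aDIST (EV 1)) (rd0 aDIST (EV 1))
     (EIf (ESum (EIf (rd0 aDIST (EV 0)) (ERd aRES (EV 0) (EV 2)) (EC 0)))
        (EAdd (EV 2) (EC 2)) (EC 0))))).

Definition ctrace :=
  CIf (ELt (EC 1) (rd0 aDIST (sc aCUR)))
  (CSeq (CAsg aPAR (EMu (EAnd (rd0 aDIST (EV 0))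
     (EAnd (ELt (rd0 aDIST (EV 0)) (rd0 aDIST (sc aCUR))) (ERd aRES (EV 0) (sc aCUR))))))
  (CSeq (CAsg aRES (EAdd (ESub (ERd aRES (EV 1) (EV 0))
       (EAnd (EEq (EV 1) (sc aPAR)) (EEq (EV 0) (sc aCUR))))
       (EAnd (EEq (EV 1) (sc aCUR)) (EEq (EV 0) (sc aPAR)))))
  (CAsg aCUR (sc aPAR)))).

Definition caug :=
  CSeq cdist
  (CSeq (CAsg aCUR (EMu (EAnd (rd0 aSNK (EV 0)) (rd0 aDIST (EV 0)))))
  (* [aCUR] is [N] if no sink is reached. The search stops after [eKap + 1] paths, one more than the
     budget allows for. *)
  (CIf (EAnd (ELt (sc aCUR) EN) (ELt (sc aCNT) (EAdd eKap (EC 1))))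
    (CSeq (CAsg aCNT (EAdd (sc aCNT) (EC 1)))
    (CSeq (CAsg aENDS (EAdd (EEq (EV 1) (sc aCUR)) (rd0 aENDS (EV 1))))
    (CFor ctrace))))).

Definition cflow :=
  CSeq (CAsg aRES (capE (EV 1) (EV 0)))
  (CSeq (CAsg aCNT (EC 0)) (CSeq (CAsg aENDS (EC 0))
  (CSeq (CFor caug)
  (CSeq (CAsg aBACK (rd0 aSNK (EV 1))) (cclos aBACK (ERd aRES (EV 2) (EV 0))))))).

Definition eOut e := ENot (ELt e eN).
Definition cprep :=
  CSeq (CAsg aRW (rd0 aW (EV 1)))
  (CSeq (cclos aRW (capE (EV 2) (EV 0)))
  (CSeq (CAsg aSNK (EIf (sc aMODE) (rd0 aW (EV 1))
     (EAdd (EAnd (rd0 aW (EV 1)) (ENot (rd0 aL (EV 1))))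
       (EAnd (eOut (EV 1)) (EAnd (rd0 aS (ESub (EV 1) eN)) (rd0 aRW (EV 1)))))))
  (CAsg aSRC (EIf (sc aMODE) (rd0 aP (EV 1)) (rd0 aX (EV 1)))))).

Definition ccase c x := CIf (EEq (sc aCASE) (EC c)) x.
Definition eOuts a :=
  EAdd (rd0 a (EV 1)) (EAnd (eOut (EV 1)) (rd0 aSEL (ESub (EV 1) eN))).

Definition cbranch1 := CSeq (CAsg aP (rd0 aSEL (EV 1))) (CAsg aMODE (EC 1)).
Definition cbranch2 := CAsg aDEL (EAdd (rd0 aDEL (EV 1)) (rd0 aSEL (EV 1))).
Definition cbranch3 := CAsg aP (eOuts aP).
Definition cbranch4 := CAsg aX (eOuts aX).
Definition cbranch5 := CSeq (CAsg aP (EC 0)) (CAsg aMODE (EC 0)).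
Definition cbranch6 := CSeq (CAsg aW (rd0 aCHO (EV 1)))
  (CSeq (CAsg aL (rd0 aSEL (EV 1))) (CAsg aX (rd0 aSEL (EV 1)))).

(** The cases: 1, the flow exceeds the budget; 2, a cut arc is deleted; 3 and 4, its head joins [P]
    or [X]; 5, the second kind of separation ends; 6, the next class is guessed. The last bit of the
    row decides between 2 and 3 or 4. *)
Definition cmove :=
  CSeq (CAsg aCV (EAnd (ELt (EV 1) eN) (EAnd (ENot (rd0 aBACK (EV 1)))
     (EAnd (rd0 aBACK (EAdd (EV 1) eN)) (capE (EV 1) (EAdd (EV 1) eN))))))
  (CSeq (CAsg aCASE (EIf (ELt eKap (sc aCNT)) (EC 1)
     (EIf (ECard aCV)
        (EIf (rd0 aROW (ESub eM (EC 1))) (EC 2) (EIf (sc aMODE) (EC 3) (EC 4)))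
        (EIf (sc aMODE) (EC 5) (EC 6)))))
  (CSeq (CAsg aCHO (EIf (EEq (sc aCASE) (EC 1)) (rd0 aENDS (EV 1))
     (EIf (ELt (sc aCASE) (EC 5)) (rd0 aCV (EV 1))
        (EAnd (rd0 aW (EV 1)) (ENot (rd0 aL (EV 1)))))))
  (* The bit of a candidate is found at its rank in the candidate set, so the number of bits does
     not depend on the number of nodes. *)
  (CSeq (CAsg aSEL (EAnd (rd0 aCHO (EV 1))
     (rd0 aROW (ESum (EIf (ELt (EV 0) (EV 2)) (EIf (rd0 aCHO (EV 0)) (EC 1) (EC 0)) (EC 0))))))
  (CSeq (ccase 1 cbranch1) (CSeq (ccase 2 cbranch2) (CSeq (ccase 3 cbranch3)
  (CSeq (ccase 4 cbranch4) (CSeq (ccase 5 cbranch5) (ccase 6 cbranch6))))))))).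

Definition gE u v :=
  EIf (ESub u (sc aI)) (EC 0) (EIf (ESub v (sc aI)) (EC 0)
   (EIf (rd0 aDEL u) (EC 0) (EIf (rd0 aDEL v) (EC 0) (ERd aADJ u v)))).

Definition ccheck :=
  CSeq (CAsg aBAD (EC 0))
  (CFor (CSeq (CAsg aRS (gE (EV 2) (EV 1)))
        (CSeq (cclos aRS (gE (EV 0) (EV 2)))
        (CAsg aBAD (EAdd (sc aBAD) (EAnd (rd0 aS (EV 2)) (rd0 aRS (EV 2)))))))).

(** The language has no product: [t * eM] is obtained by adding up [eM] over all indices below the
    round [t]. *)
Definition cload := CAsg aROW (EAnd (ELt (EV 1) eM)
  (rd0 aG (EAdd (ESum (EIf (ELt (EV 0) (EV 3)) eM (EC 0))) (EV 1)))).

Definition cpre := CSeq cprep cflow.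
Definition cstep := CSeq cpre (CSeq cload cmove).

(** Binary increment: a bit flips exactly when no lower bit is 0. *)
Definition cincr := CAsg aG
  (EIf (ESum (EIf (ELt (EV 0) (EV 2)) (ENot (rd0 aG (EV 0))) (EC 0)))
     (rd0 aG (EV 1)) (ENot (rd0 aG (EV 1)))).

Definition czero a := CAsg a (EC 0).

(* The scratch arrays are cleared so that the run of a trial depends only on
   the guessed bits. *)
Definition cstart :=
  CSeq (CAsg aW (EAnd (ELt (EV 1) eN) (EAdd (rd0 aSOL (EV 1)) (EEq (EV 1) (sc aI)))))
  (foldr (fun a => CSeq (czero a)) (czero aDEL)
    [:: aL; aX; aP; aMODE; aSRC; aSNK; aRES; aDIST; aCUR; aPAR; aCNT; aENDS;
        aBACK; aRW; aROW; aSEL; aRS; aBAD; aCV; aCASE; aCHO]).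

Definition caccept :=
  CIf (EAnd (ENot (sc aBAD)) (ENot (ESub (ECard aDEL) eK)))
    (CSeq (CAsg aCAND (rd0 aDEL (EV 1))) (CAsg aFOUND (EC 1))).

Definition ctrial :=
  CSeq cstart (CSeq (CFor cstep) (CSeq ccheck (CSeq caccept cincr))).

Definition cinit :=
  CSeq (CAsg aADJ (EAnd (ELt (EV 1) eN) (EAnd (ELt (EV 0) eN)
     (EIn (EAdd (EC 2) (EAdd (ESum (EIf (ELt (EV 0) (EV 2)) eN (EC 0))) (EV 0)))))))
  (CSeq (CAsg aS (EAnd (ELt (EV 1) eN)
     (EIn (EAdd (EC 2) (EAdd (ESum (EIf (ELt (EV 0) eN) eN (EC 0))) (EV 1))))))
  (CSeq (CAsg aSOL (EC 0)) (CAsg aOK (EC 1)))).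

Definition citer :=
  CSeq (CAsg aI (EV 2))
  (CSeq (CAsg aFOUND (EC 0)) (CSeq (CAsg aG (EC 0))
  (CSeq (CRep ctrial)
  (CSeq (CAsg aSOL (EIf (sc aFOUND) (rd0 aCAND (EV 1)) (rd0 aSOL (EV 1))))
  (CAsg aOK (EAnd (sc aOK) (sc aFOUND))))))).

Definition cmain := CSeq cinit (CFor (CIf (ELt (EV 0) eN) citer)).

Lemma cmain_wf : cwf cmain && onerep cmain.
Proof. by []. Qed.

Fixpoint wr c :=
  match c with
  | CAsg a _ => [:: a]
  | CSeq x y => wr x ++ wr y
  | CIf _ x | CFor x | CRep x => wr x
  end.

(** * Correctness of the program *)

Section Correct.
Variables (N R : nat) (inp : nat -> nat).
Hypothesis N0 : 0 < N.

Notation evl := (eval N inp).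
Notation exe := (exec N R inp).
Implicit Types (st : store) (env : seq nat).

Lemma iteri_ind (P : nat -> store -> Prop) (f : nat -> store -> store) m st :
  P 0 st -> (forall i s, i < m -> P i s -> P i.+1 (f i s)) -> P m (iteri m f st).
Proof.
move=> P0 PS; elim: m PS => [|m IH] PS //=; apply: (PS) => //; apply: IH => i s hi.
by apply: PS; apply: ltnW.
Qed.

Lemma exec_frame c env st a : a \notin wr c -> exe c env st a = st a.
Proof.
elim: c env st => [b e|x IHx y IHy|e x IHx|x IHx|x IHx] env st /=.
- by rewrite inE /upd -[eqn a b]/(a == b) => /negbTE ->.
- by rewrite mem_cat negb_or => /andP[hx hy]; rewrite IHy ?IHx.
- by case: ifP => // _; apply: IHx.
- move=> ha; apply: (iteri_ind (P := fun _ s => s a = st a)) => // i s _ <-.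
  exact: IHx.
- by move=> ha; elim: {1}R => //= m IHm; rewrite IHx.
Qed.

Lemma rd_ord st a (i j : 'I_N) : rd N st a i j = st a i j.
Proof. by rewrite /rd !ltn_ord. Qed.

Lemma rd_vec st a (i : 'I_N) : rd N st a i 0 = st a i 0.
Proof. by rewrite /rd ltn_ord N0. Qed.

Lemma rd_sc st a : rd N st a 0 0 = st a 0 0.
Proof. by rewrite /rd N0. Qed.

(** * Sets, closures and least indices in arrays *)

Definition vs st a : {set 'I_N} := [set i : 'I_N | st a i 0 != 0].

Lemma in_vs st a (i : 'I_N) : (i \in vs st a) = (st a i 0 != 0).
Proof. by rewrite inE. Qed.

Lemma vs_frame c env st a : a \notin wr c -> vs (exe c env st) a = vs st a.
Proof. by move=> h; rewrite /vs exec_frame. Qed.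

Lemma sum_neq0 (F : 'I_N -> nat) : (\sum_i F i != 0) = [exists i, F i != 0].
Proof. by rewrite sum_nat_eq0 negb_forall; apply: eq_existsb => i. Qed.

Definition grow (e : rel 'I_N) (A : {set 'I_N}) := A :|: [set i | [exists x in A, e x i]].

(** A walk shortens to one without repeated nodes, which is exhausted within [N] rounds. *)
Lemma iter_grow e A : iter N (grow e) A = [set i | [exists x in A, connect e x i]].
Proof.
have mono m m' : m <= m' -> iter m (grow e) A \subset iter m' (grow e) A.
  elim: m' => [|m' IH]; first by rewrite leqn0 => /eqP->.
  rewrite leq_eqVlt => /orP[/eqP-> //|/IH h]; apply: subset_trans h _.
  exact: subsetUl.
apply/setP => i; apply/idP/idP.
  suff H m : i \in iter m (grow e) A -> i \in [set i | [exists x in A, connect e x i]] by apply: H.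
  elim: m i => [|m IH] i /=.
    by move=> iA; rewrite inE; apply/exists_inP; exists i.
  case/setUP => [/IH//|]; rewrite !inE => /exists_inP[x /IH].
  rewrite inE => /exists_inP[y yA yx] xi; apply/exists_inP; exists y => //.
  exact: connect_trans yx (connect1 xi).
rewrite inE => /exists_inP[x xA /connectP[p hp ->]].
case/shortenP: hp => q hq uq _.
have sq : size q <= N.
  by move: (card_uniqP uq) => /= e1; have := max_card (mem (x :: q)); rewrite e1 card_ord; lia.
apply: (subsetP (mono _ _ sq)).
elim/last_ind: q hq {uq sq} => [|q z IH] //=.
rewrite rcons_path last_rcons size_rcons => /andP[/IH hq hz] /=.
by rewrite inE; apply/orP; right; rewrite inE; apply/exists_inP; exists (last x q).
Qed.

(** Each round overwrites [a], so [edge] has to express [e] in every store that differs from [st]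
    only there. *)
Lemma exec_cclos a edge env st (e : rel 'I_N) :
  (forall st', (forall b, b != a -> st' b = st b) ->
     forall (x i : 'I_N) t, (evl st' [:: val x, 0, val i, t & env] edge != 0) = e x i) ->
  vs (exe (cclos a edge) env st) a = [set i | [exists x in vs st a, connect e x i]].
Proof.
move=> he; rewrite -iter_grow.
suff [_ ->] : (forall b, b != a -> exe (cclos a edge) env st b = st b) /\
  vs (exe (cclos a edge) env st) a = iter N (grow e) (vs st a) by [].
rewrite /cclos /=.
apply: (iteri_ind (P := fun m s => (forall b, b != a -> s b = st b) /\
   vs s a = iter m (grow e) (vs st a))) => // t s _ [hs es].
split; first by move=> b hb; rewrite /upd -[eqn b a]/(b == a) (negbTE hb); apply: hs.
rewrite iterS -es; apply/setP => i; rewrite in_vs /upd /grow in_setU in_vs.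
rewrite -[eqn a a]/(a == a) eqxx rd_vec addn_eq0 negb_and; congr (_ || _).
rewrite sum_neq0 in_set; apply: eq_existsb => x; rewrite in_vs he //.
by rewrite rd_vec andbC; case: (e x i).
Qed.

(** The outer sum counts the indices [y] without a witness up to [y]; these are the ones below the
    least witness. *)
Lemma eval_mu st env e (f : nat -> bool) :
  (forall x y, x < N -> y < N -> (evl st [:: x, y & env] e != 0) = f x) ->
  (exists2 x, x < N & f x) -> evl st env (EMu e) < N /\ f (evl st env (EMu e)).
Proof.
move=> he hex.
have hex' : exists x, (x < N) && f x by case: hex => x h1 h2; exists x; rewrite h1.
case: (ex_minnP hex') => x0 /andP[x0N fx0] hmin.
suff -> : evl st env (EMu e) = x0 by [].
rewrite /EMu /=.
transitivity (\sum_(y < N) nat_of_bool (y < x0)).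
  apply: eq_bigr => y _; rewrite -[LHS]/(1 - _).
  case: ltnP => hy.
    rewrite big1 // => x _; case: ifP => // /negbT; rewrite negbK subn_eq0 => hxy.
    apply/eqP; rewrite -[_ == _]negbK he //; apply/negP => fx.
    by have := hmin x; rewrite ltn_ord fx => /(_ isT); lia.
  apply/eqP; rewrite subn_eq0 lt0n sum_neq0; apply/existsP; exists (Ordinal x0N) => /=.
  have -> : (x0 - y != 0) = false by lia.
  by rewrite he.
rewrite -(big_mkord xpredT (fun y => nat_of_bool (y < x0))).
rewrite (big_cat_nat (n := x0)) //=; last exact: ltnW.
rewrite [X in X + _](eq_big_nat _ _ (F2 := fun=> 1)); last by move=> i /andP[_ ->].
rewrite sum_nat_const_nat subn0 muln1 big_nat big1 ?addn0 // => i /andP[hi _].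
by rewrite ltnNge hi.
Qed.

Lemma eval_mu_none st env e :
  (forall x y, x < N -> y < N -> evl st [:: x, y & env] e = 0) ->
  evl st env (EMu e) = N.
Proof.
move=> he; rewrite /EMu /=; transitivity (\sum_(y < N) 1); last by rewrite sum1_card card_ord.
apply: eq_bigr => y _; rewrite big1 // => x _; case: ifP => // _; exact: he.
Qed.

Lemma exec_seq x y env st : exe (CSeq x y) env st = exe y env (exe x env st).
Proof. by []. Qed.
Lemma exec_asg a e env st :
  exe (CAsg a e) env st = upd st a (fun i j => evl st [:: j, i & env] e).
Proof. by []. Qed.
Lemma exec_if e x env st :
  exe (CIf e x) env st = if evl st env e != 0 then exe x env st else st.
Proof. by []. Qed.
Lemma exec_for x env st :
  exe (CFor x) env st = iteri N (fun i => exe x (i :: env)) st.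
Proof. by []. Qed.
Lemma upd_same st a f : upd st a f a = f.
Proof. by rewrite /upd -[eqn a a]/(a == a) eqxx. Qed.

(** * Augmenting paths and the flow *)

Definition resf st : 'I_N -> 'I_N -> nat := fun x y => st aRES x y.

(** The labels act as a potential that decreases towards the sources along residual arcs; the bound
    [N + 1] ensures that [N] rounds of tracing come down to label 1. *)
Definition dist_ok (d : nat -> nat) st :=
  [/\ [set i : 'I_N | d i != 0] = reach (resf st) (vs st aSRC),
      forall i : 'I_N, d i = 1 -> i \in vs st aSRC,
      forall i : 'I_N, 1 < d i ->
        exists2 u : 'I_N, 0 < d u < d i & 0 < resf st u i &
      forall i : 'I_N, d i <= N.+1].

Lemma exec_cdist env st :
  dist_ok (fun i => exe cdist env st aDIST i 0) st.
Proof.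
pose e : rel 'I_N := arc (resf st).
suff : [/\ exe cdist env st aRES = st aRES,
  vs (exe cdist env st) aDIST = iter N (grow e) (vs st aSRC),
  forall i : 'I_N, exe cdist env st aDIST i 0 = 1 -> i \in vs st aSRC,
  forall i : 'I_N, 1 < exe cdist env st aDIST i 0 -> exists2 u : 'I_N,
     0 < exe cdist env st aDIST u 0 < exe cdist env st aDIST i 0 & 0 < resf st u i
  & forall i : 'I_N, exe cdist env st aDIST i 0 <= N.+1].
  by case=> _ h1 h2 h3 h4; split=> //; rewrite -/(vs _ aDIST) h1 iter_grow.
rewrite /cdist exec_seq exec_for; set s0 := exe (CAsg _ _) env st.
apply: (iteri_ind (P := fun m s => [/\ s aRES = st aRES,
  vs s aDIST = iter m (grow e) (vs st aSRC),
  forall i : 'I_N, s aDIST i 0 = 1 -> i \in vs st aSRC,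
  forall i : 'I_N, 1 < s aDIST i 0 -> exists2 u : 'I_N,
     0 < s aDIST u 0 < s aDIST i 0 & 0 < resf st u i
  & forall i : 'I_N, s aDIST i 0 <= m.+1])).
  rewrite /s0 /=; split=> //.
  - apply/setP => i; rewrite !in_vs /upd /= rd_vec.
    by case: (st aSRC i 0).
  - by move=> i; rewrite /upd /= rd_vec in_vs; case: (st aSRC i 0).
  - by move=> i; rewrite /upd /= rd_vec; case: (st aSRC i 0).
  - by move=> i; rewrite /upd /= rd_vec; case: (st aSRC i 0).
move=> m s hm [h1 h2 h3 h4 h5].
set s' := exe _ _ s.
have val_i (i : 'I_N) : s' aDIST i 0 =
    if s aDIST i 0 != 0 then s aDIST i 0 else
    if [exists x in vs s aDIST, e x i] then m + 2 else 0.
  rewrite /s' exec_asg upd_same /= rd_vec; case: ifP => // _; rewrite sum_neq0.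
  congr (if _ then _ else _); apply: eq_existsb => x; rewrite rd_vec rd_ord in_vs h1.
  by rewrite /e /arc lt0n /resf; case: ifP; rewrite ?andbF ?andbT.
split.
- by rewrite -h1.
- rewrite iterS -h2; apply/setP => i; rewrite in_vs val_i in_setU in_vs in_set.
  case: (eqVneq (s aDIST i 0) 0) => [_|h] /=; last by rewrite h.
  by case: ifP; rewrite ?addn2.
- move=> i; rewrite val_i; case: ifP => [_|_]; first exact: h3.
  by case: ifP => //; rewrite addn2.
- move=> i; rewrite val_i; case: ifP => [di|_].
    move=> /h4 [u hu hr]; exists u => //; rewrite val_i.
    by have -> : s aDIST u 0 != 0 by lia.
  case: ifP => // /exists_inP[x xD xi] _; exists x; last exact: xi.
  rewrite val_i; move: xD; rewrite in_vs => xD; rewrite xD lt0n xD /=.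
  by have := h5 x; lia.
- move=> i; rewrite val_i; case: ifP => _; first by apply: leq_trans (h5 i) _.
  by case: ifP; lia.
Qed.

Lemma eq_nat_expr (a b : nat) : 1 - (a - b + (b - a)) = (a == b).
Proof. by case: (ltngtP a b); lia. Qed.

Lemma eqb_neq0 (b : bool) : ((b : nat) != 0) = b. Proof. by case: b. Qed.

(** Every arc altered so far has an end with a larger label than the current node, so the
    predecessor promised by the labels is still joined by a residual arc. The change of the cut
    values telescopes by [delta_shift]. *)
Lemma exec_trace env st (c0 : 'I_N) :
  dist_ok (fun i => st aDIST i 0) st -> st aCUR 0 0 = c0 -> st aDIST c0 0 != 0 ->
  exists2 s0, s0 \in vs st aSRC & forall A : {set 'I_N},
    delta (resf (exe (CFor ctrace) env st)) A + (s0 \in A) =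
    delta (resf st) A + (c0 \in A).
Proof.
move=> [_ d1 d2 d3] ec dc.
suff [_ [c [ec' [hc1 hc2] _ hc3]]] : exe (CFor ctrace) env st aDIST = st aDIST /\
   exists c : 'I_N, [/\ exe (CFor ctrace) env st aCUR 0 0 = c,
   st aDIST c 0 != 0 /\ (st aDIST c 0 <= 1 \/ st aDIST c 0 + N <= N.+1),
   forall x y : 'I_N, st aDIST x 0 <= st aDIST c 0 -> st aDIST y 0 <= st aDIST c 0 ->
     resf (exe (CFor ctrace) env st) x y = resf st x y &
   forall A : {set 'I_N}, delta (resf (exe (CFor ctrace) env st)) A + (c \in A) =
    delta (resf st) A + (c0 \in A)].
  exists c => //; apply: d1; by lia.
rewrite exec_for.
apply: (iteri_ind (P := fun m s => s aDIST = st aDIST /\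
   exists c : 'I_N, [/\ s aCUR 0 0 = c,
   st aDIST c 0 != 0 /\ (st aDIST c 0 <= 1 \/ st aDIST c 0 + m <= N.+1),
   forall x y : 'I_N, st aDIST x 0 <= st aDIST c 0 -> st aDIST y 0 <= st aDIST c 0 ->
     resf s x y = resf st x y &
   forall A : {set 'I_N}, delta (resf s) A + (c \in A) =
    delta (resf st) A + (c0 \in A)])).
  by split=> //; exists c0; split=> //; split=> //; right; rewrite addn0.
move=> m s hm [eD [c [ecs [dc0 dcm] hres hdel]]].
rewrite /ctrace exec_if [evl s _ _]/= rd_sc ecs rd_vec eD; case: ifP => hd; last first.
  by split=> //; exists c; split=> //; split=> //; left; lia.
have {}hd : 1 < st aDIST c 0 by lia.
rewrite exec_seq; set pe := EMu _; set s1 := exe _ _ s.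
rewrite exec_seq; set s2 := exe _ _ s1; set s3 := exe _ _ s2.
pose f x := [&& st aDIST x 0 != 0, st aDIST x 0 < st aDIST c 0 & s aRES x c != 0].
have [pv [es1 pN /and3P[p1 p2 p3]]] : exists pv, [/\ s1 aPAR 0 0 = pv, pv < N & f pv].
  exists (evl s [:: 0, 0, m & env] pe).
  suff [h1 h2] : evl s [:: 0, 0, m & env] pe < N /\ f (evl s [:: 0, 0, m & env] pe) by split.
  apply: (eval_mu (f := f)).
    move=> x y hx hy; rewrite /= rd_sc ecs rd_vec eD /f.
    rewrite (rd_vec s aDIST (Ordinal hx)) eD /= (rd_ord s aRES (Ordinal hx) c) /=.
    case: ifP => //= _; rewrite subn_eq0 -ltnNge; case: ifP => //.
  have [u /andP[hu1 hu2] hr] := d2 c hd; exists u => //; rewrite /f hu2 -lt0n hu1 /=.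
  rewrite -lt0n -[s aRES u c]/(resf s u c) hres //; exact: ltnW.
set p := Ordinal pN.
have es3 (x y : 'I_N) : s3 aRES x y = s aRES x y - ((x, y) == (p, c)) + ((x, y) == (c, p)).
  rewrite /s3 exec_asg -[upd _ _ _ aRES]/(s2 aRES) /s2 exec_asg upd_same /= !rd_sc es1.
  rewrite rd_ord -[s1 aRES]/(s aRES) -[s1 aCUR 0 0]/(s aCUR 0 0) ecs !xpair_eqE.
  rewrite !eq_nat_expr !eqb_neq0 -!val_eqE /=.
  by do 2!case: (x == _ :> nat).
split; first by rewrite -eD.
exists p; split.
- by rewrite /s3 exec_asg upd_same /= rd_sc.
- by split=> //; right; case: dcm => /= h; move: p2 hd; lia.
- move=> x y hx hy; rewrite -hres;
    [|exact: leq_trans hx (ltnW p2)|exact: leq_trans hy (ltnW p2)].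
  have xc : x != c by apply: contraTneq p2 => <-; rewrite -leqNgt.
  have yc : y != c by apply: contraTneq p2 => <-; rewrite -leqNgt.
  by rewrite /resf es3 !xpair_eqE (negbTE xc) (negbTE yc) andbF subn0 addn0.
- move=> A.
  have -> : resf s3 = shift (resf s) p c.
    by do 2!apply: functional_extensionality => ?; rewrite /resf es3.
  rewrite delta_shift.
  + exact: hdel.
  + by apply: contraTneq p2 => ep; rewrite -[X in st aDIST X 0]/(val p) ep ltnn.
  + by rewrite lt0n.
Qed.

Notation nn := (inp 0).
Notation kk := (inp 1 - (inp 1 - inp 0)).

Lemma eval_card st env a : evl st env (ECard a) = #|vs st a|.
Proof.
rewrite /= -sum1_card [RHS]big_mkcond; apply: eq_bigr => i _.
by rewrite in_vs rd_vec.
Qed.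

Definition kap st := kk - #|vs st aDEL|.

Lemma eval_kap st env : evl st env eKap = kap st.
Proof. by rewrite -[LHS]/(kk - evl st env (ECard aDEL)) eval_card. Qed.

Definition capn st (p q : nat) :=
  if nn - p != 0 then
    if 1 - (q - (p + nn) + (p + nn - q)) != 0 then
      if p - rd N st aI 0 0 != 0 then 0 else 1 - rd N st aDEL p 0 else 0
  else if nn - q != 0 then if rd N st aADJ (p - nn) q != 0 then kk + 1 else 0 else 0.

Lemma eval_cap st env p q : evl st env (capE p q) = capn st (evl st env p) (evl st env q).
Proof. by []. Qed.

Definition capf st : 'I_N -> 'I_N -> nat := fun x y => capn st x y.

Lemma exec_caug env st (s := exe caug env st) (X := vs st aSRC) (Z := vs st aSNK) :
  (st aCNT 0 0 <= kap st -> forall x, x \in X -> x \notin alive (resf st) Z) /\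
    [/\ s aRES = st aRES, s aCNT = st aCNT & s aENDS = st aENDS] \/
  exists2 t : 'I_N, t \in Z & [/\ st aCNT 0 0 <= kap st, s aCNT 0 0 = (st aCNT 0 0).+1,
    vs s aENDS = t |: vs st aENDS, exists2 x, x \in X & x \in alive (resf st) Z &
    forall A : {set 'I_N}, X \subset A ->
    delta (resf s) A + 1 = delta (resf st) A + (t \in A)].
Proof.
rewrite {}/s /caug exec_seq; set s1 := exe cdist env st.
have hd : dist_ok (fun i => s1 aDIST i 0) st by apply: exec_cdist.
have fr a : a \notin wr cdist -> s1 a = st a by apply: exec_frame.
rewrite exec_seq; set s2 := exe (CAsg aCUR _) env s1.
have fr2 a : a != aDIST -> a != aCUR -> s2 a = st a.
  move=> h1 h2; rewrite /s2 exec_frame ?inE //; apply: fr.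
  by rewrite !inE !negb_or h1.
have eD : s2 aDIST = s1 aDIST by [].
pose f (x : nat) := (st aSNK x 0 != 0) && (s1 aDIST x 0 != 0).
have fE x y : x < N -> y < N ->
  (evl s1 [:: x, y, 0, 0 & env] (EAnd (rd0 aSNK (EV 0)) (rd0 aDIST (EV 0))) != 0) = f x.
  move=> hx hy; rewrite /= (rd_vec s1 aSNK (Ordinal hx)) (rd_vec s1 aDIST (Ordinal hx)) /=.
  by rewrite fr // /f; case: ifP.
have cond : (evl s2 env (EAnd (ELt (sc aCUR) EN) (ELt (sc aCNT) (EAdd eKap (EC 1)))) != 0) =
   (s2 aCUR 0 0 < N) && (st aCNT 0 0 <= kap st).
  rewrite -[evl _ _ _]/(if N - rd N s2 aCUR 0 0 != 0 then evl s2 env eKap + 1 - rd N s2 aCNT 0 0 else 0).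
  have ek : kap s2 = kap st by rewrite /kap /vs fr2.
  have ec : s2 aCNT = st aCNT by apply: fr2.
  rewrite !rd_sc eval_kap ek ec subn_eq0 -ltnNge; case: ifP => //= _.
  by rewrite subn_eq0 -ltnNge addn1 ltnS.
case: (boolP [exists x : 'I_N, f x]) => [/existsP[x0 fx0]|hn]; last first.
  left; split.
    move=> _ x xX; apply/aliveP => -[z zZ xz].
    have : z \in [set i : 'I_N | s1 aDIST i 0 != 0].
      by case: hd => -> _ _ _; apply/reachP; exists x.
    rewrite inE => hz; move/existsPn/(_ z): hn; rewrite /f hz andbT.
    by move: zZ; rewrite in_vs => ->.
  rewrite exec_if cond.
  have -> : s2 aCUR 0 0 = N.
    apply: eval_mu_none => x y hx hy; apply/eqP; rewrite -[_ == _]negbK fE //.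
    by move/existsPn/(_ (Ordinal hx)): hn.
  by rewrite ltnn /=; split; apply: fr2.
have [tN /andP[ft1 ft2]] : s2 aCUR 0 0 < N /\ f (s2 aCUR 0 0).
  apply: (eval_mu (f := f)) => //; by exists x0.
rewrite exec_if cond tN andTb; case: (leqP (st aCNT 0 0) (kap st)) => hc; last first.
  by left; split=> //; split; apply: fr2.
right; pose t := Ordinal tN; exists t; first by rewrite in_vs.
rewrite !exec_seq.
set s3 := exe (CAsg aENDS _) env _.
have f3 a : a != aDIST -> a != aCUR -> a != aCNT -> a != aENDS -> s3 a = st a.
  by move=> h1 h2 h3 h4; rewrite /s3 !exec_frame ?inE //; apply: fr2.
split=> //.
- rewrite exec_frame // -[s3 aCNT 0 0]/(rd N s2 aCNT 0 0 + 1).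
  by rewrite rd_sc fr2 // addn1.
- rewrite vs_frame //; apply/setP => i; rewrite in_vs in_setU1 in_vs /s3 exec_asg upd_same /=.
  rewrite eq_nat_expr rd_sc rd_vec -[upd _ _ _ aENDS]/(s2 aENDS) fr2 //.
  rewrite -[upd _ _ _ aCUR 0 0]/(s2 aCUR 0 0) addn_eq0 negb_and.
  by rewrite eqb_neq0 -val_eqE.
- have : t \in [set i : 'I_N | s1 aDIST i 0 != 0] by rewrite inE.
  case: hd => -> _ _ _ /reachP[x xX xt]; exists x => //; apply/aliveP; exists t => //.
  by rewrite in_vs.
- move=> A XA.
  have [|||s0 s0X hs0] := exec_trace (st := s3) env (c0 := t).
  + have -> : (fun i => s3 aDIST i 0) = (fun i => s1 aDIST i 0) by [].
    have eR : resf s3 = resf st by rewrite /resf f3.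
    have eS : vs s3 aSRC = vs st aSRC by rewrite /vs f3.
    by rewrite /dist_ok eR eS.
  + by [].
  + by [].
  have s0A : s0 \in A by apply: (subsetP XA); move: s0X; rewrite /vs f3.
  by have := hs0 A; rewrite s0A /= => ->; rewrite /resf f3.
Qed.

(** A round that does not raise the count finds the flow complete or the limit reached. At most
    [kap st + 1] rounds raise it, and there are more than that. The cut identity is kept for sides
    that avoid the end nodes: such a side loses one unit per path. *)
Lemma exec_cflow env st (s := exe cflow env st) (X := vs st aSRC) (Z := vs st aSNK) :
  kap st + 2 <= N ->
  flow_spec (capf st) X Z (kap st) (kap st < s aCNT 0 0) (vs s aENDS) (~: vs s aBACK).
Proof.
move=> kN; rewrite {}/s /cflow exec_seq; set s1 := exe _ _ st.
rewrite exec_seq exec_seq; set s3 := exe _ _ (exe _ _ s1).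
have f3 a : a != aRES -> a != aCNT -> a != aENDS -> s3 a = st a.
  by move=> h1 h2 h3; rewrite /s3 /s1 !exec_frame ?inE.
have r3 : resf s3 = capf st by [].
rewrite exec_seq exec_for; set s4 := iteri _ _ _.
have : [/\ [/\ s4 aSRC = st aSRC, s4 aSNK = st aSNK & s4 aDEL = st aDEL],
  vs s4 aENDS \subset Z, s4 aCNT 0 0 <= (kap st).+1, #|vs s4 aENDS| <= s4 aCNT 0 0 &
  (forall A : {set 'I_N}, X \subset A -> [disjoint A & vs s4 aENDS] ->
     delta (resf s4) A + s4 aCNT 0 0 = delta (capf st) A) /\
  (N <= s4 aCNT 0 0 \/ (s4 aCNT 0 0 <= kap st -> forall x, x \in X -> x \notin alive (resf s4) Z))].
  apply: (iteri_ind (P := fun m s4 => [/\ [/\ s4 aSRC = st aSRC, s4 aSNK = st aSNK & s4 aDEL = st aDEL],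
    vs s4 aENDS \subset Z, s4 aCNT 0 0 <= (kap st).+1, #|vs s4 aENDS| <= s4 aCNT 0 0 &
    (forall A : {set 'I_N}, X \subset A -> [disjoint A & vs s4 aENDS] ->
       delta (resf s4) A + s4 aCNT 0 0 = delta (capf st) A) /\
    (m <= s4 aCNT 0 0 \/ (s4 aCNT 0 0 <= kap st -> forall x, x \in X -> x \notin alive (resf s4) Z))])).
    have e0 : vs s3 aENDS = set0 by apply/eqP; rewrite -subset0; apply/subsetP => i; rewrite in_vs.
    split=> //; rewrite ?e0 ?sub0set ?cards0 //.
    by split; [move=> A _ _; rewrite r3 addn0 | left].
  move=> m s hm [[fS fZ fD] h1 h2 h3 [h4 h5]].
  have eX : vs s aSRC = X by rewrite /vs fS.
  have eZ : vs s aSNK = Z by rewrite /vs fZ.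
  have eK : kap s = kap st by rewrite /kap /vs fD.
  case: (exec_caug (m :: env) s); rewrite eX eZ eK.
    move=> [hno [g1 g2 g3]].
    have gR : resf (exe caug (m :: env) s) = resf s by rewrite /resf g1.
    have gE : vs (exe caug (m :: env) s) aENDS = vs s aENDS by rewrite /vs g3.
    split; [by rewrite !exec_frame | by rewrite gE | by rewrite g2 | by rewrite gE g2 | ].
    rewrite gE gR g2; split=> //; by right.
  move=> [t tZ [c1 c2 c3 [x xX xal] c4]].
  split; [by rewrite !exec_frame | | by rewrite c2 | | ].
  - by rewrite c3 subUset sub1set tZ.
  - by rewrite c3 c2; apply: leq_trans (leq_card_setU _ _) _; rewrite cards1.
  - rewrite c2; split.
      move=> A XA; rewrite c3 => dA; rewrite -h4 //; last first.
        by apply: disjointWr dA; apply: subsetUr.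
      have tA : t \notin A by rewrite disjoint_sym in dA; move/disjointP: dA; apply; rewrite setU11.
      by have := c4 A XA; rewrite (negbTE tA); lia.
    case: h5 => [h5|h5]; first by left.
    by have := h5 c1 x xX; rewrite xal.
move=> [[fS fZ fD] h1 h2 h3 [h4 h5]].
have eX : vs s4 aSRC = X by rewrite /vs fS.
rewrite exec_seq; set s5 := exe _ _ s4; set s6 := exe _ _ s5.
have f6 a : a != aBACK -> s6 a = s4 a by move=> h; rewrite /s6 /s5 !exec_frame ?inE.
have eE : vs s6 aENDS = vs s4 aENDS by rewrite /vs f6.
rewrite f6 // eE; case: ltnP => hk.
  split=> //; first by apply: leq_trans h3 h2.
  by move=> A' XA' dA'; have := h4 A' XA' dA'; lia.
have hno : forall x, x \in X -> x \notin alive (resf s4) Z by case: h5 => [|/(_ hk)//]; lia.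
have eB : vs s6 aBACK = alive (resf s4) Z.
  rewrite /s6 (exec_cclos (e := fun x i => 0 < resf s4 i x)).
    apply/setP => i; rewrite !inE; apply: eq_existsb => x.
    rewrite in_vs -[s5 aBACK x 0]/(rd N s4 aSNK x 0) rd_vec fZ -in_vs; congr (_ && _).
    exact: (connect_rev (arc (resf s4)) x i).
  by move=> st' hst' x i t; rewrite /= rd_ord hst' // lt0n.
have [far dl] := is_far_residual h4 h1 hno.
by rewrite eB; split=> //; rewrite dl.
Qed.

(** * One move of the program *)

Hypothesis nN : nn + nn <= N.
Hypothesis kN : side kk < N.

Definition mode st := st aMODE 0 0 != 0.
Definition snode st := [set i : 'I_N | (nn <= i) && (st aS (i - nn) 0 != 0)].

Lemma rd_lt st a i : i < N -> rd N st a i 0 = st a i 0.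
Proof. by move=> h; rewrite /rd h N0. Qed.

Lemma rd_sub_vec st a (i : 'I_N) m : rd N st a (i - m) 0 = st a (i - m) 0.
Proof. by rewrite rd_lt //; apply: leq_ltn_trans (leq_subr _ _) (ltn_ord i). Qed.

Lemma capf_frame st st' : st' aI = st aI -> st' aDEL = st aDEL -> st' aADJ = st aADJ ->
  capf st' = capf st.
Proof. by rewrite /capf /capn /rd => -> -> ->. Qed.

Lemma out_expr i : (1 - (nn - i) != 0) = (nn <= i).
Proof. by lia. Qed.

Lemma exec_cprep env st (s := exe cprep env st) :
  vs s aSNK = (if mode st then vs st aW
               else xsinks (capf st) (snode st) (vs st aW) (vs st aL)) /\
  vs s aSRC = (if mode st then vs st aP else vs st aX).
Proof.
rewrite {}/s /cprep !exec_seq; set s1 := exe (CAsg aRW _) env st.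
set s2 := exe (cclos _ _) env s1; set s3 := exe (CAsg aSNK _) env s2.
have f2 a : a != aRW -> s2 a = st a.
  by move=> h; rewrite /s2 /s1 !exec_frame ?inE.
have eRW : vs s2 aRW = alive (capf st) (vs st aW).
  rewrite /s2 (exec_cclos (e := fun x i => 0 < capf st i x)).
    apply/setP => i; rewrite !inE; apply: eq_existsb => x.
    rewrite in_vs /s1 exec_asg upd_same /= rd_vec -in_vs; congr (_ && _).
    exact: (connect_rev (arc (capf st)) x i).
  move=> st' hst' x i t; rewrite eval_cap lt0n -[capn _ _ _]/(capf st' i x).
  by rewrite (capf_frame (st := st)) // hst'.
split; last first.
  apply/setP => i; rewrite in_vs exec_asg upd_same /= rd_sc !rd_vec /mode.
  have f3 a : a != aRW -> a != aSNK -> s3 a = st a.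
    by move=> h1 h2; rewrite /s3 exec_frame ?inE //; apply: f2.
  by rewrite !f3 //; case: ifP => _; rewrite in_vs.
rewrite vs_frame //; apply/setP => i; rewrite in_vs /s3 exec_asg upd_same /= rd_sc !rd_vec.
rewrite rd_sub_vec (f2 aMODE) // (f2 aW) // (f2 aL) // (f2 aS) //.
rewrite -[st aMODE 0 0 != 0]/(mode st); case: ifP => _; first by rewrite in_vs.
rewrite addn_eq0 negb_and in_setU in_setD in_setI; congr (_ || _).
  by rewrite !in_vs; case: (st aW i 0) => [|w]; rewrite ?andbF //; case: (st aL i 0) => [|l] //=; rewrite subSS sub0n.
rewrite -eRW in_vs [i \in snode st]inE out_expr.
by case: (nn <= i) => //=; case: (st aS (i - nn) 0 != 0).
Qed.

Lemma exec_ccase j x env s :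
  exe (ccase j x) env s = if s aCASE 0 0 == j then exe x env s else s.
Proof. by rewrite /ccase exec_if /= rd_sc eq_nat_expr eqb_neq0. Qed.

Definition rank (A : {set 'I_N}) (v : 'I_N) := #|[set x in A | x < v]|.

Lemma rank_lt (A : {set 'I_N}) (v : 'I_N) : v \in A -> rank A v < #|A|.
Proof.
move=> vA; apply: proper_card; rewrite properE; apply/andP; split.
  by apply/subsetP => x; rewrite inE => /andP[].
by apply/subsetPn; exists v => //; rewrite inE vA ltnn.
Qed.

Lemma rank_inj (A : {set 'I_N}) (v w : 'I_N) : v \in A -> w \in A ->
  rank A v = rank A w -> v = w.
Proof.
have mono (x y : 'I_N) : x \in A -> x < y -> rank A x < rank A y.
  move=> xA xy; apply: proper_card; rewrite properE; apply/andP; split.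
    apply/subsetP => z; rewrite !inE => /andP[-> /= zx]; exact: ltn_trans zx xy.
  by apply/subsetPn; exists x; rewrite !inE xA ?xy ?ltnn.
move=> vA wA e; apply: val_inj; case: (ltngtP v w) => // h.
  by have := mono _ _ vA h; rewrite e ltnn.
by have := mono _ _ wA h; rewrite e ltnn.
Qed.

(** Ranks stay below [#|A| <= q], so position [q] is free for the action bit. *)
Lemma row_exists (A B : {set 'I_N}) (act : bool) q : #|A| <= q -> B \subset A ->
  exists row : nat -> bool, (forall v, v \in A -> row (rank A v) = (v \in B)) /\ row q = act.
Proof.
move=> hA BA.
exists (fun i => if i == q then act else [exists v in B, rank A v == i]); split.
  move=> v vA; have hr := rank_lt vA; have -> : (rank A v == q) = false by lia.
  apply/exists_inP/idP => [[w wB /eqP e]|vB]; last by exists v.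
  by rewrite -(rank_inj (subsetP BA _ wB) vA e).
by rewrite eqxx.
Qed.

Lemma capf_caps st x y : capf st x y <= 1 \/ kk < capf st x y.
Proof.
rewrite /capf /capn; do ![case: ifP => _]; try by [left|right; rewrite addn1].
by left; rewrite leq_subr.
Qed.

Lemma capf_small st x y : 0 < capf st x y <= kk ->
  [/\ x < nn, y = x + nn :> nat & x \notin vs st aDEL].
Proof.
rewrite /capf /capn; case: ifP => hx; last by do ![case: ifP => _]; lia.
rewrite eq_nat_expr eqb_neq0; case: eqP => // ->; case: ifP => // _.
rewrite rd_vec in_vs negbK => h; split=> //; lia.
Qed.

Definition cvset st (A : {set 'I_N}) := [set p.1 | p in cut (capf st) A].

Definition presel st s2 :=
  if kap st < s2 aCNT 0 0 then vs s2 aENDS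
  else if cut (capf st) (~: vs s2 aBACK) != set0 then cvset st (~: vs s2 aBACK)
  else vs st aW :\: vs st aL.

Definition casev st s2 (act : bool) :=
  if kap st < s2 aCNT 0 0 then 1 else
  if cut (capf st) (~: vs s2 aBACK) != set0 then
    if act then 2 else if mode st then 3 else 4
  else if mode st then 5 else 6.

Definition cbranch c := nth cbranch6
  [:: cbranch6; cbranch1; cbranch2; cbranch3; cbranch4; cbranch5] c.

(* [s2] is the state after the flow computation and [s3] the same state with
   the guessed row loaded. *)
Lemma exec_cmove env st s2 s3 (row : nat -> bool) (B : {set 'I_N}) :
  (forall a, a \in [:: aDEL; aI; aADJ; aMODE; aW; aL] -> s2 a = st a) ->
  (~~ (kap st < s2 aCNT 0 0) -> delta (capf st) (~: vs s2 aBACK) <= kap st) ->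
  (forall a, a != aROW -> s3 a = s2 a) ->
  (forall i, i < side kk -> (s3 aROW i 0 != 0) = row i) ->
  #|presel st s2| <= (side kk).-1 -> B \subset presel st s2 ->
  (forall v, v \in presel st s2 -> row (rank (presel st s2) v) = (v \in B)) ->
  exists s4, [/\ exe cmove env s3 = exe (cbranch (casev st s2 (row (side kk).-1))) env s4,
    forall a, a \notin [:: aCV; aCASE; aCHO; aSEL; aROW] -> s4 a = s2 a,
    vs s4 aSEL = B & vs s4 aCHO = presel st s2].
Proof.
move=> f2 hd f3 hrow hpre BA hB.
have ff3 a : a \in [:: aDEL; aI; aADJ; aMODE; aW; aL] -> s3 a = st a.
  move=> ha; rewrite f3 ?f2 //; by apply: contraTneq ha => ->.
have q0 : (side kk).-1 < side kk by rewrite /side; lia.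
have ekap : kap s3 = kap st by rewrite /kap /vs ff3.
have ecap : capf s3 = capf st by apply: capf_frame; apply: ff3.
rewrite /cmove exec_seq; set t1 := exe _ _ s3.
have ft1 a : a != aCV -> t1 a = s3 a by move=> h; rewrite /t1 exec_frame ?inE.
have eCV : ~~ (kap st < s2 aCNT 0 0) -> vs t1 aCV = cvset st (~: vs s2 aBACK).
  move=> /hd dle; apply/setP => i.
  have capk p : p \in cut (capf st) (~: vs s2 aBACK) -> 0 < capf st p.1 p.2 <= kk.
    move=> pc; have : 0 < capf st p.1 p.2 by move: pc; rewrite inE => /and3P[].
    move=> -> /=; apply: leq_trans (leq_subr #|vs st aDEL| _); apply: leq_trans dle.
    by rewrite delta_cut (bigD1 p) //= leq_addr.
  rewrite in_vs /t1 exec_asg upd_same.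
  rewrite -[evl _ _ _]/(if nn - i != 0 then (if 1 - rd N s3 aBACK i 0 != 0 then
     (if rd N s3 aBACK (i + nn) 0 != 0 then capn s3 i (i + nn) else 0) else 0) else 0).
  rewrite rd_vec f3 //; case: (ltnP i nn) => hi; last first.
    have -> : (nn - i != 0) = false by lia.
    apply/esym/negbTE/imsetP => -[p pc ip].
    by have [+ _ _] := capf_small (capk p pc); rewrite -ip ltnNge hi.
  have -> : nn - i != 0 by lia.
  have iN : i + nn < N by lia.
  pose o := Ordinal iN; rewrite (rd_lt s3 aBACK iN) -[capn _ _ _]/(capf s3 i o) ecap f3 //.
  apply/idP/imsetP.
    case: ifP => // h1; case: ifP => // h2 h3; exists (i, o) => //.
    rewrite inE /= !in_setC !in_vs h2 /arc lt0n h3 andbT andbT.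
    by move: h1; case: (s2 aBACK i 0).
  case=> -[i' o'] pc /= ei; have [h1 h2 h3] := capf_small (capk _ pc); move: pc => /=.
  rewrite -ei /= in h1 h2 h3 *; have -> : o' = o by apply: val_inj.
  rewrite inE /= !in_setC !in_vs !negbK /arc lt0n => /and3P[/eqP-> -> ->] //.
have eCV0 : ~~ (kap st < s2 aCNT 0 0) ->
    (#|vs t1 aCV| != 0) = (cut (capf st) (~: vs s2 aBACK) != set0).
  move=> h; rewrite eCV // cards_eq0; congr (~~ _); apply/eqP/eqP => [e|e]; last by rewrite /cvset e imset0.
  apply/eqP; rewrite -subset0; apply/subsetP => p pc.
  by have := imset_f fst pc; rewrite -/(cvset st _) e inE.
rewrite exec_seq; set t2 := exe _ _ t1.
have ft2 a : a != aCV -> a != aCASE -> t2 a = s3 a.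
  by move=> h1 h2; rewrite /t2 exec_frame ?inE //; apply: ft1.
have eCASE : t2 aCASE 0 0 = casev st s2 (row (side kk).-1).
  rewrite /t2 exec_asg upd_same.
  set c := evl _ _ _.
  have -> : c = if evl t1 [:: 0, 0 & env] eKap < t1 aCNT 0 0 then 1 else
     if evl t1 [:: 0, 0 & env] (ECard aCV) != 0 then
       if t1 aROW (side kk).-1 0 != 0 then 2 else if mode t1 then 3 else 4
     else if mode t1 then 5 else 6.
    rewrite /c -[LHS]/(if rd N t1 aCNT 0 0 - evl t1 [:: 0, 0 & env] eKap != 0 then 1 else
     if evl t1 [:: 0, 0 & env] (ECard aCV) != 0 then
       if rd N t1 aROW (kk + kk + (kk + kk) + 8 - 1) 0 != 0 then 2 else
         if rd N t1 aMODE 0 0 != 0 then 3 else 4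
     else if rd N t1 aMODE 0 0 != 0 then 5 else 6).
    rewrite !rd_sc subn_eq0 -ltnNge.
    have -> : kk + kk + (kk + kk) + 8 - 1 = (side kk).-1 by rewrite /side; lia.
    by rewrite rd_lt //; lia.
  rewrite eval_kap eval_card /casev.
  have -> : kap t1 = kap st by rewrite -ekap /kap /vs ft1.
  have -> : mode t1 = mode st by rewrite /mode ft1 // ff3.
  rewrite !ft1 // hrow // [s3 aCNT]f3 //; case: ifP => // /negbT h.
  by rewrite eCV0.
rewrite exec_seq; set t3 := exe _ _ t2.
have ft3 a : a != aCV -> a != aCASE -> a != aCHO -> t3 a = s3 a.
  by move=> h1 h2 h3; rewrite /t3 exec_frame ?inE //; apply: ft2.
have eCHO : vs t3 aCHO = presel st s2.
  apply/setP => i; rewrite in_vs /t3 exec_asg upd_same /= rd_sc !rd_vec eCASE.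
  rewrite eq_nat_expr eqb_neq0 /presel /casev.
  case: (boolP (kap st < s2 aCNT 0 0)) => h.
    by rewrite /= ft2 // f3 // in_vs.
  have eC := eCV h; rewrite -/(t2 aCV) in eC.
  have eCt : t2 aCV = t1 aCV by [].
  case: (boolP (cut (capf st) (~: vs s2 aBACK) != set0)) => hc.
    have -> : forall b c : bool, ((if b then 2 else if c then 3 else 4) == 1) = false by case=> [[]|[]].
    have -> : forall b c : bool, (5 - (if b then 2 else if c then 3 else 4) != 0) by case=> [[]|[]].
    by rewrite eCt -in_vs eC.
  have -> : forall b : bool, ((if b then 5 else 6) == 1) = false by case.
  have -> : forall b : bool, (5 - (if b then 5 else 6) != 0) = false by case.
  rewrite !ft2 // !ff3 // in_setD !in_vs.
  by case: (st aW i 0) => [|w]; rewrite ?andbF //; case: (st aL i 0) => [|l] //=; rewrite subSS sub0n.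
rewrite exec_seq; set t4 := exe _ _ t3.
have eSEL : vs t4 aSEL = B.
  apply/setP => i; rewrite in_vs /t4 exec_asg upd_same.
  rewrite -[evl _ _ _]/(if rd N t3 aCHO i 0 != 0 then rd N t3 aROW
    (\sum_(x < N) if i - x != 0 then if rd N t3 aCHO x 0 != 0 then 1 else 0 else 0) 0 else 0).
  have -> : \sum_(x < N) (if i - x != 0 then if rd N t3 aCHO x 0 != 0 then 1 else 0 else 0) =
      rank (presel st s2) i.
    rewrite /rank -sum1_card [RHS]big_mkcond; apply: eq_bigr => x _.
    rewrite inE -eCHO in_vs rd_vec subn_eq0 -ltnNge.
    by case: (_ < _); rewrite ?andbF ?andbT.
  rewrite rd_vec -in_vs eCHO; case: ifP => hi; last first.
    by apply/esym/negbTE; apply: contraFN hi; apply: (subsetP BA).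
  have hr := rank_lt hi; rewrite rd_lt; last by lia.
  by rewrite ft3 // hrow; [apply: hB|lia].
exists t4; split=> //; last first.
- move=> a; rewrite !inE !negb_or => /and5P[h1 h2 h3 h4 h5].
  by rewrite /t4 exec_frame ?inE // ft3 // f3.
have eC4 : t4 aCASE 0 0 = casev st s2 (row (side kk).-1) by rewrite -eCASE.
have skip v j x s : s aCASE 0 0 = v -> v != j -> exe (ccase j x) env s = s.
  by move=> e /negbTE h; rewrite exec_ccase e h.
have hit j x s : s aCASE 0 0 = j -> exe (ccase j x) env s = exe x env s.
  by move=> e; rewrite exec_ccase e eqxx.
have sk v j x : t4 aCASE 0 0 = v -> v != j -> exe (ccase j x) env t4 = t4.
  exact: skip.
have sa v j x b : t4 aCASE 0 0 = v -> v != j -> aCASE \notin wr b ->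
    exe (ccase j x) env (exe b env t4) = exe b env t4.
  by move=> e h1 h2; apply: skip h1; rewrite exec_frame.
have hcase : casev st s2 (row (side kk).-1) \in [:: 1; 2; 3; 4; 5; 6].
  by rewrite /casev; do ![case: ifP => _].
move: hcase eC4; rewrite !exec_seq !inE.
do ![case/orP] => /eqP -> eC4.
- by rewrite (hit 1) // !(sa 1 2, sa 1 3, sa 1 4, sa 1 5, sa 1 6).
- by rewrite (sk 2 1) // (hit 2) // !(sa 2 3, sa 2 4, sa 2 5, sa 2 6).
- by rewrite (sk 3 1) // (sk 3 2) // (hit 3) // !(sa 3 4, sa 3 5, sa 3 6).
- by rewrite (sk 4 1) // (sk 4 2) // (sk 4 3) // (hit 4) // !(sa 4 5, sa 4 6).
- by rewrite (sk 5 1) // (sk 5 2) // (sk 5 3) // (sk 5 4) // (hit 5) // (sa 5 6).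
- by rewrite (sk 6 1) // (sk 6 2) // (sk 6 3) // (sk 6 4) // (sk 6 5) // (hit 6).
Qed.

(** * The branching invariant along a run *)

Definition ginv st mu :=
  [/\ #|vs st aDEL| <= kk, #|vs st aW| <= kk.+1 &
      invariant kk (snode st) (mode st) (capf st) (kap st)
        (vs st aW) (vs st aL) (vs st aX) (vs st aP) mu].

Definition gdone st :=
  [/\ #|vs st aDEL| <= kk, vs st aW = set0, vs st aL = set0, vs st aX = set0 &
      mode st = false /\ ~ bad (capf st) (snode st)].

Lemma flow_step env st :
  flow_spec (capf st) (if mode st then vs st aP else vs st aX)
    (if mode st then vs st aW else xsinks (capf st) (snode st) (vs st aW) (vs st aL))
    (kap st) (kap st < exe cpre env st aCNT 0 0) (vs (exe cpre env st) aENDS)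
    (~: vs (exe cpre env st) aBACK).
Proof.
rewrite /cpre exec_seq; set s1 := exe cprep env st.
have [e1 e2] := exec_cprep env st; rewrite -/s1 in e1 e2.
have ek : kap s1 = kap st by rewrite /kap vs_frame.
have ec : capf s1 = capf st by apply: capf_frame; apply: exec_frame.
have hk : kap s1 + 2 <= N by rewrite ek /kap; move: kN; rewrite /side; lia.
by have := exec_cflow env hk; rewrite e1 e2 ek ec.
Qed.

Definition core := [:: aDEL; aI; aADJ; aMODE; aW; aL; aX; aP; aS].

Lemma frame_pre env st a : a \in core -> exe cpre env st a = st a.
Proof. by move=> ha; apply: exec_frame; move: a ha; apply/allP. Qed.

Lemma snode_frame st st' : st' aS = st aS -> snode st' = snode st.
Proof. by move=> e; rewrite /snode e. Qed.

Lemma mode_frame st st' : st' aMODE = st aMODE -> mode st' = mode st.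
Proof. by move=> e; rewrite /mode e. Qed.

Lemma vs_eq st st' a : st' a = st a -> vs st' a = vs st a.
Proof. by move=> e; rewrite /vs e. Qed.

Lemma kap_frame st st' : st' aDEL = st aDEL -> kap st' = kap st.
Proof. by move=> e; rewrite /kap (vs_eq e). Qed.

Lemma vs_asg env st a e : vs (exe (CAsg a e) env st) a =
  [set i : 'I_N | evl st [:: 0, val i & env] e != 0].
Proof. by apply/setP => i; rewrite in_vs exec_asg upd_same inE. Qed.

Lemma vs_asg_vec env st a b : vs (exe (CAsg a (rd0 b (EV 1))) env st) a = vs st b.
Proof. by rewrite vs_asg; apply/setP => i; rewrite inE in_vs /= rd_vec. Qed.

Lemma vs_asg_zero env st a : vs (exe (CAsg a (EC 0)) env st) a = set0.
Proof. by rewrite vs_asg; apply/setP => i; rewrite !inE. Qed.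

Lemma vs_asg_outs env st a (v w : 'I_N) : vs st aSEL = [set v] -> w = v + nn :> nat ->
  vs (exe (CAsg a (eOuts a)) env st) a = w |: vs st a.
Proof.
move=> eS ew; rewrite vs_asg; apply/setP => i; rewrite inE in_setU1 in_vs /=.
rewrite rd_vec rd_sub_vec addn_eq0 negb_and orbC; congr (_ || _); rewrite out_expr.
case: (leqP nn i) => hi; last by apply/esym/negbTE; rewrite -val_eqE /= ew; lia.
have iN : i - nn < N by apply: leq_ltn_trans (leq_subr _ _) (ltn_ord i).
have := in_vs st aSEL (Ordinal iN); rewrite eS inE /= => <-.
by rewrite -!val_eqE /= ew; lia.
Qed.

Lemma capf_delete env st (v w : 'I_N) (s := exe cbranch2 env st) :
  v < nn -> w = v + nn :> nat -> vs st aSEL = [set v] ->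
  capf s = mask (capf st) [set (v, w)].
Proof.
move=> hv ew eS; have eD : vs s aDEL = v |: vs st aDEL.
  rewrite vs_asg; apply/setP => i; rewrite inE in_setU1 in_vs /= !rd_vec.
  rewrite addn_eq0 negb_and orbC; congr (_ || _).
  by rewrite -in_vs eS inE.
apply: functional_extensionality => x; apply: functional_extensionality => y.
rewrite /mask inE xpair_eqE /capf /capn.
rewrite !rd_vec !eq_nat_expr !eqb_neq0 -![rd N s _ _ _]/(rd N st _ _ _).
case: (ltnP x nn) => hx; last first.
  have -> : (nn - x != 0) = false by lia.
  have /negbTE -> : x != v by apply: contraTneq hx => ->; rewrite -ltnNge.
  by [].
have -> : nn - x != 0 by lia.
have eDx : (s aDEL x 0 != 0) = (x == v) || (st aDEL x 0 != 0).
  by rewrite -!in_vs eD in_setU1.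
have en (a : nat) : 1 - a = ~~ (a != 0) by case: a => // a; rewrite subSS sub0n.
rewrite !en eDx; case: eqP => [ey|ney].
  case: (eqVneq x v) => [ex|//] /=.
  have -> : y = w by apply: val_inj; rewrite /= ey ew ex.
  by rewrite eqxx; case: ifP.
by case: ifP.
Qed.

Lemma step_progress env st mu (s2 := exe cpre env st) : ginv st mu.+1 ->
  exists row : nat -> bool, forall env' s3,
    (forall a, a != aROW -> s3 a = s2 a) ->
    (forall i, i < side kk -> (s3 aROW i 0 != 0) = row i) ->
    ginv (exe cmove env' s3) mu \/ gdone (exe cmove env' s3).
Proof.
move=> [hD hW hinv].
have hflow := flow_step env st; rewrite -/s2 in hflow.
have f2 a : a \in core -> s2 a = st a by apply: frame_pre.
have hk1 : kap st <= kk by apply: leq_subr.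
have hdl : ~~ (kap st < s2 aCNT 0 0) -> delta (capf st) (~: vs s2 aBACK) <= kap st.
  by move=> /negbTE h; move: hflow; rewrite h => -[].
(* All cases reduce to naming an action bit [act] and a set [B] of candidates; the row encoding both
   is fixed before the state [s3] that contains it. *)
suff H (act : bool) (B : {set 'I_N}) : #|presel st s2| <= kk.+1 -> B \subset presel st s2 ->
    (forall env' s4, (forall a, a \in core -> s4 a = st a) -> vs s4 aSEL = B ->
        vs s4 aCHO = presel st s2 ->
        ginv (exe (cbranch (casev st s2 act)) env' s4) mu \/
        gdone (exe (cbranch (casev st s2 act)) env' s4)) ->
    exists row : nat -> bool, forall env' s3,
    (forall a, a != aROW -> s3 a = s2 a) ->
    (forall i, i < side kk -> (s3 aROW i 0 != 0) = row i) ->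
    ginv (exe cmove env' s3) mu \/ gdone (exe cmove env' s3).
  move: hflow hdl; case: ltnP => hover hflow hdl.
  - have md : mode st = false.
      apply/negbTE/negP => md; rewrite md in hinv hflow.
      exact: (step_over_dead hinv hflow).
    rewrite md in hinv hflow.
    have [f fE hinv'] := step_over hinv hflow.
    have ep : presel st s2 = vs s2 aENDS by rewrite /presel hover.
    apply: (H false [set f]); rewrite ?ep ?sub1set //.
      by case: hflow => _ h _; apply: leq_trans h _; rewrite ltnS.
    move=> env' s4 f4 eS _; left.
    have -> : casev st s2 false = 1 by rewrite /casev hover.
    rewrite -[cbranch 1]/cbranch1.
    set s5 := exe cbranch1 env' s4.
    have f5 a : a != aP -> a != aMODE -> a \in core -> s5 a = st a.
      by move=> h1 h2 h3; rewrite /s5 exec_frame ?inE ?negb_or ?h1 // f4.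
    have eP : vs s5 aP = [set f] by rewrite /s5 exec_seq vs_frame // vs_asg_vec.
    have eM : mode s5 = true by [].
    rewrite /ginv eP eM (vs_eq (f5 aDEL _ _ _)) // (vs_eq (f5 aW _ _ _)) // (vs_eq (f5 aL _ _ _)) // (vs_eq (f5 aX _ _ _)) // (snode_frame (f5 aS _ _ _)) //.
    have eK5 : kap s5 = kap st by apply/kap_frame/f5.
        have eC5 : capf s5 = capf st by apply: capf_frame; apply: f5.
        rewrite eK5 eC5; exact: And3 hD hW hinv'.
  - have hle := hdl isT.
    case: (eqVneq (cut (capf st) (~: vs s2 aBACK)) set0) => hcut.
    + have ep : presel st s2 = vs st aW :\: vs st aL by rewrite /presel ltnNge hover hcut eqxx.
      have hWL : #|vs st aW :\: vs st aL| <= kk.+1.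
        by apply: leq_trans hW; apply: subset_leq_card; apply: subsetDl.
      case: (boolP (mode st)) => md; rewrite ?md ?(negbTE md) in hinv hflow.
        have hinv' := step_dead_done hinv hflow hcut.
        apply: (H false set0); rewrite ?ep ?sub0set //.
        move=> env' s4 f4 _ _; left.
        have -> : casev st s2 false = 5 by rewrite /casev ltnNge hover hcut eqxx md.
        rewrite -[cbranch 5]/cbranch5.
        set s5 := exe cbranch5 env' s4.
        have f5 a : a != aP -> a != aMODE -> a \in core -> s5 a = st a.
          by move=> h1 h2 h3; rewrite /s5 exec_frame ?inE ?negb_or ?h1 // f4.
        have eP : vs s5 aP = set0 by rewrite /s5 exec_seq vs_frame // vs_asg_zero.
        have eM : mode s5 = false by [].
        rewrite /ginv eP eM (vs_eq (f5 aDEL _ _ _)) // (vs_eq (f5 aW _ _ _)) // (vs_eq (f5 aL _ _ _)) // (vs_eq (f5 aX _ _ _)) // (snode_frame (f5 aS _ _ _)) //.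
        have eK5 : kap s5 = kap st by apply/kap_frame/f5.
        have eC5 : capf s5 = capf st by apply: capf_frame; apply: f5.
        rewrite eK5 eC5; exact: And3 hD hW hinv'.
      have [hh hL] := step_class_done hinv hflow hcut.
      have core6 env' s4 B : (forall a, a \in core -> s4 a = st a) -> vs s4 aSEL = B ->
        vs s4 aCHO = vs st aW :\: vs st aL ->
        casev st s2 false = 6 /\ let s5 := exe cbranch6 env' s4 in
        [/\ [/\ vs s5 aDEL = vs st aDEL, capf s5 = capf st, kap s5 = kap st, snode s5 = snode st & mode s5 = false],
            vs s5 aW = vs st aW :\: vs st aL, vs s5 aL = B, vs s5 aX = B & vs s5 aP = vs st aP].
        move=> f4 eS eC; split; first by rewrite /casev ltnNge hover hcut eqxx (negbTE md).
        move=> s5.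
        have f5 a : a != aW -> a != aL -> a != aX -> a \in core -> s5 a = st a.
          by move=> h1 h2 h3 h4; rewrite /s5 exec_frame ?inE ?negb_or ?h1 ?h2 // f4.
        rewrite (vs_eq (f5 aDEL _ _ _ _)) // (vs_eq (f5 aP _ _ _ _)) // (snode_frame (f5 aS _ _ _ _)) //.
        rewrite (kap_frame (f5 aDEL _ _ _ _)) // (capf_frame (f5 aI _ _ _ _) (f5 aDEL _ _ _ _) (f5 aADJ _ _ _ _)) //.
        rewrite (mode_frame (f5 aMODE _ _ _ _)) // (negbTE md).
        split; [by split | | | | by []]; rewrite /s5 /cbranch6 !exec_seq.
        - by rewrite vs_frame // vs_frame // vs_asg_vec eC.
        - by rewrite vs_frame // vs_asg_vec vs_frame.
        - by rewrite vs_asg_vec !vs_frame.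
      case: (eqVneq (vs st aW :\: vs st aL) set0) => W0.
        apply: (H false set0); rewrite ?ep ?sub0set //.
        move=> env' s4 f4 eS eC; right.
        have [-> [[h1 h2 h3 h4 h5] h6 h7 h8 h9]] := core6 env' s4 _ f4 eS eC.
        rewrite -[cbranch 6]/cbranch6 /gdone h1 h2 h4 h5 h6 h7 h8; split=> //; split=> //.
        move: hh; rewrite /hits W0; suff -> : mask (capf st) (outs set0) = capf st by [].
        by do 2!apply: functional_extensionality => ?; rewrite /mask inE in_set0.
      have [L' L'W hinv'] := hL W0.
      apply: (H false L'); rewrite ?ep //.
      move=> env' s4 f4 eS eC; left.
      have [-> [[h1 h2 h3 h4 h5] h6 h7 h8 h9]] := core6 env' s4 _ f4 eS eC.
      rewrite -[cbranch 6]/cbranch6 /ginv h1 h2 h3 h4 h5 h6 h7 h8 h9.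
      exact: And3 hD hWL hinv'.
    + have ep : presel st s2 = cvset st (~: vs s2 aBACK) by rewrite /presel ltnNge hover hcut.
      have cap1 := cut_caps (capf_caps st) (leq_trans hle hk1).
      have cpre : #|presel st s2| <= kk.+1.
        rewrite ep; apply: leq_trans (leq_imset_card _ _) _; rewrite -delta_cut1 //.
        by apply: leq_trans hle (leq_trans hk1 _).
      have [[v w] pc hp] := step_cut hinv hflow hcut.
      have vw1 : capf st v w = 1 by apply: cap1 pc.
      have [|hv ew vD] := @capf_small st v w.
        rewrite vw1 /=; move: (leq_trans hle hk1); rewrite delta_cut (bigD1 (v, w)) //= vw1; lia.
      have sub : [set v] \subset presel st s2.
        by rewrite sub1set ep; apply/imsetP; exists (v, w).
      case: hp => [[k0 hinv']|hinv'].
        apply: (H true [set v]) => //.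
        move=> env' s4 f4 eS _; left.
        have -> : casev st s2 true = 2 by rewrite /casev ltnNge hover hcut.
        rewrite -[cbranch 2]/cbranch2.
        set s5 := exe cbranch2 env' s4.
        have f5 a : a != aDEL -> a \in core -> s5 a = st a.
          by move=> h1 h2; rewrite /s5 exec_frame ?inE ?negb_or ?h1 // f4.
        have eD : vs s5 aDEL = v |: vs st aDEL.
          rewrite vs_asg; apply/setP => i; rewrite inE in_setU1 in_vs /= !rd_vec f4 //.
          by rewrite addn_eq0 negb_and orbC -in_vs eS inE.
        have ec : capf s5 = mask (capf st) [set (v, w)].
          rewrite (capf_delete _ hv ew eS); congr mask; apply: capf_frame; exact: f4.
        have ek : kap s5 = (kap st).-1.
          by rewrite /kap eD cardsU1 vD; move: k0; rewrite /kap; lia.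
        rewrite /ginv eD ec ek (vs_eq (f5 aW _ _)) // (vs_eq (f5 aL _ _)) // (vs_eq (f5 aX _ _)) // (vs_eq (f5 aP _ _)) // (snode_frame (f5 aS _ _)) //.
        rewrite (mode_frame (f5 aMODE _ _)) //; split=> //.
        by rewrite cardsU1 vD; move: k0; rewrite /kap; lia.
      apply: (H false [set v]) => //.
      move=> env' s4 f4 eS _; left.
      case: (boolP (mode st)) => md; rewrite ?md ?(negbTE md) in hinv'.
        have -> : casev st s2 false = 3 by rewrite /casev ltnNge hover hcut md.
        rewrite -[cbranch 3]/cbranch3; set s5 := exe cbranch3 env' s4.
        have f5 a : a != aP -> a \in core -> s5 a = st a.
          by move=> h1 h2; rewrite /s5 exec_frame ?inE ?negb_or ?h1 // f4.
        have eP : vs s5 aP = w |: vs st aP.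
          by rewrite /s5 (vs_asg_outs _ _ eS ew); congr (_ |: _); apply: vs_eq; apply: f4.
        rewrite /ginv eP (vs_eq (f5 aDEL _ _)) // (vs_eq (f5 aW _ _)) // (vs_eq (f5 aL _ _)) // (vs_eq (f5 aX _ _)) // (snode_frame (f5 aS _ _)) //.
        rewrite (mode_frame (f5 aMODE _ _)) // md.
        have eK5 : kap s5 = kap st by apply/kap_frame/f5.
        have eC5 : capf s5 = capf st by apply: capf_frame; apply: f5.
        rewrite eK5 eC5; exact: And3 hD hW hinv'.
      have -> : casev st s2 false = 4 by rewrite /casev ltnNge hover hcut (negbTE md).
      rewrite -[cbranch 4]/cbranch4; set s5 := exe cbranch4 env' s4.
      have f5 a : a != aX -> a \in core -> s5 a = st a.
        by move=> h1 h2; rewrite /s5 exec_frame ?inE ?negb_or ?h1 // f4.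
      have eX : vs s5 aX = w |: vs st aX.
        by rewrite /s5 (vs_asg_outs _ _ eS ew); congr (_ |: _); apply: vs_eq; apply: f4.
      rewrite /ginv eX (vs_eq (f5 aDEL _ _)) // (vs_eq (f5 aW _ _)) // (vs_eq (f5 aL _ _)) // (vs_eq (f5 aP _ _)) // (snode_frame (f5 aS _ _)) //.
      rewrite (mode_frame (f5 aMODE _ _)) // (negbTE md).
      have eK5 : kap s5 = kap st by apply/kap_frame/f5.
        have eC5 : capf s5 = capf st by apply: capf_frame; apply: f5.
        rewrite eK5 eC5; exact: And3 hD hW hinv'.
move=> hp BA hB.
have q1 : kk.+1 <= (side kk).-1 by rewrite /side; lia.
have [row [hrow hact]] := row_exists act (leq_trans hp q1) BA.
exists row => env' s3 f3 hr.
have [|s4 [-> f4 eS eC]] := exec_cmove env' _ hdl f3 hr (leq_trans hp q1) BA hrow.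
  by move=> a ha; apply: f2; move: a ha; apply/allP.
rewrite hact; apply: hB => // a ha; rewrite f4 ?f2 //.
by move: a ha; apply/allP.
Qed.

(** The number of rounds is fixed, so a finished run must idle. With [W], [L] and [X] empty there
    are neither sources nor sinks, the minimum cut is empty, and the move is case 6 with nothing to
    choose. *)
Lemma step_done env env' st s3 : gdone st ->
  (forall a, a != aROW -> s3 a = exe cpre env st a) -> gdone (exe cmove env' s3).
Proof.
move=> [hD W0 L0 X0 [md nb]] f3.
set s2 := exe cpre env st in f3.
have f2 a : a \in core -> s2 a = st a by apply: frame_pre.
have hflow := flow_step env st; rewrite -/s2 md W0 L0 X0 in hflow.
have Z0 : xsinks (capf st) (snode st) set0 set0 = set0.
  apply/setP => x; rewrite in_setU in_setI in_setD in_set0 andbF /=.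
  by apply/negbTE; rewrite negb_and; apply/orP; right; apply/aliveP => -[w]; rewrite inE.
rewrite Z0 in hflow.
have hover : (kap st < s2 aCNT 0 0) = false.
  apply/negbTE/negP => h; rewrite h in hflow; case: hflow => E0 _ /(_ set0).
  rewrite sub0set delta_set0 ltn0 => /(_ isT) /(_ _)/negP; apply => //.
  by apply/disjointP => x; rewrite inE.
rewrite hover in hflow; case: hflow => -[_ _ /(_ set0 (sub0set _))] [|+ _ hle].
  by apply/disjointP => x; rewrite inE.
rewrite delta_set0 leqn0 => /eqP d0.
have hcut : cut (capf st) (~: vs s2 aBACK) = set0.
  apply/eqP; rewrite -cards_eq0 -delta_cut1 ?d0 //.
  by apply: (cut_caps (capf_caps st)); rewrite d0.
have ep : presel st s2 = set0 by rewrite /presel hover hcut eqxx W0 set0D.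
have [|||||||s4 [-> f4 eS eC]] := @exec_cmove env' st s2 s3 (fun i => s3 aROW i 0 != 0) set0.
- by move=> a ha; apply: f2; move: a ha; apply/allP.
- by rewrite d0.
- by [].
- by [].
- by rewrite ep cards0.
- by rewrite sub0set.
- by move=> v; rewrite ep inE.
have -> : casev st s2 (s3 aROW (side kk).-1 0 != 0) = 6 by rewrite /casev hover hcut eqxx md.
rewrite -[cbranch 6]/cbranch6.
set s5 := exe cbranch6 env' s4.
have f5 a : a != aW -> a != aL -> a != aX -> a \in core -> s5 a = st a.
  move=> h1 h2 h3 h4; rewrite /s5 exec_frame ?inE ?negb_or ?h1 ?h2 // f4 ?f2 //.
  by move: a h4 {h1 h2 h3}; apply/allP.
rewrite /gdone (vs_eq (f5 aDEL _ _ _ _)) // (snode_frame (f5 aS _ _ _ _)) //.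
rewrite (capf_frame (f5 aI _ _ _ _) (f5 aDEL _ _ _ _) (f5 aADJ _ _ _ _)) //.
rewrite (mode_frame (f5 aMODE _ _ _ _)) // md.
split=> //; rewrite /s5 /cbranch6 !exec_seq.
- by rewrite vs_frame // vs_frame // vs_asg_vec eC ep.
- by rewrite vs_frame // vs_asg_vec vs_frame.
- by rewrite vs_asg_vec !vs_frame.
Qed.

(** * Dependence of a run on the guessed bits *)

Fixpoint erd e :=
  match e with
  | EV _ | EC _ | EN => [::]
  | EIn e | ESum e => erd e
  | ERd a e1 e2 => a :: erd e1 ++ erd e2
  | EAdd e1 e2 | ESub e1 e2 => erd e1 ++ erd e2
  | EIf e1 e2 e3 => erd e1 ++ erd e2 ++ erd e3
  end.

Fixpoint crd c :=
  match c with
  | CAsg _ e => erd e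
  | CSeq x y => crd x ++ crd y
  | CIf e x => erd e ++ crd x
  | CFor x | CRep x => crd x
  end.

Definition agree (Ig : seq nat) st st' := forall a, a \notin Ig -> st a = st' a.

Lemma eval_agree Ig st st' env e : all [predC Ig] (erd e) -> agree Ig st st' ->
  evl st env e = evl st' env e.
Proof.
move=> + h; elim: e env => [i|c||e IH|a e1 IH1 e2 IH2|e1 IH1 e2 IH2|e1 IH1 e2 IH2|
   e1 IH1 e2 IH2 e3 IH3|e IH] env //=; rewrite ?all_cat.
- by move=> he; rewrite (IH env).
- by move=> /and3P[ha h1 h2]; rewrite (IH1 env) // (IH2 env) // /rd h.
- by move=> /andP[h1 h2]; rewrite (IH1 env) // (IH2 env).
- by move=> /andP[h1 h2]; rewrite (IH1 env) // (IH2 env).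
- by move=> /and3P[h1 h2 h3]; rewrite (IH1 env) // (IH2 env) // (IH3 env).
- by move=> he; apply: eq_bigr => i _; apply: IH.
Qed.

Lemma exec_agree Ig c env st st' : all [predC Ig] (crd c) -> agree Ig st st' ->
  agree Ig (exe c env st) (exe c env st').
Proof.
elim: c env st st' => [b e|x IHx y IHy|e x IHx|x IHx|x IHx] env st st' /=; rewrite ?all_cat.
- move=> he h a ha; rewrite /upd; case: (eqn a b); last exact: h.
  by do 2!apply: functional_extensionality => ?; apply: eval_agree he h.
- by move=> /andP[hx hy] h; apply: IHy => //; apply: IHx.
- move=> /andP[he hx] h; rewrite (eval_agree _ he h); case: ifP => // _.
  exact: IHx.
- by move=> hx h; elim: {1 3}N => //= m IHm; apply: IHx.
- by move=> hx h; elim: {1 3}R => //= m IHm; apply: IHx.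
Qed.

Fixpoint stepsf (f : nat -> store -> store) t q s :=
  if q is q'.+1 then stepsf f t.+1 q' (f t s) else s.

Lemma iteri_shift (f : nat -> store -> store) q s :
  iteri q.+1 f s = iteri q (fun i => f i.+1) (f 0 s).
Proof. by elim: q => //= q ->. Qed.

Lemma stepsf_iteri f t q s : stepsf f t q s = iteri q (fun i => f (t + i)) s.
Proof.
elim: q t s => [|q IH] t s; first by [].
rewrite iteri_shift [LHS]IH addn0; congr (iteri q _ _).
by apply: functional_extensionality => i; rewrite addSnnS.
Qed.

Definition steps env := stepsf (fun t => exe cstep (t :: env)).

Lemma stepsS env t q s : steps env t q.+1 s = steps env t.+1 q (exe cstep (t :: env) s).
Proof. by []. Qed.

Lemma exec_load t env s : t < N ->
  exe cload (t :: env) s aROW = fun i j =>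
    if i < side kk then rd N s aG (t * side kk + i) 0 else 0.
Proof.
move=> tN; apply: functional_extensionality => i; apply: functional_extensionality => j.
rewrite exec_asg upd_same.
rewrite -[evl _ _ _]/(if kk + kk + (kk + kk) + 8 - i != 0 then rd N s aG
   (\sum_(x < N) (if t - x != 0 then kk + kk + (kk + kk) + 8 else 0) + i) 0 else 0).
have -> : kk + kk + (kk + kk) + 8 = side kk by rewrite /side; lia.
rewrite subn_eq0 -ltnNge; congr (if _ then rd _ _ _ (_ + _) _ else _).
rewrite -(big_mkord xpredT (fun x => if t - x != 0 then side kk else 0)).
rewrite (big_cat_nat (n := t)) //=; last exact: ltnW.
rewrite [X in X + _](eq_big_nat _ _ (F2 := fun=> side kk)); last first.
  by move=> x /andP[_ hx]; rewrite subn_eq0 leqNgt hx.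
rewrite sum_nat_const_nat subn0 big_nat big1 ?addn0 // => x /andP[hx _].
by rewrite ifF //; lia.
Qed.

Lemma exec_step t env s : exe cstep (t :: env) s =
  exe cmove (t :: env) (exe cload (t :: env) (exe cpre (t :: env) s)).
Proof. by rewrite /cstep !exec_seq. Qed.

Lemma steps_done env t q s : gdone s -> gdone (steps env t q s).
Proof.
elim: q t s => [//|q IH] t s hs; rewrite stepsS; apply: IH.
rewrite exec_step; apply: (step_done (env := t :: env) _ hs) => a ha.
by rewrite exec_frame // inE.
Qed.

(** These arrays differ from trial to trial; within a step they are read only when the row is
    loaded. *)
Definition unread := [:: aG; aFOUND; aCAND].

Lemma pre_unread : all [predC unread] (crd cpre).
Proof. by []. Qed.

Lemma move_unread : all [predC unread] (crd cmove).
Proof. by []. Qed.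

(** The bits are collected along an ideal run from [st], one row per step. A run that starts equal
    to [st] outside [unread] and finds these bits in [aG] retraces it. *)
Lemma steps_exist env mu t st : (t + mu) * side kk <= N -> ginv st mu \/ gdone st ->
  exists b : nat -> bool, forall s q, agree unread s st -> mu <= q -> t + q <= N ->
    (forall i, t * side kk <= i < (t + mu) * side kk -> s aG i 0 = b i) ->
    gdone (steps env t q s).
Proof.
have agree_gdone s s' : agree unread s s' -> gdone s' -> gdone s.
  move=> h; rewrite /gdone !(vs_eq (h _ _)) // (mode_frame (h _ _)) //.
  by rewrite (snode_frame (h _ _)) // (capf_frame (h _ _) (h _ _) (h _ _)).
elim: mu t st => [|mu IH] t st hN [hst|hst].
- by case: hst => _ _ /invariant_pos.
- by exists (fun=> false) => s q h _ _ _; apply: steps_done; apply: agree_gdone hst.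
- have [row hrow] := step_progress (t :: env) hst.
  set s2 := exe cpre (t :: env) st in hrow.
  pose s3 := upd s2 aROW (fun i _ => if i < side kk then row i : nat else 0).
  have [||b hb] := IH t.+1 (exe cmove (t :: env) s3).
  + by rewrite addSnnS.
  + apply: hrow.
      by move=> a ha; rewrite /s3 /upd -[eqn a aROW]/(a == aROW) (negbTE ha).
    by move=> i hi; rewrite /s3 upd_same hi eqb_neq0.
  (* Block [t] of the guess is the row of this step; the later blocks come from the induction. *)
  exists (fun i => if i < t.+1 * side kk then row (i - t * side kk) else b i).
  move=> s [//|q] hs hq htq hG; rewrite stepsS; apply: hb; [|by []|by rewrite addSnnS|].
  + rewrite exec_step; apply: exec_agree move_unread _ => a ha.
    case: (eqVneq a aROW) => [->|ne].
      rewrite exec_load /s3 ?upd_same; last by lia.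
      apply: functional_extensionality => i; apply: functional_extensionality => j.
      case: ltnP => // hi; have hi2 : t * side kk + i < t.+1 * side kk by rewrite mulSn; lia.
      have hi3 : t.+1 * side kk <= (t + mu.+1) * side kk by rewrite leq_mul2r; apply/orP; right; lia.
      rewrite rd_lt; last by lia.
      rewrite exec_frame // hG; last by lia.
      by rewrite hi2 addKn.
    rewrite exec_frame ?inE // /s3 /upd -[eqn a aROW]/(a == aROW) (negbTE ne).
    by apply: (exec_agree (t :: env) pre_unread hs).
  + move=> i hi; rewrite exec_step exec_frame // exec_frame // exec_frame // hG.
      by have -> : (i < t.+1 * side kk) = false by lia.
    by rewrite -addSnnS; move: hi => /andP[h1 ->]; rewrite andbT; apply: leq_trans h1; rewrite mulSn leq_addl.
- by exists (fun=> false) => s q h _ _ _; apply: steps_done; apply: agree_gdone hst.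
Qed.

(** * The graph and its split graph *)

Definition vrel (adj : rel nat) b (D : {set 'I_N}) : rel 'I_N := fun u v =>
  [&& u < b, v < b, u \notin D, v \notin D & adj u v].

Definition vbad (adj : rel nat) (S : pred nat) b D :=
  exists s y : 'I_N, [/\ S s, vrel adj b D s y & connect (vrel adj b D) y s].

Definition capD (adj : rel nat) b (D : {set 'I_N}) : 'I_N -> 'I_N -> nat := fun x y =>
  if x < nn then ((y == x + nn :> nat) && (x < b) && (x \notin D) : nat)
  else if (y < nn) && adj (x - nn) y then kk.+1 else 0.

Definition adjst st : rel nat := fun u v => st aADJ u v != 0.
Definition sst st : pred nat := fun v => st aS v 0 != 0.
Definition bnd st := (st aI 0 0).+1.

Lemma capfE st : capf st = capD (adjst st) (bnd st) (vs st aDEL).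
Proof.
apply: functional_extensionality => x; apply: functional_extensionality => y.
rewrite /capf /capn /capD eq_nat_expr eqb_neq0 !subn_eq0 -!ltnNge rd_sc rd_vec in_vs.
have -> : rd N st aADJ (x - nn) y = st aADJ (x - nn) y.
  by rewrite /rd ltn_ord andbT; case: ltnP => //; have := ltn_ord x; lia.
case: ltnP => _.
  case: eqP => //= _; rewrite /bnd ltnS; case: leqP => //= _.
  by case: (st aDEL x 0) => // a; rewrite subSS sub0n.
by rewrite addn1; case: ltnP => //= _; case: ifP.
Qed.

Section Vertices.
Variables (adj : rel nat) (S : pred nat).
Hypothesis adj_lt : forall u v, adj u v -> u < nn /\ v < nn.
Hypothesis S_lt : forall v, S v -> v < nn.

(** [S] sits on the out-nodes and [W] on the in-nodes, which makes them disjoint as [last_class]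
    requires. *)
Definition sset := [set i : 'I_N | (nn <= i) && S (i - nn)].

Lemma node_ex (v : nat) : v < nn -> exists2 i : 'I_N, val i = v & exists o : 'I_N, val o = v + nn.
Proof.
move=> hv; have h1 : v < N by lia. have h2 : v + nn < N by lia.
by exists (Ordinal h1) => //; exists (Ordinal h2).
Qed.

Lemma bad_vbad b D : bad (capD adj b D) sset <-> vbad adj S b D.
Proof.
set c := capD adj b D; set g := vrel adj b D.
have arc_in (x y : 'I_N) : x < nn -> arc c x y = [&& y == x + nn :> nat, x < b & x \notin D].
  by move=> hx; rewrite /arc /c /capD hx -andbA lt0b.
have arc_out (x y : 'I_N) : nn <= x -> arc c x y = (y < nn) && adj (x - nn) y.
  move=> hx; rewrite /arc /c /capD; have -> : (x < nn) = false by lia.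
  by case: ifP.
split.
- move=> [so [y []]]; rewrite inE => /andP[hso hS] soy yso.
  have hs := S_lt hS.
  have [s es [_ _]] := node_ex hs.
  (* What a walk from [z] to the out-node of [s] says about the vertices. *)
  have main (z : 'I_N) : connect (arc c) z so ->
    (z < nn -> [/\ z < b, z \notin D, s < b, s \notin D & connect g z s]) /\
    (forall v : 'I_N, z = v + nn :> nat -> v < nn -> v = s \/
       exists2 w : 'I_N, adj v w & [/\ w < b, w \notin D, s < b, s \notin D & connect g w s]).
    move=> /connectP[p hp ez]; elim: p z hp ez => [|z' p IH] z /=.
      move=> _ e; split; first by rewrite -e ltnNge hso.
      move=> v ev _; left; apply: val_inj; rewrite es e ev /=; lia.
    move=> /andP[zz' hp] ez; have [IH1 IH2] := IH _ hp ez; split.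
      move=> hz; move: zz'; rewrite arc_in // => /and3P[/eqP ez' zb zD].
      case: (IH2 z ez' hz) => [e|[w zw [wb wD sb sD ws]]].
        by rewrite -e in zb zD *; split.
      split=> //; apply: connect_trans (connect1 _) ws.
      by rewrite /g /vrel zb wb zD wD.
    move=> v ev hv; right; move: zz'; rewrite arc_out ev ?leq_addl // addnK => /andP[hz' vz'].
    by exists z' => //; have [h1 h2 h3 h4 h5] := IH1 hz'.
  have [|s' es' _] := @node_ex (so - nn); first by [].
  move: soy; rewrite arc_out // => /andP[hy sy].
  have [/(_ hy)[yb yD sb sD ys] _] := main y yso.
  exists s, y; split=> //; first by rewrite -[nat_of_ord s]/(val s) es.
  by rewrite /vrel sb yb sD yD -[nat_of_ord s]/(val s) es.
- move=> [s [y [hS sy ys]]]; have hs := S_lt hS.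
  have [_ _ [so eso]] := node_ex hs.
  have H (u v : 'I_N) (uo vo : 'I_N) : val uo = u + nn -> val vo = v + nn -> g u v ->
      exists2 vi : 'I_N, arc c uo vi & arc c vi vo.
    move=> eu ev /and5P[ub vb uD vD uv]; have [hu hv] := adj_lt uv; exists v.
      by rewrite arc_out eu ?leq_addl // addnK hv uv.
    by rewrite arc_in // ev eqxx vb vD.
  have G (u v : 'I_N) (uo vo : 'I_N) : val uo = u + nn -> val vo = v + nn ->
      u < nn -> connect g u v -> connect (arc c) uo vo.
    move=> eu ev hu /connectP[p hp e]; elim: p u uo eu hu hp e => [|w p IH] u uo eu hu /=.
      move=> _ e; have -> : uo = vo by apply: val_inj; rewrite eu ev e.
      exact: connect0.
    move=> /andP[uw hp] e; have [_ hw] : u < nn /\ w < nn.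
      by apply: adj_lt; case/and5P: uw.
    have [_ _ [wo ewo]] := node_ex hw.
    have [wi h1 h2] := H _ _ _ _ eu ewo uw.
    apply: connect_trans (connect1 h1) (connect_trans (connect1 h2) _).
    exact: IH ewo hw hp e.
  have [_ hy] : s < nn /\ y < nn by apply: adj_lt; case/and5P: sy.
  have [_ _ [yo eyo]] := node_ex hy.
  have [yi h1 h2] := H _ _ _ _ eso eyo sy.
  exists so, yi; split=> //.
    by rewrite inE -[nat_of_ord so]/(val so) eso leq_addl addnK.
  by apply: connect_trans (connect1 h2) (G _ _ _ _ eyo eso hy ys).
Qed.

Definition arcset (b : nat) (D : {set 'I_N}) : {set 'I_N * 'I_N} :=
  [set p : 'I_N * 'I_N | [&& p.1 \in D, p.1 < nn, p.1 < b & p.2 == p.1 + nn :> nat]].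

Lemma mask_arcset b D : mask (capD adj b set0) (arcset b D) = capD adj b D.
Proof.
apply: functional_extensionality => x; apply: functional_extensionality => y.
rewrite /mask inE /= /capD in_set0.
case: (ltnP x nn) => hx; last by rewrite andbF.
by case: (x \in D) => //=; case: (x < b); case: eqP.
Qed.

Lemma mask_outs b (W : {set 'I_N}) : (forall w : 'I_N, w \in W -> w < nn) ->
  mask (capD adj b set0) (outs W) = capD adj b W.
Proof.
move=> hW; apply: functional_extensionality => x; apply: functional_extensionality => y.
rewrite /mask inE /= /capD in_set0.
case: (boolP (x \in W)) => // xW.
by rewrite hW // andbF.
Qed.

Lemma card_arcset b D : #|arcset b D| <= #|D|.
Proof.
have -> : #|arcset b D| = #|[set p.1 | p in arcset b D]|.
  rewrite card_in_imset // => -[x y] [x' y']; rewrite !inE /=.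
  move=> /and4P[_ _ _ /eqP e1] /and4P[_ _ _ /eqP e2] ex; congr pair => //.
  by apply: val_inj; rewrite /= e1 e2 ex.
by apply/subset_leq_card/subsetP => x /imsetP[p]; rewrite inE => /and4P[h _ _ _] ->.
Qed.

Lemma tok_arcset b D : tok (capD adj b set0) (arcset b D).
Proof.
by move=> p; rewrite inE => /and4P[_ h1 h2 h3]; rewrite /capD h1 h2 h3 in_set0.
Qed.

Lemma vbad_sub b b' (D D' : {set 'I_N}) : (forall v : 'I_N, v < b -> v \notin D -> v < b' /\ v \notin D') ->
  vbad adj S b D -> vbad adj S b' D'.
Proof.
move=> h.
have hg u v : vrel adj b D u v -> vrel adj b' D' u v.
  move=> /and5P[h1 h2 h3 h4 h5]; have [a1 a2] := h u h1 h3; have [a3 a4] := h v h2 h4.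
  by rewrite /vrel a1 a2 a3 a4.
move=> [s [y [sS sy ys]]]; exists s, y; split=> //; first exact: hg.
by apply: connect_sub ys => u v /hg/connect1.
Qed.

(** The initial potential: [3 * k + (k + 1)] units of [H = k + 2], a further [H] as [l] is 0, and 1
    for the first step, made with [L] empty. *)
Definition mu0 := kk.+2 * (4 * kk + 2) + 1.

(** The previous solution together with the new vertex [i] gives [W]; an arbitrary small solution
    [T0] becomes the hidden one. Starting with [L] and [X] empty turns the guess of the first class
    into an ordinary step. *)
Lemma ginv_start st (i : nat) (SOL T0 : {set 'I_N}) :
  adjst st = adj -> sst st = S -> st aI 0 0 = i -> i < nn ->
  vs st aW = [set v : 'I_N | (v < nn) && ((v \in SOL) || (v == i :> nat))] ->
  vs st aDEL = set0 -> vs st aL = set0 -> vs st aX = set0 -> mode st = false ->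
  #|SOL| <= kk -> ~ vbad adj S i SOL -> #|T0| <= kk -> ~ vbad adj S i.+1 T0 ->
  ginv st mu0.
Proof.
move=> eadj eS ei hi eW eD eL eX eM cS hS cT hT.
have eC : capf st = capD adj i.+1 set0 by rewrite capfE eadj /bnd ei eD.
have eSn : snode st = sset by rewrite /snode /sset -eS.
have cW : #|vs st aW| <= kk.+1.
  have [iv eiv _] := node_ex hi.
  apply: leq_trans (_ : #|iv |: SOL| <= _); last first.
    by apply: leq_trans (leq_card_setU _ _) _; rewrite cards1 add1n ltnS.
  apply: subset_leq_card; apply/subsetP => v; rewrite eW in_setU1 in_set => /andP[_].
  by rewrite orbC -val_eqE /= eiv.
have ek : kap st = kk by rewrite /kap eD cards0 subn0.
have hW (w : 'I_N) : w \in vs st aW -> w < nn by rewrite eW inE => /andP[].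
split=> //; first by rewrite eD cards0.
rewrite eM ek eC eSn eL eX; split.
  split=> //.
  - by move=> x y; rewrite -eC; apply: capf_caps.
  - rewrite /hits mask_outs // => /bad_vbad h; apply: hS; apply: vbad_sub h => v hv.
    rewrite eW inE negb_and negb_or -leqNgt => /orP[|/andP[h1 h2]]; last by split=> //; lia.
    by move=> h; exfalso; lia.
  - apply/disjointP => x; rewrite inE => /andP[h _]; apply/negP => /hW; lia.
  - have [iv eiv _] := node_ex hi; apply/set0Pn; exists iv.
    by rewrite eW inE -[nat_of_ord iv]/(val iv) eiv hi eqxx orbT.
split=> //; exists (arcset i.+1 T0).
have r0 (c : 'I_N -> 'I_N -> nat) : reach c set0 = set0.
  by apply/setP => x; rewrite in_set0; apply/negbTE/reachP => -[y]; rewrite inE.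
split.
- exact: tok_arcset.
- exact: leq_trans (card_arcset _ _) cT.
- split; rewrite ?sub0set // ?r0.
  + by rewrite mask_arcset => /bad_vbad.
  + by apply/disjointP => x; rewrite inE.
  + by move=> s _; rewrite inE.
- exists 0; split=> //; split=> //; rewrite eqxx /mu0.
  have := leq_mul (leqnn kk.+2) (_ : 3 * kk + #|vs st aW| <= 3 * kk + kk.+1).
  rewrite leq_add2l => /(_ cW).
  have -> : 4 * kk + 2 = 3 * kk + kk.+1 + 1 by lia.
  rewrite [kk.+2 * (_ + 1)]mulnDr muln1 subn0; set A := _ * _; set B := _ * (_ + kk.+1).
  by move: A B => A B /= hAB; rewrite add1n addSn addn1 ltnS leq_add2r.
Qed.

End Vertices.

(** * Testing a candidate *)

Lemma exec_ccheck env st :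
  (exe ccheck env st aBAD 0 0 != 0) <->
  vbad (adjst st) (sst st) (bnd st) (vs st aDEL).
Proof.
set g := vrel (adjst st) (bnd st) (vs st aDEL).
have gE_eval s env' u v (x y : 'I_N) : (forall a, a != aBAD -> a != aRS -> s a = st a) ->
    evl s env' u = x -> evl s env' v = y -> (evl s env' (gE u v) != 0) = g x y.
  move=> fs eu ev; rewrite /= eu ev rd_sc !rd_vec rd_ord !fs // /g /vrel /bnd !ltnS !in_vs.
  rewrite !subn_eq0 -!ltnNge /adjst.
  case: ltnP => //= _; case: ltnP => //= _.
  by case: (st aDEL x 0) => //=; case: (st aDEL y 0).
pose hit (s : 'I_N) := sst st s && [exists y, g s y && connect g y s].
suff [_ e] : (forall a, a != aBAD -> a != aRS -> exe ccheck env st a = st a) /\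
    (exe ccheck env st aBAD 0 0 != 0) = [exists s : 'I_N, (s < N) && hit s].
  rewrite e; split.
    by case/existsP=> s /and3P[_ hs /existsP[y /andP[sy ys]]]; exists s, y.
  case=> s [y [hs sy ys]]; apply/existsP; exists s; rewrite ltn_ord /hit hs /=.
  by apply/existsP; exists y; apply/andP.
rewrite /ccheck exec_seq exec_for; set s0 := exe _ _ st.
apply: (iteri_ind (P := fun m s => (forall a, a != aBAD -> a != aRS -> s a = st a) /\
    (s aBAD 0 0 != 0) = [exists s : 'I_N, (s < m) && hit s])).
  split; first by move=> a h1 h2; rewrite /s0 exec_frame ?inE.
  by apply/esym/negbTE/existsPn => s; rewrite ltn0.
move=> m s hm [fs es]; rewrite !exec_seq.
set s1 := exe (CAsg aRS _) _ s; set s2 := exe (cclos _ _) _ s1.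
have fs1 a : a != aBAD -> a != aRS -> s1 a = st a.
  by move=> h1 h2; rewrite /s1 exec_frame ?inE //; apply: fs.
have fs2 a : a != aBAD -> a != aRS -> s2 a = st a.
  by move=> h1 h2; rewrite /s2 exec_frame ?inE //; apply: fs1.
split; first by move=> a h1 h2; rewrite exec_frame ?inE //; apply: fs2.
pose om := Ordinal hm.
have e1 : vs s1 aRS = [set y | g om y].
  apply/setP => y; rewrite in_vs /s1 exec_asg upd_same inE.
  by rewrite (gE_eval s _ _ _ om y).
have e2 : vs s2 aRS = [set i | [exists x in vs s1 aRS, connect g x i]].
  rewrite /s2 (exec_cclos (e := g)) // => st' hst' x i t.
  by apply: gE_eval => // a h1 h2; rewrite hst' // fs1.
have e3 : (s2 aRS m 0 != 0) = [exists y, g om y && connect g y om].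
  have := in_vs s2 aRS om; rewrite e2 e1 inE => <-.
  by apply: eq_existsb => y; rewrite inE.
rewrite exec_asg upd_same.
rewrite -[evl _ _ _]/(rd N s2 aBAD 0 0 + (if rd N s2 aS m 0 != 0 then rd N s2 aRS m 0 else 0)).
have eB : s2 aBAD = s aBAD by rewrite /s2 /s1 !exec_frame.
rewrite rd_sc !rd_lt // eB addn_eq0 negb_and es fs2 //.
have -> : ((if st aS m 0 != 0 then s2 aRS m 0 else 0) != 0) = hit om.
  by rewrite /hit -e3 /sst /=; case: ifP.
apply/orP/existsP => [[/existsP[x /andP[xm hx]]|hx]|[x /andP[xm hx]]].
- by exists x; rewrite hx andbT; apply: leq_trans xm _.
- by exists om; rewrite hx andbT /=.
- move: xm; rewrite ltnS leq_eqVlt => /orP[/eqP xm|xm]; last first.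
    by left; apply/existsP; exists x; rewrite xm.
  by right; have <- : x = om by apply: val_inj.
Qed.

(** * The binary counter of guesses *)

Lemma bit_succ i r : odd (r.+1 %/ 2 ^ i) =
  odd (r %/ 2 ^ i) (+) all (fun x => odd (r %/ 2 ^ x)) (iota 0 i).
Proof.
elim: i r => [|i IH] r; first by rewrite !divn1 /= addbT.
have dv q : q %/ 2 ^ i.+1 = q./2 %/ 2 ^ i by rewrite expnS divnMA divn2.
have -> : all (fun x => odd (r %/ 2 ^ x)) (iota 0 i.+1) =
    odd r && all (fun x => odd (r./2 %/ 2 ^ x)) (iota 0 i).
  rewrite /= divn1 -[iota 1 i]/(iota (1 + 0) i) iotaDl all_map; congr (_ && _).
  by apply: eq_all => x /=; rewrite expnS divnMA divn2.
rewrite !dv; case: (boolP (odd r)) => hr /=.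
  by rewrite -IH uphalf_half hr.
by rewrite addbF uphalf_half (negbTE hr).
Qed.

Lemma bits_exist D (b : nat -> bool) :
  exists2 r, r < 2 ^ D & forall i, i < D -> odd (r %/ 2 ^ i) = b i.
Proof.
elim: D b => [|D IH] b; first by exists 0.
have [r hr hb] := IH (fun i => b i.+1).
exists (b 0 + r.*2); first by rewrite expnS; case: (b 0); lia.
case=> [|i] hi; first by rewrite divn1 oddD odd_double addbF oddb.
by rewrite expnS divnMA divn2 half_bit_double hb.
Qed.

Lemma exec_cincr env st r : (forall i, i < N -> st aG i 0 = odd (r %/ 2 ^ i)) ->
  forall i, i < N -> exe cincr env st aG i 0 = odd (r.+1 %/ 2 ^ i).
Proof.
move=> hG i hi; rewrite exec_asg upd_same bit_succ.
rewrite -[evl _ _ _]/(if \sum_(x < N) (if i - x != 0 then 1 - rd N st aG x 0 else 0) != 0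
   then rd N st aG i 0 else 1 - rd N st aG i 0).
rewrite rd_lt // hG // sum_neq0.
have -> : [exists x : 'I_N, (if i - x != 0 then 1 - rd N st aG x 0 else 0) != 0] =
    ~~ all (fun x => odd (r %/ 2 ^ x)) (iota 0 i).
  rewrite -has_predC; apply/existsP/hasP => [[x]|[x]].
    rewrite subn_eq0 -ltnNge; case: ltnP => // hx; rewrite rd_vec hG // => h.
    by exists (val x); rewrite ?mem_iota //=; move: h; case: (odd _).
  rewrite mem_iota /= add0n => hx hb; have hxN : x < N by apply: ltn_trans hi.
  exists (Ordinal hxN); rewrite subn_eq0 -ltnNge /= hx rd_lt // hG //.
  by rewrite (negbTE hb).
by case: (all _ _); case: (odd _).
Qed.

(** * Trials over all guesses *)

Lemma exec_zeros env b l s a :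
  exe (foldr (fun a => CSeq (czero a)) (czero b) l) env s a =
  if a \in b :: l then fun _ _ => 0 else s a.
Proof.
elim: l s => [|x l IH] s; rewrite [foldr _ _ _]/= ?exec_seq ?IH !inE.
  by rewrite /= /upd -[eqn a b]/(a == b); case: eqP.
case: (eqVneq a b) => //= _; case: (boolP (a \in l)); rewrite ?orbT ?orbF //= => _.
by rewrite /upd -[eqn a x]/(a == x); case: eqP.
Qed.

Definition scratch := [:: aL; aX; aP; aMODE; aSRC; aSNK; aRES; aDIST; aCUR; aPAR; aCNT;
  aENDS; aBACK; aRW; aROW; aSEL; aRS; aBAD; aCV; aCASE; aCHO].

Lemma exec_cstart env s a : exe cstart env s a =
  if a \in aDEL :: scratch then fun _ _ => 0 else
  exe (CAsg aW (EAnd (ELt (EV 1) eN) (EAdd (rd0 aSOL (EV 1)) (EEq (EV 1) (sc aI))))) env s a.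
Proof. by rewrite /cstart exec_seq exec_zeros. Qed.

Lemma wr_ctrial : all (fun a => (a == aW) || (a \in aDEL :: scratch) || (a \in unread)) (wr ctrial).
Proof. by []. Qed.

Lemma start_agree env st s : (forall a, a \notin wr ctrial -> s a = st a) ->
  agree unread (exe cstart env s) (exe cstart env st).
Proof.
move=> hs a ha; rewrite !exec_cstart; case: ifP => // hw.
rewrite !exec_asg /upd; case: (eqVneq a aW) => [->|ne].
  rewrite -[eqn aW aW]/true; do 2!apply: functional_extensionality => ?.
  have e1 : s aSOL = st aSOL by apply: hs.
  have e2 : s aI = st aI by apply: hs.
  by rewrite /= /rd e1 e2.
rewrite -[eqn a aW]/(a == aW) (negbTE ne); apply: hs.
apply: contraFN hw => hw; have := allP wr_ctrial a hw.
by rewrite (negbTE ne) (negbTE ha) orbF.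
Qed.

Hypothesis kN3 : side kk ^ 3 <= N.
Hypothesis RE : R = 2 ^ (side kk ^ 3).

(** Steps times bits per step: the length of the guess fits the counter, which explains the cube in
    the running time. *)
Lemma mu0_le : mu0 * side kk <= side kk ^ 3.
Proof.
rewrite (expnSr _ 2) leq_mul2r; apply/orP; right.
by rewrite /mu0 /side; move: kk => k; nia.
Qed.

Definition kept := [:: aADJ; aS; aI; aSOL; aFOUND; aCAND; aG].

Lemma frame_run a env s : a \in kept ->
  exe (CFor cstep) env (exe cstart env s) a = s a.
Proof.
move=> ha; have /andP[h1 h2] : (a \notin wr cstart) && (a \notin wr cstep).
  by move: a ha; apply/allP.
by rewrite (exec_frame (c := CFor cstep) _ _ h2) (exec_frame _ _ h1).
Qed.

Lemma frame_check a env s : a != aBAD -> a != aRS -> exe ccheck env s a = s a.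
Proof. by move=> h1 h2; apply: exec_frame; rewrite !inE !negb_or h1 h2. Qed.

Lemma exec_caccept env s (ok := (s aBAD 0 0 == 0) && (#|vs s aDEL| <= kk)) :
  [/\ exe caccept env s aG = s aG,
      ok -> exe caccept env s aFOUND 0 0 = 1 /\ vs (exe caccept env s) aCAND = vs s aDEL &
      ~~ ok -> exe caccept env s = s].
Proof.
have cond : (evl s env (EAnd (ENot (sc aBAD)) (ENot (ESub (ECard aDEL) eK))) != 0) = ok.
  rewrite -[evl _ _ _]/(if 1 - rd N s aBAD 0 0 != 0 then
     1 - (evl s env (ECard aDEL) - kk) else 0) eval_card rd_sc /ok.
  case: (s aBAD 0 0) => [|q]; last by rewrite subSS sub0n.
  by rewrite /= subn_eq0 -ltnNge ltnS leqn0 subn_eq0.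
split; first exact: exec_frame.
- move=> q; rewrite /caccept exec_if cond q; split=> //.
  by rewrite exec_seq vs_frame // vs_asg_vec.
- by move=> /negbTE q; rewrite /caccept exec_if cond q.
Qed.

Lemma frame_incr a env s : a != aG -> exe cincr env s a = s a.
Proof. by move=> h; apply: exec_frame; rewrite inE. Qed.

Lemma exec_trialE env s : exe ctrial env s = exe cincr env (exe caccept env
  (exe ccheck env (exe (CFor cstep) env (exe cstart env s)))).
Proof. by []. Qed.

Lemma frame_trial a env s : a \notin wr ctrial -> exe ctrial env s a = s a.
Proof. exact: exec_frame. Qed.

Lemma outside_trial : all (fun a => a \notin wr ctrial) [:: aADJ; aS; aI; aSOL; aOK].
Proof. by []. Qed.

Lemma start_G env s : exe cstart env s aG = s aG.
Proof. exact: exec_frame. Qed.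

Local Opaque cstep cstart ccheck caccept cincr ctrial.

Section Iter.
Variables (env : seq nat) (st : store) (i : nat) (T0 : {set 'I_N}).
Hypothesis (hi : i < nn) (eI : st aI 0 0 = i).
Hypothesis adj_lt : forall u v, adjst st u v -> u < nn /\ v < nn.
Hypothesis S_lt : forall v, sst st v -> v < nn.
Let good (D : {set 'I_N}) := #|D| <= kk /\ ~ vbad (adjst st) (sst st) i.+1 D.

Definition trial_inv r s :=
  [/\ forall a, a \notin wr ctrial -> s a = st a,
      forall j, j < N -> s aG j 0 = odd (r %/ 2 ^ j) &
      s aFOUND 0 0 != 0 -> good (vs s aCAND)].

Lemma trial_start : ~ vbad (adjst st) (sst st) i (vs st aSOL) -> #|vs st aSOL| <= kk ->
  good T0 -> ginv (exe cstart env st) mu0.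
Proof.
move=> h1 h2 [h3 h4]; set s := exe cstart env st.
have fs a : a \notin aDEL :: scratch -> a != aW -> s a = st a.
  move=> ha hb; rewrite /s exec_cstart (negbTE ha) exec_asg /upd -[eqn a aW]/(a == aW).
  by rewrite (negbTE hb).
have z a : a \in aDEL :: scratch -> vs s a = set0.
  by move=> ha; apply/setP => v; rewrite in_vs /s exec_cstart ha in_set0.
have eadj : adjst s = adjst st by rewrite /adjst fs.
have eS : sst s = sst st by rewrite /sst fs.
apply: (ginv_start adj_lt S_lt eadj eS _ hi _ _ _ _ _ h2 h1 h3 h4).
- by rewrite fs.
- apply/setP => v; rewrite in_vs /s exec_cstart [aW \in _]/= exec_asg upd_same in_set.
  rewrite /= rd_sc rd_vec eq_nat_expr eI in_vs subn_eq0 -ltnNge.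
  by case: ltnP => //= _; rewrite addn_eq0 negb_and eqb_neq0.
- exact: z.
- exact: z.
- exact: z.
- by rewrite /mode /s exec_cstart.
Qed.

Lemma trial_step r s : trial_inv r s ->
  [/\ trial_inv r.+1 (exe ctrial env s),
      s aFOUND 0 0 != 0 -> exe ctrial env s aFOUND 0 0 != 0 &
      gdone (exe (CFor cstep) env (exe cstart env s)) -> exe ctrial env s aFOUND 0 0 != 0].
Proof.
move=> [h1 h2 h3].
have outT a : a \in [:: aADJ; aS; aI; aSOL; aOK] -> s a = st a.
  by move=> ha; apply: h1; apply: (allP outside_trial).
have e1 : s aADJ = st aADJ by apply: outT.
have e2 : s aS = st aS by apply: outT.
have e3 : s aI = st aI by apply: outT.
have f4 a : a \notin wr ctrial -> exe ctrial env s a = st a.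
  by move=> ha; rewrite frame_trial // h1.
have f1 a : a \in kept -> exe (CFor cstep) env (exe cstart env s) a = s a by apply: frame_run.
move: f4; rewrite exec_trialE; move: (exe (CFor cstep) env _) f1 => s1 f1 f4.
have hb : (exe ccheck env s1 aBAD 0 0 != 0) <->
    vbad (adjst st) (sst st) i.+1 (vs (exe ccheck env s1) aDEL).
  have := exec_ccheck env s1; rewrite /adjst /sst /bnd (f1 aADJ) // (f1 aS) // (f1 aI) //.
  by rewrite e1 e2 e3 eI (vs_eq (frame_check (a := aDEL) _ _ _ _)).
have f2 a : a != aBAD -> a != aRS -> exe ccheck env s1 a = s1 a by apply: frame_check.
move: (exe ccheck env s1) hb f2 f4 => s2 hb f2.
have [g3 ok3 no3] := exec_caccept env s2.
move: (exe caccept env s2) g3 ok3 no3 => s3 g3 ok3 no3 f4.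
have found2 : s2 aFOUND = s aFOUND by rewrite f2 // f1.
have cand2 : s2 aCAND = s aCAND by rewrite f2 // f1.
have fr4 a : a != aG -> exe cincr env s3 a = s3 a by apply: frame_incr.
have good2 : (s2 aBAD 0 0 == 0) && (#|vs s2 aDEL| <= kk) -> good (vs s2 aDEL).
  by move=> /andP[q1 q2]; split=> // /hb; rewrite q1.
have gG : s3 aG = s aG by rewrite g3 f2 // f1.
split.
- split.
  + exact: f4.
  + by apply: exec_cincr => j hj; rewrite gG h2.
  + rewrite fr4 // (vs_eq (fr4 aCAND _)) //.
    case: (boolP ((s2 aBAD 0 0 == 0) && (#|vs s2 aDEL| <= kk))) => q.
      by case: (ok3 q) => _ ->; move=> _; apply: good2.
    by rewrite (no3 q) found2 (vs_eq cand2); apply: h3.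
- move=> q; rewrite fr4 //.
  case: (boolP ((s2 aBAD 0 0 == 0) && (#|vs s2 aDEL| <= kk))) => q'.
    by case: (ok3 q') => ->.
  by rewrite (no3 q') found2.
- move=> [d1 _ _ _ [_ nb]]; rewrite fr4 //.
  have eD : vs s2 aDEL = vs s1 aDEL by apply: vs_eq; apply: f2.
  have q : (s2 aBAD 0 0 == 0) && (#|vs s2 aDEL| <= kk).
    rewrite eD d1 andbT; apply/negPn/negP => /(proj1 hb) hv; apply: nb.
    have ea : adjst s1 = adjst st by rewrite /adjst f1 // e1.
    have es : sst s1 = sst st by rewrite /sst f1 // e2.
    have eb : bnd s1 = i.+1 by rewrite /bnd f1 // e3 eI.
    have -> : snode s1 = sset (sst st) by rewrite /snode /sset -es.
    by rewrite capfE ea eb; apply/bad_vbad => //; rewrite -eD.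
  by case: (ok3 q) => ->.
Qed.

Lemma trials_sound r s : trial_inv 0 s -> trial_inv r (iter r (exe ctrial env) s).
Proof.
move=> h0; elim: r => [|r IH]; first exact: h0.
by rewrite iterS; have [] := trial_step IH.
Qed.

(** The bits from [steps_exist] are the binary digits of some [r < R]. The trial with counter [r]
    ends in a tested solution, and later trials keep [aFOUND] set. *)
Lemma trials_complete s : trial_inv 0 s ->
  ~ vbad (adjst st) (sst st) i (vs st aSOL) -> #|vs st aSOL| <= kk -> good T0 ->
  iter R (exe ctrial env) s aFOUND 0 0 != 0.
Proof.
move=> h0 q1 q2 q3; have hst := trial_start q1 q2 q3.
have hN : (0 + mu0) * side kk <= N by apply: leq_trans mu0_le kN3.
have [b hb] := steps_exist env hN (or_introl hst).
have [r hr hbits] := bits_exist (side kk ^ 3) b; rewrite -RE in hr.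
have mono m : iter r.+1 (exe ctrial env) s aFOUND 0 0 != 0 ->
    iter (m + r.+1) (exe ctrial env) s aFOUND 0 0 != 0.
  move=> h; elim: m => [|m IH]; first exact: h.
  by rewrite addSn iterS; have [_ q _] := trial_step (trials_sound (m + r.+1) h0); apply: q.
suff h : iter r.+1 (exe ctrial env) s aFOUND 0 0 != 0.
  by have := mono (R - r.+1) h; rewrite subnK.
rewrite iterS.
have hinv := trials_sound r h0; have [_ _] := trial_step hinv; apply.
set sr := iter r _ s in hinv *.
have -> : exe (CFor cstep) env (exe cstart env sr) = steps env 0 N (exe cstart env sr).
  by rewrite /steps stepsf_iteri.
have [f1 f2 f3] := hinv.
apply: hb.
- exact: start_agree.
- apply: leq_trans kN3; apply: leq_trans mu0_le; apply: leq_pmulr.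
  by rewrite /side addn_gt0 orbT.
- exact: leqnn.
- move=> j /andP[_ hj]; have hj3 : j < side kk ^ 3 by apply: leq_trans hj mu0_le.
  by rewrite start_G f2 ?hbits //; apply: leq_trans hj3 kN3.
Qed.

End Iter.

(** * Iterative compression *)

Definition good adj S b (D : {set 'I_N}) := #|D| <= kk /\ ~ vbad adj S b D.

Lemma exec_rep x env st : exe (CRep x) env st = iter R (exe x env) st.
Proof. by []. Qed.

Lemma exec_citer env i st : i < nn ->
  (forall u v, adjst st u v -> u < nn /\ v < nn) -> (forall v, sst st v -> v < nn) ->
  [/\ exe citer (i :: env) st aADJ = st aADJ, exe citer (i :: env) st aS = st aS,
   exe citer (i :: env) st aOK 0 0 != 0 ->
     good (adjst st) (sst st) i.+1 (vs (exe citer (i :: env) st) aSOL) &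
   st aOK 0 0 != 0 -> good (adjst st) (sst st) i (vs st aSOL) ->
     (exists T0, good (adjst st) (sst st) i.+1 T0) ->
     exe citer (i :: env) st aOK 0 0 != 0].
Proof.
move=> hi hadj hS; rewrite /citer !exec_seq exec_rep.
set s1 := exe (CAsg aG _) _ _.
have f1 a : a \notin [:: aI; aFOUND; aG] -> s1 a = st a.
  by rewrite !inE !negb_or => /and3P[h1 h2 h3]; rewrite /s1 !exec_frame ?inE.
have eI : s1 aI 0 0 = i by [].
have inv0 : trial_inv s1 i 0 s1.
  by split=> // j hj; rewrite div0n.
have e1 : s1 aADJ = st aADJ by apply: f1.
have e2 : s1 aS = st aS by apply: f1.
have e3 : s1 aOK = st aOK by apply: f1.
have e4 : vs s1 aSOL = vs st aSOL by apply: vs_eq; apply: f1.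
have ea : adjst s1 = adjst st by rewrite /adjst e1.
have es : sst s1 = sst st by rewrite /sst e2.
have hadj1 u v : adjst s1 u v -> u < nn /\ v < nn by rewrite ea; apply: hadj.
have hS1 v : sst s1 v -> v < nn by rewrite es; apply: hS.
have [fr _ hsound] := trials_sound (i :: env) eI hadj1 hS1 R inv0.
have hcomp T0 := trials_complete (T0 := T0) (i :: env) hi eI hadj1 hS1 inv0.
rewrite ea es e4 in hsound hcomp.
set s2 := iter R _ s1 in fr hsound hcomp *; clearbody s2.
have fr2 a : a \in [:: aADJ; aS; aI; aSOL; aOK] -> s2 a = s1 a.
  by move=> ha; apply: fr; apply: (allP outside_trial).
set s3 := exe (CAsg aSOL _) _ s2.
have f3 a : a != aSOL -> s3 a = s2 a by move=> h; rewrite /s3 exec_frame ?inE.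
have f4 a e : a != aOK -> exe (CAsg aOK e) (i :: env) s3 a = s3 a.
  by move=> h; rewrite exec_frame ?inE.
have eOK : exe (CAsg aOK (EAnd (sc aOK) (sc aFOUND))) (i :: env) s3 aOK 0 0 =
    if st aOK 0 0 != 0 then s2 aFOUND 0 0 else 0.
  by rewrite exec_asg upd_same /= !rd_sc !f3 // fr2 // e3.
rewrite (f4 aADJ) // (f4 aS) // (f3 aADJ) // (f3 aS) // eOK; split.
- by rewrite fr2.
- by rewrite fr2.
- case: ifP => // _ hF; rewrite vs_frame //.
  suff -> : vs s3 aSOL = vs s2 aCAND by apply: hsound.
  by rewrite /s3 vs_asg; apply/setP => v; rewrite inE in_vs /= rd_sc hF rd_vec.
- by move=> -> [h1 h2] [T0 hT0]; apply: (hcomp T0).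
Qed.

Local Opaque citer.

Lemma exec_cmain st0 (adj : rel nat) (S : pred nat) :
  (forall u v, u < nn -> v < nn -> adj u v = (inp (2 + (u * nn + v)) != 0)) ->
  (forall v, v < nn -> S v = (inp (2 + (nn * nn + v)) != 0)) ->
  (forall u v, adj u v -> u < nn /\ v < nn) -> (forall v, S v -> v < nn) ->
  exe cmain [::] st0 aOK 0 0 != 0 <-> exists D, good adj S nn D.
Proof.
move=> hadj hS adj_lt S_lt; rewrite /cmain exec_seq exec_for.
set s0 := exe cinit _ st0.
have mulE m q : m <= N -> \sum_(x < N) (if m - x != 0 then q else 0) = m * q.
  move=> hm; rewrite -(big_mkord xpredT (fun x => if m - x != 0 then q else 0)).
  rewrite (big_cat_nat (n := m)) //=.
  rewrite [X in X + _](eq_big_nat _ _ (F2 := fun=> q)); last first.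
    by move=> x /andP[_ hx]; rewrite subn_eq0 leqNgt hx.
  rewrite sum_nat_const_nat subn0 big_nat big1 ?addn0 // => x /andP[hx _].
  by rewrite ifF //; lia.
have nN' : nn <= N by apply: leq_trans nN; apply: leq_addr.
have ea : adjst s0 = adj.
  apply: functional_extensionality => u; apply: functional_extensionality => v.
  rewrite /adjst /s0 /cinit !exec_seq exec_frame // exec_frame // exec_frame //.
  rewrite exec_asg upd_same.
  rewrite -[evl _ _ _]/(if nn - u != 0 then if nn - v != 0 then
     inp (2 + (\sum_(x < N) (if u - x != 0 then nn else 0) + v)) else 0 else 0).
  rewrite !subn_eq0 -!ltnNge.
  case: ltnP => hu; last by apply/esym/negP => /adj_lt[]; lia.
  case: ltnP => hv; last by apply/esym/negP => /adj_lt[]; lia.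
  by rewrite mulE ?hadj //; lia.
have es : sst s0 = S.
  apply: functional_extensionality => v.
  rewrite /sst /s0 /cinit !exec_seq.
  set sA := exe (CAsg aADJ _) _ _.
  rewrite exec_frame // exec_frame // exec_asg upd_same.
  rewrite -[evl _ _ _]/(if nn - v != 0 then
     inp (2 + (\sum_(x < N) (if nn - x != 0 then nn else 0) + v)) else 0).
  rewrite subn_eq0 -ltnNge; case: ltnP => hv; last by apply/esym/negP => /S_lt; lia.
  by rewrite mulE ?hS.
(* The loop runs up to [N], past the last vertex, hence [minn m nn]. *)
pose P m s := [/\ adjst s = adj, sst s = S,
   s aOK 0 0 != 0 -> good adj S (minn m nn) (vs s aSOL) &
   (exists D, good adj S nn D) -> s aOK 0 0 != 0].
(* A solution of the whole graph also solves the subgraph on any initial segment of the vertices, so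
   a single failed round settles the answer. *)
have good_le b b' D : b <= b' -> good adj S b' D -> good adj S b D.
  move=> hbb [h1 h2]; split=> // h; apply: h2; apply: vbad_sub h => v hv hD; split=> //.
  exact: leq_trans hv hbb.
suff [_ _ h1 h2] : P N (iteri N (fun i => exe (CIf (ELt (EV 0) eN) citer) [:: i]) s0).
  split; last exact: h2.
  by move=> /h1 h; exists (vs (iteri N (fun i => exe (CIf (ELt (EV 0) eN) citer) [:: i]) s0) aSOL); move: h; rewrite (minn_idPr nN').
apply: (iteri_ind (P := P)).
  split=> //; rewrite min0n => _.
  have -> : vs s0 aSOL = set0.
    by rewrite /s0 /cinit !exec_seq vs_frame // vs_asg_zero.
  split; first by rewrite cards0.
  by case=> s [y [_]]; rewrite /vrel ltn0.
move=> i s hi [h1 h2 h3 h4]; rewrite exec_if.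
rewrite -[evl _ _ _]/(nn - i) subn_eq0 -ltnNge; case: ltnP => hin; last first.
  by split=> //; move=> /h3; rewrite !(minn_idPr _) //; apply: leq_trans hin _.
have [||c1 c2 c3 c4] := @exec_citer [::] i s hin; rewrite ?h1 ?h2 //.
rewrite h1 h2 in c3 c4.
have [a1 a2] : (minn i nn = i) /\ (minn i.+1 nn = i.+1) by split; apply/minn_idPl; lia.
rewrite a1 in h3; split.
- by rewrite /adjst c1.
- by rewrite /sst c2.
- by rewrite a2.
- move=> [D hD]; have hok := h4 (ex_intro _ D hD); apply: c4 => //; first exact: h3.
  by exists D; apply: good_le hD.
Qed.

End Correct.

(** * From the encoded instance to numbered vertices *)

Section Instance.
Variables (V : finType) (e : rel V) (S : {set V}) (k : nat).
Let n := #|V|.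
Let N := (side n ^ 3)%N.
Let inp := nth 0 (encode e S k).

Lemma nth_allpairs (A B : Type) (f : A -> B -> nat) s t (x0 : A) (y0 : B) i j :
  i < size s -> j < size t ->
  nth 0 [seq f x y | x <- s, y <- t] (i * size t + j) = f (nth x0 s i) (nth y0 t j).
Proof.
move=> hi hj; elim: s i hi => [//|a s IH] [|i] hi; rewrite allpairs_cons nth_cat size_map.
  by rewrite mul0n add0n hj (nth_map y0).
rewrite ltnNge mulSn -addnA leq_addr /= addKn; exact: IH.
Qed.

Lemma inp_adj (x y : V) :
  inp (2 + (enum_rank x * n + enum_rank y)) = e x y.
Proof.
rewrite /inp /encode [nth _ _ _]/= nth_cat size_allpairs -!cardE -/n.
have hx := ltn_ord (enum_rank x); have hy := ltn_ord (enum_rank y); rewrite -/n in hx hy.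
have -> : enum_rank x * n + enum_rank y < n * n.
  have h : (enum_rank x).+1 * n <= n * n by rewrite leq_mul2r hx orbT.
  by apply: leq_trans h; rewrite mulSn addnC ltn_add2r.
have := nth_allpairs (fun x y => nat_of_bool (e x y)) (s := enum V) (t := enum V) x y.
by rewrite -!cardE -/n => ->; rewrite // !nth_enum_rank.
Qed.

Lemma inp_set (x : V) : inp (2 + (n * n + enum_rank x)) = (x \in S).
Proof.
rewrite /inp /encode [nth _ _ _]/= nth_cat size_allpairs -!cardE -/n.
rewrite !add0n ltnNge leq_addr addKn (nth_map x) ?nth_enum_rank //.
by rewrite -cardE.
Qed.

Let adj : rel nat := fun u v => [&& u < n, v < n & inp (2 + (u * n + v)) != 0].
Let Sn : pred nat := fun v => (v < n) && (inp (2 + (n * n + v)) != 0).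

Lemma n_le_N : n <= N.
Proof.
apply: leq_trans (_ : side n <= _); first by rewrite /side; lia.
by rewrite -{1}[side n]expn1 leq_pexp2l // /side addn_gt0 orbT.
Qed.

Let phi (x : V) : 'I_N := widen_ord n_le_N (enum_rank x).

Lemma phi_inj : injective phi.
Proof. by move=> x y /(congr1 val) /= /ord_inj/enum_rank_inj. Qed.

Lemma phi_lt x : phi x < n. Proof. exact: ltn_ord (enum_rank x). Qed.

Lemma phi_onto (u : 'I_N) : u < n -> exists x, u = phi x.
Proof.
by move=> hu; exists (enum_val (Ordinal hu)); apply: val_inj; rewrite /= enum_valK.
Qed.

Lemma adj_phi x y : adj (phi x) (phi y) = e x y.
Proof. by rewrite /adj !phi_lt /= inp_adj; case: (e x y). Qed.

Lemma Sn_phi x : Sn (phi x) = (x \in S).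
Proof. by rewrite /Sn phi_lt /= inp_set; case: (x \in S). Qed.

Lemma closed_walkP (r : rel V) :
  has_closed_walk_through r S <-> exists x y, [/\ x \in S, r x y & connect r y x].
Proof.
split=> [[p hp [x xS xp]]|[x [y [xS xy /connectP[q hq ex]]]]].
  have [i p' ep] := rot_to xp; move: hp; rewrite -(rot_cycle i) ep /=.
  case: p' ep => [|y p'] ep /=; first by rewrite andbT => xx; exists x, x.
  case/andP=> xy; rewrite rcons_path => /andP[hp' lx]; exists x, y; split=> //.
  apply: connect_trans (connect1 lx); apply/connectP; by exists p'.
exists (y :: q); last by exists x => //; rewrite ex mem_last.
by rewrite /= rcons_path hq -ex.
Qed.

Lemma vbad_walk (D : {set 'I_N}) (T : {set V}) : T = [set x | phi x \in D] ->
  vbad adj Sn n D <-> has_closed_walk_through (delete_vertices e T) S.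
Proof.
move=> eT.
have eg x y : vrel adj n D (phi x) (phi y) = delete_vertices e T x y.
  by rewrite /vrel /delete_vertices /= !phi_lt adj_phi eT !inE.
have up x y : connect (delete_vertices e T) x y -> connect (vrel adj n D) (phi x) (phi y).
  move=> /connectP[p hp ->]; elim: p x hp => [|z p IH] x /=; first by rewrite connect0.
  by move=> /andP[xz /IH]; apply: connect_trans; apply: connect1; rewrite eg.
have down x z : connect (vrel adj n D) (phi x) z ->
    exists2 y, z = phi y & connect (delete_vertices e T) x y.
  move=> /connectP[p hp ->]; elim: p x hp => [|w p IH] x /=; first by exists x.
  move=> /andP[xw hp]; have [w' ew] : exists w', w = phi w'.
    by apply: phi_onto; case/and5P: xw.
  rewrite ew in xw hp *; have [y ey wy] := IH _ hp; exists y => //.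
  by apply: connect_trans wy; apply: connect1; rewrite -eg.
rewrite closed_walkP; split=> [[s [y [hs sy ys]]]|[x [y [xS xy yx]]]].
  have [x ex] : exists x, s = phi x by apply: phi_onto; case/andP: hs.
  have [y' ey] : exists y', y = phi y' by apply: phi_onto; case/and5P: sy.
  rewrite ex ey in hs sy ys; exists x, y'; split.
  - by rewrite -Sn_phi.
  - by rewrite -eg.
  - by have [x' /phi_inj <-] := down _ _ ys.
by exists (phi x), (phi y); rewrite Sn_phi eg; split=> //; apply: up.
Qed.

(** No set of vertices has more than [n] elements, so truncating the parameter to [n] loses no
    solution. *)
Lemma subset_dfvs_good :
  subset_dfvs e S k <-> exists D : {set 'I_N}, good inp adj Sn n D.
Proof.
split=> [[T [cT hT]]|[D [cD hD]]].
  have eT : T = [set x | phi x \in phi @: T].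
    by apply/setP => x; rewrite inE mem_imset //; apply: phi_inj.
  exists (phi @: T); split; last by move/(vbad_walk eT).
  rewrite card_imset; last exact: phi_inj.
  have : #|T| <= n by apply: max_card.
  by rewrite /inp /=; rewrite -/n; lia.
exists [set x | phi x \in D]; split; last by move/(vbad_walk (erefl _)).
rewrite -(card_imset _ phi_inj); apply: leq_trans (_ : #|D| <= _).
  by apply/subset_leq_card/subsetP => u /imsetP[x]; rewrite inE => xD ->.
by apply: leq_trans cD _; apply: leq_subr.
Qed.

End Instance.

(** * The time bound in terms of the input size *)

Lemma run_more P t t' s s' : t <= t' -> run P t s = Some s' -> run P t' s = Some s'.
Proof.
elim: t t' s => [|t IH] [|t'] s //=; case: onth => // i; exact: IH.
Qed.

Lemma size_le_bit_size s : size s <= bit_size s.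
Proof.
rewrite /bit_size; elim: s => [|a s IH]; rewrite ?big_nil // big_cons /=.
by rewrite addSn ltnS (leq_trans IH) ?leq_addl.
Qed.

Lemma leq_side m n : m <= n -> side m <= side n.
Proof. by rewrite /side; lia. Qed.

Lemma side_le m : 0 < m -> side m <= 12 * m.
Proof. by rewrite /side; lia. Qed.

Theorem theorem1 :
  exists (P : program) (f g : nat -> nat),
    [/\ bigO f (fun k => k ^ 3), polynomially_bounded g &
        forall (V : finType) (e : rel V) (S : {set V}) (k : nat), 0 < k ->
          decides_within P (encode e S k) (subset_dfvs e S k)
            (2 ^ f k * g (bit_size (encode e S k)))].
Proof.
have [hw h1] := andP cmain_wf.
have [P [K [d HP]]] := ram_implements hw h1 (isT : 0 < aOK < 32).
exists P, (fun k => side k ^ 3), (fun x => K * side x ^ d); split.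
(* The constant 12 is [side 1]. *)
- exists (12 ^ 3), 1 => k k0; rewrite -expnMn leq_exp2r //; exact: side_le.
- exists d, (K * 12 ^ d), 1 => x x0; rewrite -mulnA -expnMn leq_mul2l; apply/orP; right.
  by case: (d) => // d'; rewrite leq_exp2r //; apply: side_le.
move=> V e S k k0; set n := #|V|.
pose rest := [seq nat_of_bool (e x y) | x <- enum V, y <- enum V] ++
    [seq nat_of_bool (x \in S) | x <- enum V].
have sz : size rest = n * n + n by rewrite size_cat size_allpairs size_map -cardE.
have [st0 [s [hr hs]]] := HP n k rest sz.
have n_size : n <= bit_size (encode e S k).
  apply: leq_trans (size_le_bit_size _).
  by rewrite (_ : size _ = (size rest).+2) // sz; lia.
exists s.
  apply: run_more hr; apply: leq_mul.
    by rewrite leq_pexp2l // leq_exp2r // leq_side // geq_minl.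
  rewrite leq_mul2l; apply/orP; right; case: (d) => // d'; rewrite leq_exp2r //.
  exact: leq_side.
rewrite hs; apply: iff_trans (iff_sym (subset_dfvs_good e S k)).
have side_n : 8 <= side n by rewrite /side; lia.
have side_N : side n * 8 <= side n ^ 3.
  by rewrite expnSr leq_mul // -{1}[side n]expn1 leq_pexp2l //; lia.
have side_kk : side (k - (k - n)) <= side n by apply: leq_side; lia.
apply: exec_cmain.
- by lia.
- by rewrite /=; move: side_N; rewrite /side -/n; lia.
- by rewrite /= -/n; lia.
- by rewrite /= -/n leq_exp2r.
- by rewrite /= -/n minnE.
- by move=> u v /= hu hv; rewrite hu hv.
- by move=> v /= hv; rewrite hv.
- by move=> u v /and3P[].
- by move=> v /andP[].
Qed.
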